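(* $$L(f,4)=\frac{\pi^{3}}{288}\left(3\,F^{1;3;2}_{1;2;1}\left[\left.\begin{matrix}\tfrac12\\ \tfrac32\end{matrix};\begin{matrix}1,1,1\\ \tfrac32,\tfrac32\end{matrix};\begin{matrix}\tfrac12,\tfrac12\\ 1\end{matrix}\right|1,1\right]+F^{1;3;2}_{1;2;1}\left[\left.\begin{matrix}\tfrac32\\ \tfrac52\end{matrix};\begin{matrix}1,1,1\\ \tfrac32,\tfrac32\end{matrix};\begin{matrix}\tfrac12,\tfrac12\\ 1\end{matrix}\right|1,1\right]\right).$$
   Context: For $|q|<1$ let $\theta_2(q)=\sum_{n\in\mathbb Z}q^{(n+1/2)^2}$, $\theta_3(q)=\sum_{n\in\mathbb Z}q^{n^2}$, $\theta_4(q)=\sum_{n\in\mathbb Z}(-1)^nq^{n^2}$. Let $f(q)=\frac1{16}\theta_2^4(q)\theta_4^2(q)=\sum_{n\ge0}a_nq^n$ and $L(f,s)=\sum_{n\ge1}a_nn^{-s}$ (analytically continued). $(a)_n=\Gamma(a+n)/\Gamma(a)$. The Kampé de Fériet function is $$F^{A;B;B'}_{C;D;D'}\left[\left.\begin{matrix}a_1,\dots,a_A\\ c_1,\dots,c_C\end{matrix};\begin{matrix}b_1,\dots,b_B\\ d_1,\dots,d_D\end{matrix};\begin{matrix}b'_1,\dots,b'_{B'}\\ d'_1,\dots,d'_{D'}\end{matrix}\right|x,y\right]=\sum_{m,n\ge0}\frac{\prod_i(a_i)_{m+n}\prod_i(b_i)_m\prod_i(b'_i)_n}{\prod_i(c_i)_{m+n}\prod_i(d_i)_m\prod_i(d'_i)_n}\frac{x^my^n}{m!\,n!},$$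 which converges absolutely at $x=y=1$ for the parameters used here. *)

(* Defs.v *)
From Stdlib Require Import Reals ZArith List Lra.
Open Scope R_scope.

Definition zrange (N : nat) : list Z :=
  map (fun i => (Z.of_nat i - Z.of_nat N)%Z) (seq 0 (2 * N + 1)).

Definition zsum (N : nat) (g : Z -> Z) : Z :=
  fold_right Z.add 0%Z (map g (zrange N)).

(* 16 * a_n, where f(q) = (1/16) theta_2(q)^4 theta_4(q)^2 = sum a_n q^n.
   Expanding the product of the six theta series, the coefficient of q^n is
   sum over (m1,..,m4,k1,k2) in Z^6 with
   (m1+1/2)^2+..+(m4+1/2)^2 + k1^2 + k2^2 = n  of  (-1)^(k1+k2),
   i.e. (2m1+1)^2+..+(2m4+1)^2 + 4k1^2 + 4k2^2 = 4n.  Every solution has all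
   coordinates in [-n, n], so the finite sum below is the full coefficient. *)
Definition theta_coef16 (n : nat) : Z :=
  let N := n in
  zsum N (fun m1 => zsum N (fun m2 => zsum N (fun m3 => zsum N (fun m4 =>
  zsum N (fun k1 => zsum N (fun k2 =>
    if Z.eqb ((2*m1+1)^2 + (2*m2+1)^2 + (2*m3+1)^2 + (2*m4+1)^2
              + 4*k1^2 + 4*k2^2)%Z (4 * Z.of_nat n)%Z
    then (if Z.even (k1 + k2) then 1%Z else (-1)%Z)
    else 0%Z)))))).

Definition a_coef (n : nat) : R := IZR (theta_coef16 n) / 16.

(* L(f,s) at s = 4 is given by the (absolutely convergent, since a_n = O(n^2))
   Dirichlet series sum_{n>=1} a_n n^{-4}. *)
Definition L_f_4_is (l : R) : Prop :=
  infinite_sum (fun k => a_coef (S k) / (INR (S k)) ^ 4) l.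

Fixpoint poch (a : R) (n : nat) : R :=
  match n with
  | O => 1
  | S k => poch a k * (a + INR k)
  end.

Definition prodl (l : list R) (g : R -> R) : R :=
  fold_right Rmult 1 (map g l).

Definition kdf_term (as_ cs bs ds bs' ds' : list R) (x y : R) (m n : nat) : R :=
  prodl as_ (fun a => poch a (m + n)) * prodl bs (fun b => poch b m)
    * prodl bs' (fun b => poch b n)
  / (prodl cs (fun c => poch c (m + n)) * prodl ds (fun d => poch d m)
     * prodl ds' (fun d => poch d n))
  * (x ^ m * y ^ n) / (INR (fact m) * INR (fact n)).

(* Value of a double series sum_{m,n>=0} T m n (absolutely convergent in our
   use), as the limit of its square partial sums. *)
Definition double_sum_is (T : nat -> nat -> R) (S : R) : Prop :=
  Un_cv (fun N => sum_f_R0 (fun m => sum_f_R0 (fun n => T m n) N) N) S.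

Definition kdf_is (as_ cs bs ds bs' ds' : list R) (x y S : R) : Prop :=
  double_sum_is (kdf_term as_ cs bs ds bs' ds' x y) S.

(* Main.v *)
(* Up to sign the form f is an Eisenstein series: a_n is (-1)^(n-1) times the sum of (-1)^j d^2 over
   d (2j+1) = n. Hence L(f,4) = eta(2) beta(4) = pi^2/12 * beta(4). For the coefficients, the
   convolution of theta_4 with 1/cosh satisfies the functional equation of q^(N^2), which expresses
   the Lambert series of f through theta_3, theta_4 and their derivatives; the remaining two ratios
   (two and four squares) are invariant under q -> q^2 and tend to 1 as q -> 0, so they equal 1.

   With b_n = (1/2)_n / n! and w_m = m! / (3/2)_m, the two Kampe de Feriet series are
   sum w_m^2 M_m and 3 sum w_m^2 M_(m+1), where M_m = sum_n b_n^2 / (2m+2n+1) is a moment of the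
   complete elliptic integral. Expanding M_m in Legendre polynomials makes the second series
   telescope to pi lambda(3)/2 - beta(4), up to the factor 12/pi. For the first, integrating power
   series in sin v over [0, pi/2] and substituting z = tan(v/2) gives the sum of
   chi(b) / (a b^2 (a+b)) over odd a, b > 0, which partial fractions evaluate as
   3/2 beta(4) - pi/4 lambda(3). In 3 F1 + F2 the terms in lambda(3) = sum 1/a^3 cancel. *)

Require Import Defs.
From Stdlib Require Import Reals List ZArith Lra Lia Psatz Classical ClassicalEpsilon Permutation.
From Coquelicot Require Import Coquelicot.
Open Scope R_scope.

(** Multiple sums are unordered sums over arbitrary index types, so that reindexing, Fubini and
    Tonelli take one form for naturals, integers, pairs and sextuples. Ordered partial sums return
    for telescoping and for the conditionally convergent series behind the partial fractions.
    Integrals enter only through antiderivatives, compared by their derivatives. The moments M_m are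
    defined by their series and the Legendre integrals by their product recursion; an integral
    identity then becomes a recurrence with a telescoping certificate, the boundary values often
    coming from Wallis' product. The first series needs its own route: M_m equals (2/pi) b_m times
    the sum over k of w_(m+k) / (2k+1), because both obey the same recurrence. Since w_(m+k) is the
    integral of sin^(2(m+k)+1), the double sum becomes one integral of a product of two series in
    sin v, which are 2 artanh z and twice the inverse tangent integral of z = tan(v/2). The modular
    part is carried out for 0 < q < 1/16: small arguments determine the coefficients of a power
    series, and there the theta series stay close to their constant terms and can be divided by. *)

Ltac inv_ge0 := try apply Rle_ge; left; apply Rinv_0_lt_compat.

(** * Unordered summation *)

Definition lsum {T : Type} (f : T -> R) (l : list T) : R :=
  fold_right (fun x s => f x + s) 0 l.

(** The limit along the net of finite subsets, represented by duplicate-free lists. For real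
    functions this amounts to absolute summability ([hsum_bounded], [hsum_bounded_by]). *)
Definition hsum {T : Type} (f : T -> R) (s : R) : Prop :=
  forall eps, 0 < eps -> exists l0, forall l, NoDup l -> incl l0 l ->
    Rabs (lsum f l - s) < eps.

Lemma lsum_app T (f : T -> R) l1 l2 : lsum f (l1 ++ l2) = lsum f l1 + lsum f l2.
Proof. induction l1; simpl; [|rewrite IHl1]; ring. Qed.

Lemma lsum_perm T (f : T -> R) l1 l2 : Permutation l1 l2 -> lsum f l1 = lsum f l2.
Proof. induction 1; simpl; lra. Qed.

Lemma lsum_eq T (f g : T -> R) l : (forall x, In x l -> f x = g x) -> lsum f l = lsum g l.
Proof.
induction l; simpl; intros H; auto.
rewrite H, IHl; auto.
Qed.

Lemma lsum_le T (f g : T -> R) l : (forall x, In x l -> f x <= g x) -> lsum f l <= lsum g l.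
Proof.
induction l; simpl; intros H; [lra|].
apply Rplus_le_compat; auto.
Qed.

Lemma lsum_plus T (f g : T -> R) l : lsum (fun x => f x + g x) l = lsum f l + lsum g l.
Proof. induction l; simpl; [|rewrite IHl]; ring. Qed.

Lemma lsum_scal T c (f : T -> R) l : lsum (fun x => c * f x) l = c * lsum f l.
Proof. induction l; simpl; [|rewrite IHl]; ring. Qed.

Lemma lsum_minus T (f g : T -> R) l : lsum (fun x => f x - g x) l = lsum f l - lsum g l.
Proof. induction l; simpl; [|rewrite IHl]; ring. Qed.

Lemma lsum_map T U (e : U -> T) (f : T -> R) l : lsum f (map e l) = lsum (fun u => f (e u)) l.
Proof. induction l; simpl; [|rewrite IHl]; ring. Qed.

Lemma lsum_0 T (f : T -> R) l : (forall x, In x l -> f x = 0) -> lsum f l = 0.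
Proof.
induction l; simpl; intros H; auto.
rewrite H, IHl; auto; lra.
Qed.

Lemma lsum_ge0 T (f : T -> R) l : (forall x, In x l -> 0 <= f x) -> 0 <= lsum f l.
Proof. intros H. rewrite <- (lsum_0 _ (fun _ => 0) l); auto. apply lsum_le; auto. Qed.

Lemma list_undup T (l : list T) : exists l', NoDup l' /\ forall x, In x l' <-> In x l.
Proof.
induction l as [|a l [l' [H1 H2]]]; [exists nil; split; [constructor|tauto]|].
destruct (classic (In a l)) as [Ha|Ha].
- exists l'; split; auto. intros x; rewrite H2; simpl; split; auto. intros [<-|]; auto.
- exists (a :: l'); split; [constructor; auto; rewrite H2; auto|].
  intros x; simpl; rewrite H2; tauto.
Qed.

(** The predicate is decided classically, which allows arbitrary propositions and index types. This
    splitting drives most of the list arguments below. *)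
Lemma list_filter T (P : T -> Prop) (l : list T) : NoDup l ->
  exists l1 l2, NoDup l1 /\ NoDup l2 /\ Permutation l (l1 ++ l2) /\
   (forall x, In x l1 <-> In x l /\ P x) /\ (forall x, In x l2 <-> In x l /\ ~ P x).
Proof.
induction l as [|a l IH]; intros Hn.
- exists nil, nil; simpl; repeat split; try constructor; tauto.
- inversion_clear Hn as [|? ? Ha Hl]. destruct (IH Hl) as [l1 [l2 [N1 [N2 [Hp [H1 H2]]]]]].
  destruct (classic (P a)) as [Pa|Pa].
  + exists (a :: l1), l2; repeat split; auto.
    * constructor; auto; rewrite H1; tauto.
    * simpl; constructor; auto.
    * destruct H as [<-|H]; [simpl; auto|]. apply H1 in H. simpl; tauto.
    * destruct H as [<-|H]; [auto|]. apply H1 in H. tauto.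
    * intros [[<-|H] Hx]; simpl; auto. right; apply H1; auto.
    * apply H2 in H; simpl; tauto.
    * apply H2 in H; tauto.
    * intros [[<-|H] Hx]; [tauto|]. apply H2; auto.
  + exists l1, (a :: l2); repeat split; auto.
    * constructor; auto; rewrite H2; tauto.
    * apply Permutation_cons_app; auto.
    * apply H1 in H; simpl; tauto.
    * apply H1 in H; tauto.
    * intros [[<-|H] Hx]; [tauto|]. apply H1; auto.
    * destruct H as [<-|H]; [simpl; auto|]. apply H2 in H. simpl; tauto.
    * destruct H as [<-|H]; [auto|]. apply H2 in H. tauto.
    * intros [[<-|H] Hx]; simpl; auto. right; apply H2; auto.
Qed.

Lemma lsum_incl T (f : T -> R) l1 l2 : (forall x, 0 <= f x) -> NoDup l1 -> NoDup l2 ->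
  incl l1 l2 -> lsum f l1 <= lsum f l2.
Proof.
intros Hf N1 N2 Hi.
destruct (list_filter _ (fun x => In x l1) l2 N2) as [a [b [Na [Nb [Hp [Ha Hb]]]]]].
rewrite (lsum_perm _ _ _ _ Hp), lsum_app.
assert (Permutation l1 a) as Hq.
{ apply NoDup_Permutation; auto. intros x. rewrite Ha. split; [auto|tauto]. }
rewrite (lsum_perm _ _ _ _ Hq).
assert (0 <= lsum f b) by (apply lsum_ge0; auto). lra.
Qed.

Lemma hsum_unique T (f : T -> R) s1 s2 : hsum f s1 -> hsum f s2 -> s1 = s2.
Proof.
intros H1 H2. apply NNPP; intros Hne.
assert (0 < Rabs (s1 - s2) / 2) as He.
{ assert (0 < Rabs (s1 - s2)) by (apply Rabs_pos_lt; lra). lra. }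
destruct (H1 _ He) as [l1 K1]. destruct (H2 _ He) as [l2 K2].
destruct (list_undup _ (l1 ++ l2)) as [l [Hn Hl]].
assert (A1 := K1 l Hn). assert (A2 := K2 l Hn).
specialize (A1 ltac:(intros x Hx; apply Hl, in_or_app; auto)).
specialize (A2 ltac:(intros x Hx; apply Hl, in_or_app; auto)).
assert (Rabs (s1 - s2) <= Rabs (lsum f l - s1) + Rabs (lsum f l - s2)).
{ replace (s1 - s2) with ((lsum f l - s2) - (lsum f l - s1)) by ring.
  eapply Rle_trans; [apply Rabs_triang|]. rewrite Rabs_Ropp. lra. }
lra.
Qed.

Arguments hsum_unique {T f s1 s2}.

Lemma hsum_ext T (f g : T -> R) s : (forall x, f x = g x) -> hsum f s -> hsum g s.
Proof.
intros E H eps He. destruct (H eps He) as [l0 K]. exists l0. intros l Hn Hi.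
rewrite <- (lsum_eq _ f g); auto.
Qed.

Lemma hsum_plus T (f g : T -> R) a b : hsum f a -> hsum g b ->
  hsum (fun x => f x + g x) (a + b).
Proof.
intros H1 H2 eps He.
destruct (H1 (eps/2) ltac:(lra)) as [l1 K1]. destruct (H2 (eps/2) ltac:(lra)) as [l2 K2].
exists (l1 ++ l2). intros l Hn Hi.
specialize (K1 l Hn ltac:(intros x Hx; apply Hi, in_or_app; auto)).
specialize (K2 l Hn ltac:(intros x Hx; apply Hi, in_or_app; auto)).
rewrite lsum_plus.
replace (lsum f l + lsum g l - (a + b)) with ((lsum f l - a) + (lsum g l - b)) by ring.
eapply Rle_lt_trans; [apply Rabs_triang|lra].
Qed.

Lemma hsum_scal T c (f : T -> R) a : hsum f a -> hsum (fun x => c * f x) (c * a).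
Proof.
intros H eps He.
assert (0 < Rabs c + 1) as Hc by (assert (H0 := Rabs_pos c); lra).
destruct (H (eps / (Rabs c + 1)) ltac:(apply Rdiv_lt_0_compat; auto)) as [l0 K].
exists l0. intros l Hn Hi. specialize (K l Hn Hi).
rewrite lsum_scal.
replace (c * lsum f l - c * a) with (c * (lsum f l - a)) by ring.
rewrite Rabs_mult.
apply Rle_lt_trans with ((Rabs c) * (eps / (Rabs c + 1))).
{ apply Rmult_le_compat_l; [apply Rabs_pos|lra]. }
apply Rlt_le_trans with ((Rabs c + 1) * (eps / (Rabs c + 1))); [|right; field; lra].
apply Rmult_lt_compat_r; [apply Rdiv_lt_0_compat; auto|lra].
Qed.

Lemma hsum_minus T (f g : T -> R) a b : hsum f a -> hsum g b ->
  hsum (fun x => f x - g x) (a - b).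
Proof.
intros H1 H2. replace (a - b) with (a + (-1) * b) by ring.
apply hsum_ext with (fun x => f x + (-1) * g x); [intros; ring|].
apply hsum_plus; auto. apply hsum_scal; auto.
Qed.

Lemma hsum_fin T (f : T -> R) l : NoDup l -> (forall x, ~ In x l -> f x = 0) ->
  hsum f (lsum f l).
Proof.
intros Hn Hz eps He. exists l. intros l' Hn' Hi.
destruct (list_filter _ (fun x => In x l) l' Hn') as [a [b [Na [Nb [Hp [Ha Hb]]]]]].
rewrite (lsum_perm _ _ _ _ Hp), lsum_app.
rewrite (lsum_0 _ f b); [|intros x Hx; apply Hb in Hx; apply Hz; tauto].
rewrite (lsum_perm _ f a l).
- rewrite Rplus_0_r, Rminus_diag, Rabs_R0; auto.
- apply NoDup_Permutation; auto. intros x; rewrite Ha; split; [tauto|auto].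
Qed.

Lemma hsum_0 T (f : T -> R) : (forall x, f x = 0) -> hsum f 0.
Proof. intros H. apply (hsum_fin _ f nil); [constructor|auto]. Qed.

Lemma list_preim T U (e : U -> T) (l : list T) :
  (forall u v, e u = e v -> u = v) -> NoDup l ->
  exists l', NoDup l' /\ (forall u, In u l' <-> In (e u) l).
Proof.
intros He. induction l as [|a l IH]; intros Hn.
- exists nil; split; [constructor|simpl; tauto].
- inversion_clear Hn as [|? ? Ha Hl]. destruct (IH Hl) as [l' [N H]].
  destruct (classic (exists u, e u = a)) as [[u Hu]|Hu].
  + exists (u :: l'); split; [constructor; auto; rewrite H, Hu; auto|].
    intros v; simpl; rewrite H; split; [intros [<-|]; auto|].
    intros [Hv|]; auto. left; apply He; congruence.
  + exists l'; split; auto. intros v; rewrite H; simpl; split; auto.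
    intros [Hv|]; auto. contradict Hu; exists v; auto.
Qed.

Lemma NoDup_map_inj T U (e : U -> T) l : (forall u v, e u = e v -> u = v) ->
  NoDup l -> NoDup (map e l).
Proof.
intros He. induction 1; simpl; constructor; auto.
rewrite in_map_iff. intros [y [Hy Iy]]. apply He in Hy; subst; auto.
Qed.

(** The form in which all changes of variables are made: bijections, sublattices, diagonals and
    shifts of the index all arise as an injection whose range contains the support. *)
Lemma hsum_inj T U (e : U -> T) (f : T -> R) s :
  (forall u v, e u = e v -> u = v) -> (forall t, (forall u, e u <> t) -> f t = 0) ->
  hsum (fun u => f (e u)) s <-> hsum f s.
Proof.
intros He Hz. split; intros H eps Heps; destruct (H eps Heps) as [l0 K].
- exists (map e l0). intros l Hn Hi.
  destruct (list_preim _ _ e l He Hn) as [l' [N' H']].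
  replace (lsum f l) with (lsum (fun u => f (e u)) l').
  + apply K; auto. intros u Hu. apply H', Hi, in_map; auto.
  + destruct (list_filter _ (fun t => exists u, e u = t) l Hn) as [a [b [Na [Nb [Hp [Ha Hb]]]]]].
    rewrite (lsum_perm _ _ _ _ Hp), lsum_app.
    rewrite (lsum_0 _ f b).
    2:{ intros x Hx; apply Hb in Hx. apply Hz. intros u Hu. apply (proj2 Hx). exists u; auto. }
    rewrite Rplus_0_r, <- lsum_map. apply lsum_perm, NoDup_Permutation; auto.
    { apply NoDup_map_inj; auto. }
    intros x; rewrite Ha, in_map_iff; split.
    * intros [u [<- Hu]]. split; [apply H'; auto|exists u; auto].
    * intros [Hx [u Hu]]; exists u; split; auto. apply H'; rewrite Hu; auto.
- destruct (list_undup _ l0) as [l0' [N0 H0]].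
  destruct (list_preim _ _ e l0' He N0) as [k [Nk Hk]].
  exists k. intros l Hn Hi.
  destruct (list_filter _ (fun t => exists u, e u = t) l0' N0) as [a [b [Na [Nb [Hp [Ha Hb]]]]]].
  replace (lsum (fun u => f (e u)) l) with (lsum f (map e l ++ b)).
  + apply K.
    * apply NoDup_app; auto; [apply NoDup_map_inj; auto|].
      intros x Hx Hx'. apply Hb in Hx'. apply in_map_iff in Hx. destruct Hx as [u [Hu _]].
      apply (proj2 Hx'); exists u; auto.
    * intros x Hx. apply in_or_app. destruct (classic (exists u, e u = x)) as [[u Hu]|Hu].
      { left. rewrite <- Hu. apply in_map, Hi, Hk. rewrite Hu. apply H0; auto. }
      { right. apply Hb; split; auto. apply H0; auto. }
  + rewrite lsum_app, lsum_map, (lsum_0 _ f b); [ring|].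
    intros x Hx; apply Hb in Hx. apply Hz. intros u Hu. apply (proj2 Hx); exists u; auto.
Qed.

Lemma hsum_bij T U (e : U -> T) (e' : T -> U) (f : T -> R) s :
  (forall u, e' (e u) = u) -> (forall t, e (e' t) = t) ->
  hsum (fun u => f (e u)) s <-> hsum f s.
Proof.
intros H1 H2. apply hsum_inj.
- intros u v H. rewrite <- (H1 u), <- (H1 v), H; auto.
- intros t Ht. exfalso; apply (Ht (e' t)); auto.
Qed.

Definition bounded_by {T} (f : T -> R) (B : R) := forall l, NoDup l -> lsum (fun x => Rabs (f x)) l <= B.

(** For nonnegative terms the supremum of the finite sums is the sum. *)
Lemma hsum_pos_ex T (f : T -> R) B : (forall x, 0 <= f x) ->
  (forall l, NoDup l -> lsum f l <= B) -> exists s, hsum f s /\ s <= B.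
Proof.
intros Hf HB.
destruct (completeness (fun y => exists l, NoDup l /\ y = lsum f l)) as [s [Hs1 Hs2]].
- exists B. intros y [l [Hn ->]]; auto.
- exists 0, nil; split; [constructor|auto].
- exists s; split; [|apply Hs2; intros y [l [Hn ->]]; auto].
  intros eps He.
  assert (exists l, NoDup l /\ s - eps < lsum f l) as [l0 [N0 H0]].
  { apply NNPP; intros H. assert (s <= s - eps); [|lra].
    apply Hs2. intros y [l [Hn ->]]. apply Rnot_lt_le; intros Hl. apply H; exists l; auto. }
  exists l0. intros l Hn Hi.
  assert (lsum f l <= s) by (apply Hs1; exists l; auto).
  assert (lsum f l0 <= lsum f l) by (apply lsum_incl; auto).
  rewrite Rabs_left1; lra.
Qed.

Lemma hsum_pos_le T (f : T -> R) s l : (forall x, 0 <= f x) -> hsum f s -> NoDup l -> lsum f l <= s.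
Proof.
intros Hf H Hn. apply Rnot_lt_le; intros Hl.
destruct (H (lsum f l - s) ltac:(lra)) as [l0 K].
destruct (list_undup _ (l ++ l0)) as [l' [N' H']].
specialize (K l' N' ltac:(intros x Hx; apply H', in_or_app; auto)).
assert (lsum f l <= lsum f l').
{ apply lsum_incl; auto. intros x Hx; apply H', in_or_app; auto. }
rewrite Rabs_right in K; lra.
Qed.

Lemma hsum_bounded T (f : T -> R) B : bounded_by f B -> exists s, hsum f s.
Proof.
intros H.
destruct (hsum_pos_ex _ (fun x => Rabs (f x)) B) as [a [Ha _]]; [intros; apply Rabs_pos|auto|].
destruct (hsum_pos_ex _ (fun x => Rabs (f x) + f x) (2 * B)) as [b [Hb _]].
- intros x; assert (K := Rle_abs (- f x)); rewrite Rabs_Ropp in K; lra.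
- intros l Hn. apply Rle_trans with (lsum (fun x => 2 * Rabs (f x)) l).
  + apply lsum_le; intros x _; assert (K := Rle_abs (f x)); lra.
  + rewrite lsum_scal. specialize (H l Hn). lra.
- exists (b - a). eapply hsum_ext; [|apply (hsum_minus _ _ _ _ _ Hb Ha)]. intros; simpl; ring.
Qed.

(** A finite set disjoint from [l0] changes a sum that stays within 1 of [s], so its own sum is at
    most 2 in modulus. Splitting it by the sign of [f] bounds its absolute values by 4. *)
Lemma hsum_bounded_by T (f : T -> R) s : hsum f s -> exists B, bounded_by f B.
Proof.
intros H. destruct (H 1 ltac:(lra)) as [l0' K0].
destruct (list_undup _ l0') as [l0 [N0 H0]].
assert (forall l, NoDup l -> incl l0 l -> Rabs (lsum f l - s) < 1) as K.
{ intros l Hn Hi. apply K0; auto. intros x Hx; apply Hi, H0; auto. }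
assert (forall l, NoDup l -> (forall x, In x l -> ~ In x l0) -> Rabs (lsum f l) <= 2) as Hd.
{ intros l Hn Hi.
  assert (K1 := K l0 N0 (incl_refl _)).
  assert (K2 := K (l0 ++ l)). rewrite lsum_app in K2.
  specialize (K2 ltac:(apply NoDup_app; auto; intros x Hx Hx'; apply (Hi x); auto) ltac:(apply incl_appl, incl_refl)).
  apply Rabs_def2 in K1. apply Rabs_def2 in K2. apply Rabs_le; lra. }
exists (lsum (fun x => Rabs (f x)) l0 + 4). intros l Hn.
destruct (list_filter _ (fun x => In x l0) l Hn) as [a [b [Na [Nb [Hp [Ha Hb]]]]]].
rewrite (lsum_perm _ _ _ _ Hp), lsum_app. apply Rplus_le_compat.
- apply lsum_incl; auto; [intros; apply Rabs_pos|]. intros x Hx; apply Ha in Hx; tauto.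
- destruct (list_filter _ (fun x => 0 <= f x) b Nb) as [c [d [Nc [Nd [Hq [Hc Hdd]]]]]].
  rewrite (lsum_perm _ _ _ _ Hq), lsum_app.
  rewrite (lsum_eq _ (fun x => Rabs (f x)) f c).
  2:{ intros x Hx; apply Hc in Hx; apply Rabs_right; lra. }
  rewrite (lsum_eq _ (fun x => Rabs (f x)) (fun x => (-1) * f x) d), lsum_scal.
  2:{ intros x Hx; apply Hdd in Hx; rewrite Rabs_left; lra. }
  assert (A1 := Hd c Nc ltac:(intros x Hx; apply Hc in Hx; destruct Hx as [Hx _]; apply Hb in Hx; tauto)).
  assert (A2 := Hd d Nd ltac:(intros x Hx; apply Hdd in Hx; destruct Hx as [Hx _]; apply Hb in Hx; tauto)).
  assert (K1 := Rle_abs (lsum f c)). assert (K2 := Rle_abs (- lsum f d)).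
  rewrite Rabs_Ropp in K2. lra.
Qed.

Lemma hsum_le T (f g : T -> R) a b : (forall x, f x <= g x) -> hsum f a -> hsum g b -> a <= b.
Proof.
intros H Ha Hb. assert (K := hsum_minus _ _ _ _ _ Hb Ha).
assert (lsum (fun x => g x - f x) nil <= b - a).
{ apply hsum_pos_le; auto; [|constructor]. intros x; specialize (H x); lra. }
simpl in *; lra.
Qed.

Lemma hsum_abs_ex T (f : T -> R) s : hsum f s -> exists s', hsum (fun x => Rabs (f x)) s' /\ Rabs s <= s'.
Proof.
intros H. destruct (hsum_bounded_by _ _ _ H) as [B HB].
destruct (hsum_pos_ex _ (fun x => Rabs (f x)) B) as [s' [Hs' _]]; [intros; apply Rabs_pos|auto|].
exists s'; split; auto. apply Rabs_le; split.
- assert (K := hsum_scal _ (-1) _ _ H).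
  assert (-1 * s <= s'); [|lra]. eapply hsum_le; [|exact K|exact Hs'].
  intros x; cbv beta. assert (A := Rle_abs (- f x)). rewrite Rabs_Ropp in A. lra.
- eapply hsum_le; [|exact H|exact Hs']. intros x; apply Rle_abs.
Qed.

Lemma hsum_dom T (f g : T -> R) s : (forall x, Rabs (f x) <= g x) -> hsum g s ->
  exists a, hsum f a /\ Rabs a <= s.
Proof.
intros Hfg Hg.
destruct (hsum_bounded _ f s) as [a Ha].
{ intros l Hn. eapply Rle_trans; [apply (lsum_le _ _ g); auto|].
  apply hsum_pos_le; auto. intros x; eapply Rle_trans; [apply Rabs_pos|apply Hfg]. }
exists a; split; auto.
destruct (hsum_abs_ex _ _ _ Ha) as [s' [Hs' Has]].
eapply Rle_trans; [exact Has|]. eapply hsum_le; [|exact Hs'|exact Hg]. auto.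
Qed.

Lemma hsum_row T U (f : T * U -> R) s t : hsum f s -> exists r, hsum (fun u => f (t, u)) r.
Proof.
intros H. destruct (hsum_bounded_by _ _ _ H) as [B HB].
apply (hsum_bounded _ _ B). intros l Hn.
rewrite <- (lsum_map _ _ (fun u => (t, u)) (fun x => Rabs (f x))).
apply HB, NoDup_map_inj; auto. congruence.
Qed.

Lemma hsum_fubini T U (f : T * U -> R) (r : T -> R) s :
  hsum f s -> (forall t, hsum (fun u => f (t, u)) (r t)) -> hsum r s.
Proof.
intros H Hr eps He. destruct (H (eps/2) ltac:(lra)) as [l0 K].
exists (map fst l0). intros l Hn Hi.
set (d := eps / 2 / (INR (length l) + 1)).
assert (0 < INR (length l) + 1) as Hpos by (assert (A := pos_INR (length l)); lra).
assert (Hd : 0 < d) by (apply Rdiv_lt_0_compat; lra).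
(* [P] is a finite set of pairs over the rows in [l] which contains the relevant part of [l0] and
   exhausts each row up to [d]; the choice of [d] keeps the total row error below half of [eps]. *)
assert (exists P, NoDup P /\ (forall x, In x P -> In (fst x) l) /\
   (forall x, In x l0 -> In (fst x) l -> In x P) /\ Rabs (lsum f P - lsum r l) <= INR (length l) * d)
  as [P [NP [_ [HP1 HP2]]]].
{ clear Hi Hpos. clearbody d. induction l as [|t l IH].
  - exists nil. simpl. split; [constructor|]. split; auto. split; [tauto|].
    rewrite Rminus_diag, Rabs_R0; lra.
  - inversion_clear Hn as [|? ? Ht Hl]. destruct (IH Hl) as [P [NP [P1 [P2 P3]]]].
    destruct (Hr t d Hd) as [m0 Km].
    destruct (list_undup _ (m0 ++ map snd l0)) as [m [Nm Hm]].
    specialize (Km m Nm ltac:(intros x Hx; apply Hm, in_or_app; auto)).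
    exists (map (fun u => (t, u)) m ++ P). repeat split.
    + apply NoDup_app; auto; [apply NoDup_map_inj; auto; congruence|].
      intros x Hx Hx'. apply in_map_iff in Hx. destruct Hx as [u [<- _]].
      apply P1 in Hx'. auto.
    + intros x Hx. apply in_app_or in Hx. destruct Hx as [Hx|Hx]; [|right; auto].
      apply in_map_iff in Hx. destruct Hx as [u [<- _]]; simpl; auto.
    + intros [x u] Hx [Hx'|Hx']; apply in_or_app; [left|right; auto].
      simpl in Hx'; subst x. apply in_map, Hm, in_or_app. right.
      change u with (snd (t, u)). apply in_map; auto.
    + rewrite lsum_app, lsum_map. change (length (t :: l)) with (S (length l)).
      rewrite S_INR. simpl.
      match goal with |- Rabs (?a + ?b - (?c + ?e)) <= _ =>
        replace (a + b - (c + e)) with ((a - c) + (b - e)) by ring end.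
      eapply Rle_trans; [apply Rabs_triang|]. lra. }
specialize (K P NP ltac:(intros x Hx; apply HP1; auto; apply Hi, in_map; auto)).
replace (lsum r l - s) with ((lsum f P - s) - (lsum f P - lsum r l)) by ring.
eapply Rle_lt_trans; [apply Rabs_triang|]. rewrite Rabs_Ropp.
assert (INR (length l) * d <= eps / 2).
{ apply Rle_trans with ((INR (length l) + 1) * d); [nra|]. unfold d. right; field; lra. }
lra.
Qed.

Lemma hsum_swap T U (f : T * U -> R) s : hsum f s -> hsum (fun x => f (snd x, fst x)) s.
Proof.
apply (hsum_bij _ _ (fun x : U * T => (snd x, fst x)) (fun x => (snd x, fst x)));
intros []; auto.
Qed.

(** A finite set of pairs is bounded by the row sums over its first projection, hence by [s]. This
    gives summability, and [hsum_fubini] then identifies the value. *)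
Lemma hsum_tonelli T U (f : T * U -> R) (r : T -> R) s :
  (forall x, 0 <= f x) -> (forall t, hsum (fun u => f (t, u)) (r t)) -> hsum r s -> hsum f s.
Proof.
intros Hf Hr Hs.
assert (forall t, 0 <= r t) as Hr0.
{ intros t. change 0 with (lsum (fun u => f (t, u)) nil).
  apply hsum_pos_le; auto. constructor. }
assert (forall K, NoDup K -> forall P, NoDup P -> (forall x, In x P -> In (fst x) K) ->
   lsum f P <= lsum r K) as HK.
{ induction K as [|t K IH]; intros NK P NP HP.
  - destruct P as [|x P]; [simpl; lra|]. destruct (HP x); simpl; auto.
  - inversion_clear NK as [|? ? Ht NK'].
    destruct (list_filter _ (fun x => fst x = t) P NP) as [a [b [Na [Nb [Hp [Ha Hb]]]]]].
    rewrite (lsum_perm _ _ _ _ Hp), lsum_app. simpl. apply Rplus_le_compat.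
    + destruct (list_preim _ _ (fun u : U => (t, u)) a ltac:(congruence) Na) as [m [Nm Hm]].
      rewrite (lsum_perm _ f a (map (fun u => (t, u)) m)).
      * rewrite lsum_map. apply hsum_pos_le; auto.
      * apply NoDup_Permutation; auto; [apply NoDup_map_inj; auto; congruence|].
        intros [x u]. rewrite in_map_iff. split.
        { intros Hx. assert (x = t) by (apply Ha in Hx; simpl in Hx; tauto). subst x.
          exists u; split; auto. apply Hm; auto. }
        { intros [u' [<- Hu]]. apply Hm; auto. }
    + apply IH; auto. intros x Hx. apply Hb in Hx. destruct Hx as [Hx Hx'].
      destruct (HP x Hx); [congruence|auto]. }
destruct (hsum_pos_ex _ f s Hf) as [s' [Hs' _]].
- intros P NP. destruct (list_undup _ (map fst P)) as [K [NK HK']].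
  apply Rle_trans with (lsum r K); [|apply hsum_pos_le; auto].
  apply HK; auto. intros x Hx. apply HK', in_map; auto.
- rewrite (hsum_unique Hs (hsum_fubini _ _ f r s' Hs' Hr)). auto.
Qed.

Lemma hsum_mul T U (f : T -> R) (g : U -> R) a b : hsum f a -> hsum g b ->
  hsum (fun x => f (fst x) * g (snd x)) (a * b).
Proof.
intros Ha Hb.
destruct (hsum_abs_ex _ _ _ Ha) as [a' [Ha' _]].
destruct (hsum_abs_ex _ _ _ Hb) as [b' [Hb' _]].
destruct (hsum_dom _ (fun x : T * U => f (fst x) * g (snd x)) (fun x => Rabs (f (fst x)) * Rabs (g (snd x))) (a' * b')) as [s [Hs _]].
- intros x; rewrite Rabs_mult; lra.
- apply (hsum_tonelli _ _ _ (fun t => Rabs (f t) * b')).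
  + intros x; apply Rmult_le_pos; apply Rabs_pos.
  + intros t; simpl. apply hsum_scal; auto.
  + rewrite Rmult_comm. eapply hsum_ext; [|apply hsum_scal, Ha']. intros; simpl; ring.
- assert (hsum (fun t => f t * b) s) as H1.
  { apply (hsum_fubini _ _ _ _ _ Hs). intros t; simpl. apply hsum_scal; auto. }
  assert (hsum (fun t => f t * b) (a * b)) as H2.
  { rewrite Rmult_comm. eapply hsum_ext; [|apply hsum_scal, Ha]. intros; simpl; ring. }
  rewrite (hsum_unique H2 H1); auto.
Qed.

Arguments hsum_mul {T U f g a b}.

(** The function is placed on the graph of [phi] inside [U * T], where [hsum_fubini] sums it along
    the fibres. It collects equal exponents of q and equal values of n in Dirichlet series. *)
Lemma hsum_fibers T U (dec : forall u v : U, {u = v} + {u <> v}) (phi : T -> U) (f : T -> R) r s :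
  hsum f s -> (forall u, hsum (fun t => if dec (phi t) u then f t else 0) (r u)) -> hsum r s.
Proof.
intros H Hr.
set (F := fun x : U * T => if dec (phi (snd x)) (fst x) then f (snd x) else 0).
apply (hsum_fubini _ _ F); [|exact Hr].
apply (hsum_inj _ _ (fun t => (phi t, t)) F).
- congruence.
- intros [u t] Hu. unfold F; simpl. destruct (dec (phi t) u) as [E|]; auto.
  exfalso; apply (Hu t). congruence.
- eapply hsum_ext; [|exact H]. intros t; unfold F; simpl. destruct (dec (phi t) (phi t)); tauto.
Qed.

Lemma lsum_seq (f : nat -> R) N : lsum f (seq 0 (S N)) = sum_f_R0 f N.
Proof.
induction N; [simpl; ring|].
rewrite seq_S, lsum_app, IHN. simpl. ring.
Qed.

Lemma list_nat_bound (l : list nat) : exists N, forall n, In n l -> (n <= N)%nat.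
Proof.
exists (list_max l). apply Forall_forall, list_max_le. lia.
Qed.

Lemma hsum_infinite_sum (f : nat -> R) s : hsum f s -> infinite_sum f s.
Proof.
intros H eps He. destruct (H eps He) as [l0 K].
destruct (list_nat_bound l0) as [N HN]. exists N. intros n Hn.
rewrite <- lsum_seq. apply K; [apply seq_NoDup|].
intros x Hx. apply in_seq. specialize (HN x Hx). lia.
Qed.

Lemma lsum_prod T U (f : T * U -> R) l1 l2 :
  lsum f (list_prod l1 l2) = lsum (fun m => lsum (fun n => f (m, n)) l2) l1.
Proof. induction l1; simpl; auto. rewrite lsum_app, lsum_map, IHl1; auto. Qed.

Lemma NoDup_prod A B (l1 : list A) (l2 : list B) : NoDup l1 -> NoDup l2 -> NoDup (list_prod l1 l2).
Proof.
intros H1 H2. induction H1 as [|x l Hx Hl IH]; simpl; [constructor|].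
apply NoDup_app; auto; [apply NoDup_map_inj; auto; congruence|].
intros [a b] Ha Hb. apply in_map_iff in Ha. destruct Ha as [y [E _]]. inversion E; subst.
apply in_prod_iff in Hb. tauto.
Qed.

Lemma hsum_double_sum (f : nat * nat -> R) s : hsum f s -> double_sum_is (fun m n => f (m, n)) s.
Proof.
intros H eps He. destruct (H eps He) as [l0 K].
destruct (list_nat_bound (map fst l0)) as [N1 H1].
destruct (list_nat_bound (map snd l0)) as [N2 H2].
exists (max N1 N2). intros n Hn.
replace (sum_f_R0 _ n) with (lsum f (list_prod (seq 0 (S n)) (seq 0 (S n)))).
- apply K; [apply NoDup_prod; apply seq_NoDup|].
  intros [x y] Hx. apply in_prod; apply in_seq.
  + specialize (H1 x (in_map fst _ _ Hx)). lia.
  + specialize (H2 y (in_map snd _ _ Hx)). lia.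
- rewrite lsum_prod, lsum_seq. apply sum_eq. intros i Hi. rewrite lsum_seq. auto.
Qed.

Lemma infinite_sum_hsum (f : nat -> R) s : (forall n, 0 <= f n) -> infinite_sum f s -> hsum f s.
Proof.
intros Hf H.
assert (forall N, sum_f_R0 f N <= s) as Hb.
{ intros N. apply (growing_ineq (fun N => sum_f_R0 f N)).
  - intros n; simpl. specialize (Hf (S n)). lra.
  - exact H. }
destruct (hsum_pos_ex _ f s Hf) as [s' [Hs' _]].
- intros l Hn. destruct (list_nat_bound l) as [N HN].
  apply Rle_trans with (lsum f (seq 0 (S N))); [|rewrite lsum_seq; auto].
  apply lsum_incl; auto; [apply seq_NoDup|].
  intros x Hx; apply in_seq; specialize (HN x Hx); lia.
- replace s with s'; auto. apply (uniqueness_sum f); auto. apply hsum_infinite_sum; auto.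
Qed.

Lemma hsum_Z (f : Z -> R) a b : hsum (fun n => f (Z.of_nat n)) a ->
  hsum (fun n => f (- Z.of_nat n - 1)%Z) b -> hsum f (a + b).
Proof.
intros Ha Hb.
apply hsum_ext with (fun z => (if Z_le_dec 0 z then f z else 0) + (if Z_le_dec 0 z then 0 else f z)).
{ intros z; destruct (Z_le_dec 0 z); ring. }
apply hsum_plus.
- apply (hsum_inj _ _ Z.of_nat); [lia| |].
  + intros t Ht. destruct (Z_le_dec 0 t); auto. exfalso; apply (Ht (Z.to_nat t)). lia.
  + eapply hsum_ext; [|exact Ha]. intros n; simpl. destruct (Z_le_dec 0 (Z.of_nat n)); auto; lia.
- apply (hsum_inj _ _ (fun n => (- Z.of_nat n - 1)%Z)); [lia| |].
  + intros t Ht. destruct (Z_le_dec 0 t); auto. exfalso; apply (Ht (Z.to_nat (-t-1))). lia.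
  + eapply hsum_ext; [|exact Hb]. intros n; simpl. destruct (Z_le_dec 0 (- Z.of_nat n - 1)); auto; lia.
Qed.

(** * Theta series *)

(** A total function by choice; its value means something only where a sum exists, which each of the
    lemmas named [_spec] establishes. *)
Definition tsum {T : Type} (f : T -> R) : R := epsilon (inhabits 0) (hsum f).

Lemma tsum_spec T (f : T -> R) : (exists s, hsum f s) -> hsum f (tsum f).
Proof. intros H. apply (epsilon_spec (inhabits 0) (hsum f) H). Qed.

Definition sg (m : Z) : R := if Z.even m then 1 else -1.

Lemma sg_add m n : sg (m + n) = sg m * sg n.
Proof. unfold sg. rewrite Z.even_add. destruct (Z.even m), (Z.even n); simpl; ring. Qed.

Lemma sg_opp m : sg (- m) = sg m.
Proof. unfold sg. rewrite Z.even_opp. auto. Qed.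

Lemma sg_sqr m : sg m * sg m = 1.
Proof. unfold sg. destruct (Z.even m); ring. Qed.

Lemma sg_abs m : Rabs (sg m) = 1.
Proof. unfold sg. destruct (Z.even m); [apply Rabs_R1|]. rewrite Rabs_left; lra. Qed.

Lemma sg_1 m : sg (m + 1) = - sg m.
Proof. rewrite sg_add. unfold sg at 2. simpl. ring. Qed.

Lemma sg_double m : sg (2 * m) = 1.
Proof. unfold sg. rewrite Z.even_mul. auto. Qed.

Lemma sg_pow j : sg (Z.of_nat j) = (-1) ^ j.
Proof.
induction j; [auto|]. replace (Z.of_nat (S j)) with (Z.of_nat j + 1)%Z by lia.
rewrite sg_1, IHj. simpl. ring.
Qed.

Lemma sg_even m n : sg (m + n) <> -1 -> exists a b, (m = a + b /\ n = a - b)%Z.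
Proof.
unfold sg. destruct (Z.even (m + n)) eqn:E; [|tauto]. intros _.
apply Z.even_spec in E. destruct E as [a Ha]. exists a, (m - a)%Z. lia.
Qed.

Lemma sg_odd m n : sg (m + n) <> 1 -> exists a b, (m = a + b + 1 /\ n = a - b)%Z.
Proof.
unfold sg. destruct (Z.even (m + n)) eqn:E; [tauto|]. intros _.
rewrite <- Z.negb_odd in E. apply Bool.negb_false_iff, Z.odd_spec in E.
destruct E as [a Ha]. exists a, (a - n)%Z. lia.
Qed.

Lemma geom_nat x : 0 <= x < 1 -> hsum (fun n => x ^ n) (/ (1 - x)).
Proof.
intros Hx. apply infinite_sum_hsum.
- intros n; apply pow_le; lra.
- intros eps He. destruct (GP_infinite x) with (eps := eps) as [N HN]; auto.
  { rewrite Rabs_right; lra. }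
  exists N. intros n Hn. specialize (HN n Hn).
  replace (sum_f_R0 (fun i => x ^ i) n) with (sum_f_R0 (fun n0 : nat => 1 * x ^ n0) n); auto.
  apply sum_eq; intros; ring.
Qed.

Lemma geom_Z x : 0 <= x < 1 -> hsum (fun m => x ^ Z.abs_nat m) (/ (1 - x) + x * / (1 - x)).
Proof.
intros Hx. apply hsum_Z.
- eapply hsum_ext; [|apply geom_nat; auto]. intros n; simpl. rewrite Zabs2Nat.id; auto.
- eapply hsum_ext; [|apply hsum_scal, geom_nat; auto]. intros n; simpl.
  replace (Z.abs_nat (- Z.of_nat n - 1)) with (S n) by lia. auto.
Qed.

(** The common majorant of the theta and Lambert series. Its ratio is [2 * q] and not [q] so that
    the weights m^2 can be absorbed by m^2 <= 2 * 2^m. *)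
Lemma geom_dom q K (f : Z -> R) : 0 < q < 1/4 ->
  (forall m, Rabs (f m) <= K * (2 * q) ^ Z.abs_nat m) -> hsum f (tsum f).
Proof.
intros Hq H. apply tsum_spec.
destruct (hsum_dom _ f (fun m => K * (2 * q) ^ Z.abs_nat m) (K * (/ (1 - 2 * q) + 2 * q * / (1 - 2 * q)))) as [s [Hs _]]; auto.
- apply hsum_scal, geom_Z; lra.
- exists s; auto.
Qed.

Lemma pz_sq q m : powerRZ q (m * m) = q ^ (Z.abs_nat m * Z.abs_nat m).
Proof. replace (m * m)%Z with (Z.of_nat (Z.abs_nat m * Z.abs_nat m)) by lia. rewrite pow_powerRZ; auto. Qed.

Lemma pow_anti q a b : 0 <= q <= 1 -> (a <= b)%nat -> q ^ b <= q ^ a.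
Proof.
intros Hq Hab. replace b with (a + (b - a))%nat by lia. rewrite pow_add.
assert (0 <= q ^ a) by (apply pow_le; lra).
assert (q ^ (b - a) <= 1) by (rewrite <- (pow1 (b - a)); apply pow_incr; lra).
nra.
Qed.

Lemma pz_sq_le q m : 0 < q < 1 -> powerRZ q (m * m) <= q ^ Z.abs_nat m.
Proof. intros Hq. rewrite pz_sq. apply pow_anti; [lra|]. nia. Qed.

Lemma pz_pos q m : 0 < q -> 0 < powerRZ q m.
Proof. intros; apply powerRZ_lt; auto. Qed.

Lemma pz_add q a b : 0 < q -> powerRZ q (a + b) = powerRZ q a * powerRZ q b.
Proof. intros; apply powerRZ_add; lra. Qed.

Lemma pz_double q a : 0 < q -> powerRZ q (2 * a) = powerRZ (q * q) a.
Proof.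
intros Hq. replace (2 * a)%Z with (a + a)%Z by lia. rewrite pz_add, powerRZ_mult; auto.
Qed.

Lemma sq_le_pow2 n : INR n * INR n <= 2 * 2 ^ n.
Proof.
assert (forall k, 4 <= INR (k + 4) /\ INR (k + 4) * INR (k + 4) <= 2 ^ (k + 4)) as H.
{ induction k as [|k [H1 H2]]; [simpl; lra|].
  replace (S k + 4)%nat with (S (k + 4)) by lia. rewrite S_INR. split; [lra|].
  simpl pow. nra. }
destruct (Nat.le_gt_cases 4 n) as [Hn|Hn].
- specialize (H (n - 4)%nat). replace (n - 4 + 4)%nat with n in H by lia.
  destruct H. assert (0 <= 2 ^ n) by (apply pow_le; lra). lra.
- destruct n as [|[|[|[|n]]]]; simpl; try lra; lia.
Qed.

Lemma IZR_abs_nat m : Rabs (IZR m) = INR (Z.abs_nat m).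
Proof. rewrite <- abs_IZR, INR_IZR_INZ. f_equal. lia. Qed.

Lemma pow_le2 q n : 0 < q -> q ^ n <= (2 * q) ^ n.
Proof. intros; apply pow_incr; lra. Qed.

Lemma sq_weight q m : 0 < q -> IZR m * IZR m * q ^ Z.abs_nat m <= 2 * (2 * q) ^ Z.abs_nat m.
Proof.
intros Hq. replace (IZR m * IZR m) with (INR (Z.abs_nat m) * INR (Z.abs_nat m)).
- assert (H := sq_le_pow2 (Z.abs_nat m)). rewrite Rpow_mult_distr.
  assert (0 < q ^ Z.abs_nat m) by (apply pow_lt; auto). nra.
- rewrite <- IZR_abs_nat, <- Rabs_mult, Rabs_right; auto. apply Rle_ge, Rle_0_sqr.
Qed.

Lemma lin_weight m : Rabs (IZR m) <= IZR m * IZR m.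
Proof.
rewrite IZR_abs_nat. replace (IZR m * IZR m) with (INR (Z.abs_nat m) * INR (Z.abs_nat m)).
- rewrite <- mult_INR. apply le_INR. nia.
- rewrite <- IZR_abs_nat, <- Rabs_mult, Rabs_right; auto. apply Rle_ge, Rle_0_sqr.
Qed.

(** With q = exp(-t) this is 1 / cosh(n t). *)
Definition sech q n := 2 / (powerRZ q n + powerRZ q (- n)).

Lemma sech_pos q n : 0 < q -> 0 < sech q n.
Proof.
intros Hq. unfold sech. assert (A := pz_pos q n Hq). assert (B := pz_pos q (-n) Hq).
apply Rdiv_lt_0_compat; lra.
Qed.

Lemma sech_le q n : 0 < q < 1 -> sech q n <= 2 * q ^ Z.abs_nat n.
Proof.
intros Hq. unfold sech. assert (A := pz_pos q n (proj1 Hq)). assert (B := pz_pos q (-n) (proj1 Hq)).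
assert (/ q ^ Z.abs_nat n <= powerRZ q n + powerRZ q (- n)) as H.
{ destruct (Z_le_dec 0 n) as [Hn|Hn].
  - replace (powerRZ q (-n)) with (/ q ^ Z.abs_nat n); [lra|].
    rewrite powerRZ_neg'. f_equal. replace n with (Z.of_nat (Z.abs_nat n)) at 2 by lia.
    rewrite pow_powerRZ; auto.
  - replace (powerRZ q n) with (/ q ^ Z.abs_nat n); [lra|].
    replace n with (- (- n))%Z at 2 by lia.
    rewrite powerRZ_neg'. f_equal. replace (- n)%Z with (Z.of_nat (Z.abs_nat n)) by lia.
    rewrite pow_powerRZ; auto. }
assert (0 < q ^ Z.abs_nat n) as Hp by (apply pow_lt; lra).
unfold Rdiv. apply Rmult_le_compat_l; [lra|].
rewrite <- (Rinv_inv (q ^ Z.abs_nat n)). apply Rinv_le_contravar; auto.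
apply Rinv_0_lt_compat; auto.
Qed.

Definition th3 q := tsum (fun m => powerRZ q (m * m)).
Definition th4 q := tsum (fun m => sg m * powerRZ q (m * m)).
(** [dth3] and [dth4] are the termwise images of the theta series under q d/dq. *)
Definition dth3 q := tsum (fun m => IZR m * IZR m * powerRZ q (m * m)).
Definition dth4 q := tsum (fun m => sg m * (IZR m * IZR m) * powerRZ q (m * m)).
(* [theta_2] without its factor [q^(1/4)]. *)
Definition th2 q := tsum (fun m => powerRZ q (m * m + m)).
(** These will turn out to be the Lambert series of two squares, its alternating form, and a quarter
    of theta_2^4 theta_3^2. *)
Definition hs q := tsum (sech q).
Definition hs_alt q := tsum (fun n => sg n * sech q n).
Definition hs_sq q := tsum (fun n => IZR n * IZR n * sech q n).

Lemma th3_spec q : 0 < q < 1/4 -> hsum (fun m => powerRZ q (m * m)) (th3 q).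
Proof.
intros Hq. apply (geom_dom q 1); auto. intros m.
rewrite Rabs_right; [|left; apply pz_pos; lra].
assert (A := pz_sq_le q m). assert (B := pow_le2 q (Z.abs_nat m)). lra.
Qed.

Lemma th4_spec q : 0 < q < 1/4 -> hsum (fun m => sg m * powerRZ q (m * m)) (th4 q).
Proof.
intros Hq. apply (geom_dom q 1); auto. intros m.
rewrite Rabs_mult, sg_abs, Rabs_right; [|left; apply pz_pos; lra].
assert (A := pz_sq_le q m). assert (B := pow_le2 q (Z.abs_nat m)). lra.
Qed.

Lemma dth_bound q m : 0 < q < 1/4 -> IZR m * IZR m * powerRZ q (m * m) <= 2 * (2 * q) ^ Z.abs_nat m.
Proof.
intros Hq. eapply Rle_trans; [|apply sq_weight; lra].
apply Rmult_le_compat_l; [apply Rle_0_sqr|]. apply pz_sq_le; lra.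
Qed.

Lemma dth3_spec q : 0 < q < 1/4 -> hsum (fun m => IZR m * IZR m * powerRZ q (m * m)) (dth3 q).
Proof.
intros Hq. apply (geom_dom q 2); auto. intros m.
rewrite Rabs_right; [apply dth_bound; auto|].
apply Rle_ge, Rmult_le_pos; [apply Rle_0_sqr|left; apply pz_pos; lra].
Qed.

Lemma dth4_spec q : 0 < q < 1/4 -> hsum (fun m => sg m * (IZR m * IZR m) * powerRZ q (m * m)) (dth4 q).
Proof.
intros Hq. apply (geom_dom q 2); auto. intros m.
rewrite Rmult_assoc, Rabs_mult, sg_abs, Rmult_1_l.
rewrite Rabs_right; [apply dth_bound; auto|].
apply Rle_ge, Rmult_le_pos; [apply Rle_0_sqr|left; apply pz_pos; lra].
Qed.

Lemma odd_hsum (f : Z -> R) s : (forall m, f (- m)%Z = - f m) -> hsum f s -> s = 0.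
Proof.
intros Hf H. assert (hsum f ((-1) * s)).
{ apply (hsum_bij _ _ (fun m => (-m)%Z) (fun m => (-m)%Z)); try (intros; lia).
  eapply hsum_ext; [|apply hsum_scal, H]. intros m; simpl; rewrite Hf; ring. }
assert (A := hsum_unique H H0). lra.
Qed.

Lemma m_th4_spec q : 0 < q < 1/4 -> hsum (fun m => sg m * IZR m * powerRZ q (m * m)) 0.
Proof.
intros Hq.
assert (hsum (fun m => sg m * IZR m * powerRZ q (m * m)) (tsum (fun m => sg m * IZR m * powerRZ q (m * m)))) as H.
{ apply (geom_dom q 2); auto. intros m.
  rewrite !Rabs_mult, sg_abs, Rmult_1_l, (Rabs_right (powerRZ q (m * m))); [|left; apply pz_pos; lra].
  eapply Rle_trans; [|apply dth_bound; auto]. apply Rmult_le_compat_r; [left; apply pz_pos; lra|].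
  apply lin_weight. }
assert (A := H). apply odd_hsum in A; [rewrite A in H; auto|].
intros m. rewrite sg_opp, opp_IZR. replace (- m * - m)%Z with (m * m)%Z by lia. ring.
Qed.

Lemma th2_spec q : 0 < q < 1/4 -> hsum (fun m => powerRZ q (m * m + m)) (th2 q).
Proof.
intros Hq. apply (geom_dom q (/ q)); auto. intros m.
rewrite Rabs_right; [|left; apply pz_pos; lra].
apply Rle_trans with (/ q * q ^ Z.abs_nat m).
- replace (powerRZ q (m * m + m)) with (/ q * q ^ Z.to_nat (m * m + m + 1)).
  + apply Rmult_le_compat_l; [inv_ge0; lra|].
    apply pow_anti; [lra|]. nia.
  + rewrite pow_powerRZ, Z2Nat.id by nia. rewrite pz_add by lra. rewrite powerRZ_1. field; lra.
- apply Rmult_le_compat_l; [inv_ge0; lra|]. apply pow_le2; lra.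
Qed.

Lemma hs_spec q : 0 < q < 1/4 -> hsum (sech q) (hs q).
Proof.
intros Hq. apply (geom_dom q 2); auto. intros n.
rewrite Rabs_right; [|left; apply sech_pos; lra].
assert (A := sech_le q n). assert (B := pow_le2 q (Z.abs_nat n)). lra.
Qed.

Lemma hs_alt_spec q : 0 < q < 1/4 -> hsum (fun n => sg n * sech q n) (hs_alt q).
Proof.
intros Hq. apply (geom_dom q 2); auto. intros n.
rewrite Rabs_mult, sg_abs, Rabs_right; [|left; apply sech_pos; lra].
assert (A := sech_le q n). assert (B := pow_le2 q (Z.abs_nat n)). lra.
Qed.

Lemma sech_sq_bound q n : 0 < q < 1/4 -> IZR n * IZR n * sech q n <= 4 * (2 * q) ^ Z.abs_nat n.
Proof.
intros Hq. assert (A := sech_le q n ltac:(lra)). assert (B := sq_weight q n ltac:(lra)).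
assert (C := Rle_0_sqr (IZR n)). unfold Rsqr in C. nra.
Qed.

Lemma hs_sq_spec q : 0 < q < 1/4 -> hsum (fun n => IZR n * IZR n * sech q n) (hs_sq q).
Proof.
intros Hq. apply (geom_dom q 4); auto. intros n.
rewrite Rabs_right; [apply sech_sq_bound; auto|].
apply Rle_ge, Rmult_le_pos; [apply Rle_0_sqr|left; apply sech_pos; lra].
Qed.

Lemma n_sech_spec q : 0 < q < 1/4 -> exists s, hsum (fun n => IZR n * sech q n) s.
Proof.
intros Hq. eexists. apply (geom_dom q 4); auto. intros m.
rewrite !Rabs_mult, (Rabs_right (sech q m)); [|left; apply sech_pos; lra].
eapply Rle_trans; [|apply sech_sq_bound; auto]. apply Rmult_le_compat_r; [left; apply sech_pos; lra|].
apply lin_weight.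
Qed.

(** * Doubling formulas q -> q^2 *)

Lemma hsum_parity_even (f : Z * Z -> R) s :
  (forall m n, sg (m + n) = -1 -> f (m, n) = 0) ->
  hsum f s <-> hsum (fun x => f (fst x + snd x, fst x - snd x)%Z) s.
Proof.
intros H. symmetry. apply (hsum_inj _ _ (fun x : Z * Z => (fst x + snd x, fst x - snd x)%Z) f).
- intros [a b] [c d]; simpl. intros E. injection E; intros. f_equal; lia.
- intros [m n] Hmn. apply H. apply NNPP; intros Hne.
  destruct (sg_even m n Hne) as [a [b [-> ->]]]. apply (Hmn (a, b)); auto.
Qed.

Lemma hsum_parity_odd (f : Z * Z -> R) s :
  (forall m n, sg (m + n) = 1 -> f (m, n) = 0) ->
  hsum f s <-> hsum (fun x => f (fst x + snd x + 1, fst x - snd x)%Z) s.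
Proof.
intros H. symmetry. apply (hsum_inj _ _ (fun x : Z * Z => (fst x + snd x + 1, fst x - snd x)%Z) f).
- intros [a b] [c d]; simpl. intros E. injection E; intros. f_equal; lia.
- intros [m n] Hmn. apply H. apply NNPP; intros Hne.
  destruct (sg_odd m n Hne) as [a [b [-> ->]]]. apply (Hmn (a, b)); auto.
Qed.

Lemma sg_diag a b : sg (a + b + (a - b)) = 1.
Proof. replace (a + b + (a - b))%Z with (2 * a)%Z by lia. apply sg_double. Qed.

Lemma sg_diag_odd a b : sg (a + b + 1 + (a - b)) = -1.
Proof.
replace (a + b + 1 + (a - b))%Z with (2 * a + 1)%Z by lia. rewrite sg_1, sg_double. ring.
Qed.

Lemma sg_sub a b : sg (a - b) = sg a * sg b.
Proof. unfold Z.sub. rewrite sg_add, sg_opp. auto. Qed.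

Lemma pz_even q a b : 0 < q ->
  powerRZ q ((a + b) * (a + b)) * powerRZ q ((a - b) * (a - b))
  = powerRZ (q * q) (a * a) * powerRZ (q * q) (b * b).
Proof.
intros Hq. rewrite <- !pz_double, <- !pz_add by auto. f_equal. lia.
Qed.

Lemma pz_odd q a b : 0 < q ->
  powerRZ q ((a + b + 1) * (a + b + 1)) * powerRZ q ((a - b) * (a - b))
  = q * (powerRZ (q * q) (a * a + a) * powerRZ (q * q) (b * b + b)).
Proof.
intros Hq. rewrite <- !pz_double, <- !pz_add by auto.
replace q with (powerRZ q 1) at 2 by (simpl; ring).
rewrite <- pz_add by auto. f_equal. lia.
Qed.

Lemma qq_range q : 0 < q < 1/4 -> 0 < q * q < 1/4.
Proof. nra. Qed.

(** The factor 1 + (-1)^(m+n) selects the pairs of even sum, parametrised by m = a + b, n = a - b.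
    Since m^2 + n^2 = 2 (a^2 + b^2), the sum over them is a theta product at q^2. The other doubling
    formulas vary the selecting factor and the weight. *)
Lemma th3_th4_double q : 0 < q < 1/4 ->
  th3 q * th3 q + th4 q * th4 q = 2 * (th3 (q * q) * th3 (q * q)).
Proof.
intros Hq. assert (Hqq := qq_range q Hq).
set (f := fun x : Z * Z => (1 + sg (fst x + snd x)) * (powerRZ q (fst x * fst x) * powerRZ q (snd x * snd x))).
apply (@hsum_unique _ f).
- eapply hsum_ext; [|apply hsum_plus; [apply (hsum_mul (th3_spec q Hq) (th3_spec q Hq))|
    apply (hsum_mul (th4_spec q Hq) (th4_spec q Hq))]].
  intros [m n]; unfold f; simpl. rewrite sg_add. ring.
- apply hsum_parity_even.
  + intros m n H. unfold f; simpl. rewrite H. ring.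
  + eapply hsum_ext; [|apply hsum_scal, (hsum_mul (th3_spec _ Hqq) (th3_spec _ Hqq))].
    intros [a b]; unfold f; simpl. rewrite sg_diag, pz_even by lra. ring.
Qed.

Lemma th3_th4_double_minus q : 0 < q < 1/4 ->
  th3 q * th3 q - th4 q * th4 q = 2 * q * (th2 (q * q) * th2 (q * q)).
Proof.
intros Hq. assert (Hqq := qq_range q Hq).
set (f := fun x : Z * Z => (1 - sg (fst x + snd x)) * (powerRZ q (fst x * fst x) * powerRZ q (snd x * snd x))).
apply (@hsum_unique _ f).
- eapply hsum_ext; [|apply hsum_minus; [apply (hsum_mul (th3_spec q Hq) (th3_spec q Hq))|
    apply (hsum_mul (th4_spec q Hq) (th4_spec q Hq))]].
  intros [m n]; unfold f; simpl. rewrite sg_add. ring.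
- apply hsum_parity_odd.
  + intros m n H. unfold f; simpl. rewrite H. ring.
  + eapply hsum_ext; [|apply hsum_scal, (hsum_mul (th2_spec _ Hqq) (th2_spec _ Hqq))].
    intros [a b]; unfold f; simpl. rewrite sg_diag_odd, pz_odd by lra. ring.
Qed.

(** Half of q d/dq applied to [th3_th4_double]. Termwise, the weight is symmetrised to m^2 + n^2 = 2
    (a^2 + b^2), which is why twice the identity is proved. *)
Lemma dth3_dth4_double q : 0 < q < 1/4 ->
  dth3 q * th3 q + dth4 q * th4 q = 4 * (dth3 (q * q) * th3 (q * q)).
Proof.
intros Hq. assert (Hqq := qq_range q Hq).
set (f := fun x : Z * Z => (1 + sg (fst x + snd x)) * (IZR (fst x) * IZR (fst x) + IZR (snd x) * IZR (snd x))
   * (powerRZ q (fst x * fst x) * powerRZ q (snd x * snd x))).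
assert (2 * (dth3 q * th3 q + dth4 q * th4 q) = 2 * (4 * (dth3 (q * q) * th3 (q * q)))); [|lra].
apply (@hsum_unique _ f).
- replace (2 * (dth3 q * th3 q + dth4 q * th4 q)) with
   ((dth3 q * th3 q + dth4 q * th4 q) + (th3 q * dth3 q + th4 q * dth4 q)) by ring.
  eapply hsum_ext; [|apply hsum_plus; apply hsum_plus;
   [apply (hsum_mul (dth3_spec q Hq) (th3_spec q Hq))
   |apply (hsum_mul (dth4_spec q Hq) (th4_spec q Hq))
   |apply (hsum_mul (th3_spec q Hq) (dth3_spec q Hq))
   |apply (hsum_mul (th4_spec q Hq) (dth4_spec q Hq))]].
  intros [m n]; unfold f; simpl. rewrite sg_add. ring.
- apply hsum_parity_even.
  + intros m n H. unfold f; simpl. rewrite H. ring.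
  + replace (2 * (4 * (dth3 (q * q) * th3 (q * q)))) with
     (4 * (dth3 (q * q) * th3 (q * q) + th3 (q * q) * dth3 (q * q))) by ring.
    eapply hsum_ext; [|apply hsum_scal, hsum_plus;
     [apply (hsum_mul (dth3_spec _ Hqq) (th3_spec _ Hqq))
     |apply (hsum_mul (th3_spec _ Hqq) (dth3_spec _ Hqq))]].
    intros [a b]; unfold f; simpl. rewrite sg_diag, pz_even by lra.
    rewrite minus_IZR, plus_IZR. ring.
Qed.

Lemma sg_half_zero m n : sg (m + n) = -1 -> sg m + sg n = 0.
Proof. rewrite sg_add. assert (A := sg_sqr m). nra. Qed.

Lemma th3_th4_mul q : 0 < q < 1/4 -> th3 q * th4 q = th4 (q * q) * th4 (q * q).
Proof.
intros Hq. assert (Hqq := qq_range q Hq).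
set (f := fun x : Z * Z => (sg (fst x) + sg (snd x)) * (powerRZ q (fst x * fst x) * powerRZ q (snd x * snd x))).
assert (2 * (th3 q * th4 q) = 2 * (th4 (q * q) * th4 (q * q))); [|lra].
apply (@hsum_unique _ f).
- replace (2 * (th3 q * th4 q)) with (th3 q * th4 q + th4 q * th3 q) by ring.
  eapply hsum_ext; [|apply hsum_plus; [apply (hsum_mul (th3_spec q Hq) (th4_spec q Hq))|
    apply (hsum_mul (th4_spec q Hq) (th3_spec q Hq))]].
  intros [m n]; unfold f; simpl. ring.
- apply hsum_parity_even.
  + intros m n H. unfold f; simpl. rewrite sg_half_zero by auto. ring.
  + eapply hsum_ext; [|apply hsum_scal, (hsum_mul (th4_spec _ Hqq) (th4_spec _ Hqq))].
    intros [a b]; unfold f; simpl. rewrite pz_even, sg_sub, sg_add by lra. ring.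
Qed.

(** q d/dq applied to [th3_th4_mul], again with a symmetrised weight; (-1)^m + (-1)^n vanishes on
    the pairs of odd sum. *)
Lemma dth3_th4_mul q : 0 < q < 1/4 ->
  dth3 q * th4 q + dth4 q * th3 q = 4 * (dth4 (q * q) * th4 (q * q)).
Proof.
intros Hq. assert (Hqq := qq_range q Hq).
set (f := fun x : Z * Z => (sg (fst x) + sg (snd x)) * (IZR (fst x) * IZR (fst x) + IZR (snd x) * IZR (snd x))
  * (powerRZ q (fst x * fst x) * powerRZ q (snd x * snd x))).
assert (2 * (dth3 q * th4 q + dth4 q * th3 q) = 2 * (4 * (dth4 (q * q) * th4 (q * q)))); [|lra].
apply (@hsum_unique _ f).
- replace (2 * (dth3 q * th4 q + dth4 q * th3 q)) with
   ((dth3 q * th4 q + dth4 q * th3 q) + (th4 q * dth3 q + th3 q * dth4 q)) by ring.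
  eapply hsum_ext; [|apply hsum_plus; apply hsum_plus;
   [apply (hsum_mul (dth3_spec q Hq) (th4_spec q Hq))
   |apply (hsum_mul (dth4_spec q Hq) (th3_spec q Hq))
   |apply (hsum_mul (th4_spec q Hq) (dth3_spec q Hq))
   |apply (hsum_mul (th3_spec q Hq) (dth4_spec q Hq))]].
  intros [m n]; unfold f; simpl. ring.
- apply hsum_parity_even.
  + intros m n H. unfold f; simpl. rewrite sg_half_zero by auto. ring.
  + replace (2 * (4 * (dth4 (q * q) * th4 (q * q)))) with
     (4 * (dth4 (q * q) * th4 (q * q) + th4 (q * q) * dth4 (q * q))) by ring.
    eapply hsum_ext; [|apply hsum_scal, hsum_plus;
     [apply (hsum_mul (dth4_spec _ Hqq) (th4_spec _ Hqq))
     |apply (hsum_mul (th4_spec _ Hqq) (dth4_spec _ Hqq))]].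
    intros [a b]; unfold f; simpl. rewrite pz_even, sg_sub, sg_add by lra.
    rewrite minus_IZR, plus_IZR. ring.
Qed.

Lemma th2_double q : 0 < q < 1/4 -> th2 q * th2 q = 2 * (th2 (q * q) * th3 (q * q)).
Proof.
intros Hq. assert (Hqq := qq_range q Hq).
set (F := fun x : Z * Z => powerRZ q (fst x * fst x + fst x) * powerRZ q (snd x * snd x + snd x)).
apply (@hsum_unique _ F).
{ apply (hsum_mul (th2_spec q Hq) (th2_spec q Hq)). }
assert (forall a b, F (a + b, a - b)%Z = powerRZ (q * q) (a * a + a) * powerRZ (q * q) (b * b)) as HF.
{ intros a b. unfold F; simpl. rewrite <- !pz_double, <- !pz_add by lra. f_equal. lia. }
set (E := fun x : Z * Z => (1 + sg (fst x + snd x)) / 2 * F x).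
assert (hsum E (th2 (q * q) * th3 (q * q))) as HE.
{ apply hsum_parity_even.
  - intros m n H. unfold E; simpl. rewrite H. field.
  - eapply hsum_ext; [|apply (hsum_mul (th2_spec _ Hqq) (th3_spec _ Hqq))].
    intros [a b]; unfold E; simpl. rewrite sg_diag, HF. field. }
replace (2 * (th2 (q * q) * th3 (q * q))) with (th2 (q * q) * th3 (q * q) + th2 (q * q) * th3 (q * q)) by ring.
(* The reflection n -> -1 - n fixes n^2 + n and reverses the parity of m + n, so it carries the even
   half [E] of [F] to the odd half. *)
apply hsum_ext with (fun x => E x + E (fst x, (-1 - snd x)%Z)).
- intros [m n]; unfold E, F; cbn [fst snd].
  replace ((-1 - n) * (-1 - n) + (-1 - n))%Z with (n * n + n)%Z by lia.
  replace (m + (-1 - n))%Z with (m + - (n + 1))%Z by lia.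
  rewrite !sg_add, sg_opp, sg_add. unfold sg at 5. simpl. field.
- apply hsum_plus; auto.
  apply (hsum_bij _ _ (fun x : Z * Z => (fst x, -1 - snd x)%Z) (fun x : Z * Z => (fst x, -1 - snd x)%Z)); auto;
  intros [m n]; cbn [fst snd]; f_equal; lia.
Qed.

Lemma hs_double q : 0 < q < 1/4 -> hs q + hs_alt q = 2 * hs (q * q).
Proof.
intros Hq. assert (Hqq := qq_range q Hq).
apply (@hsum_unique _ (fun n => (1 + sg n) * sech q n)).
- eapply hsum_ext; [|apply hsum_plus; [apply (hs_spec q Hq)|apply (hs_alt_spec q Hq)]].
  intros n; simpl; ring.
- apply (hsum_inj _ _ (fun a => (2 * a)%Z)); [lia| |].
  + intros n Hn. unfold sg. destruct (Z.even n) eqn:E; [|ring].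
    apply Z.even_spec in E. destruct E as [a Ha]. exfalso. apply (Hn a); lia.
  + eapply hsum_ext; [|apply hsum_scal, (hs_spec _ Hqq)]. intros a; cbv beta.
    rewrite sg_double. unfold sech. replace (- (2 * a))%Z with (2 * (- a))%Z by lia.
    rewrite !pz_double by lra. ring.
Qed.

(** * The convolution of theta_4 with 1/cosh *)

Lemma conv_ex q N : 0 < q < 1/4 ->
  hsum (fun m => sg m * powerRZ q (m * m) * sech q (N - m)) (tsum (fun m => sg m * powerRZ q (m * m) * sech q (N - m))).
Proof.
intros Hq. apply (geom_dom q 2); auto. intros m.
rewrite !Rabs_mult, sg_abs, !Rabs_right; try (apply Rle_ge; left; first [apply sech_pos|apply pz_pos]; lra).
assert (A := pz_sq_le q m ltac:(lra)). assert (B := pow_le2 q (Z.abs_nat m) ltac:(lra)).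
assert (C := pz_pos q (m * m) ltac:(lra)).
assert (D := sech_pos q (N - m) ltac:(lra)).
assert (E : sech q (N - m) <= 2).
{ eapply Rle_trans; [apply sech_le; lra|]. 
  assert (q ^ Z.abs_nat (N - m) <= 1); [|lra].
  rewrite <- (pow1 (Z.abs_nat (N - m))). apply pow_incr; lra. }
nra.
Qed.

Definition conv0 q := tsum (fun m => sg m * powerRZ q (m * m) * sech q (0 - m)).

Lemma Z_ind_shift (P : Z -> Prop) : P 0%Z -> (forall n, P n <-> P (n + 1)%Z) -> forall n, P n.
Proof.
intros H0 H n.
assert (forall k, P (Z.of_nat k) /\ P (- Z.of_nat k)%Z) as K.
{ induction k as [|k [H1 H2]]; [simpl; auto|]. split.
  - replace (Z.of_nat (S k)) with (Z.of_nat k + 1)%Z by lia. apply (proj1 (H _)); auto.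
  - apply (proj2 (H _)). replace (- Z.of_nat (S k) + 1)%Z with (- Z.of_nat k)%Z by lia. auto. }
destruct (Z_le_dec 0 n) as [Hn|Hn].
- replace n with (Z.of_nat (Z.abs_nat n)) by lia. apply K.
- replace n with (- Z.of_nat (Z.abs_nat n))%Z by lia. apply K.
Qed.

(* Multiplying [1 / cosh] by [q^n + q^-n] leaves a theta series that vanishes by the symmetry
   [m -> -1 - m], so the convolution satisfies the functional equation of [q^(N^2)]. *)
Lemma conv_step q N a b : 0 < q < 1/4 ->
  hsum (fun m => sg m * powerRZ q (m * m) * sech q (N - m)) a ->
  hsum (fun m => sg m * powerRZ q (m * m) * sech q (N + 1 - m)) b ->
  b = powerRZ q (2 * N + 1) * a.
Proof.
intros Hq Ha Hb.
assert (Hz : hsum (fun m => sg m * powerRZ q (m * m + m)) 0).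
{ assert (hsum (fun m => sg m * powerRZ q (m * m + m)) (tsum (fun m => sg m * powerRZ q (m * m + m)))) as H.
  { apply tsum_spec.
    destruct (hsum_dom _ (fun m => sg m * powerRZ q (m * m + m)) (fun m => powerRZ q (m * m + m)) (th2 q)) as [s [Hs _]].
    - intros m. rewrite Rabs_mult, sg_abs, Rabs_right; [lra|left; apply pz_pos; lra].
    - apply th2_spec; auto.
    - exists s; auto. }
  assert (H' := H). apply (hsum_bij _ _ (fun m => (-1 - m)%Z) (fun m => (-1 - m)%Z)) in H'; try (intros; lia).
  assert (H'' := hsum_plus _ _ _ _ _ H H').
  assert (tsum (fun m => sg m * powerRZ q (m * m + m)) + tsum (fun m => sg m * powerRZ q (m * m + m)) = 0) as E.
  { eapply @hsum_unique; [exact H''|]. apply hsum_0. intros m; cbv beta.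
    replace ((-1 - m) * (-1 - m) + (-1 - m))%Z with (m * m + m)%Z by lia.
    replace (-1 - m)%Z with (- (m + 1))%Z by lia. rewrite sg_opp, sg_1. ring. }
  replace (tsum _) with 0 in H by lra. auto. }
apply (hsum_bij _ _ (fun m => (m + 1)%Z) (fun m => (m - 1)%Z)) in Hb; try (intros; lia).
assert (b - powerRZ q (2 * N + 1) * a = (-2 * powerRZ q (N + 1)) * 0); [|lra].
eapply @hsum_unique; [apply hsum_minus; [exact Hb|apply hsum_scal, Ha]|].
eapply hsum_ext; [|apply hsum_scal, Hz]. intros m; cbv beta.
replace (N + 1 - (m + 1))%Z with (N - m)%Z by lia.
rewrite sg_1.
assert (powerRZ q ((m + 1) * (m + 1)) = powerRZ q (m * m + m) * powerRZ q (N + 1) * powerRZ q (-(N - m))) as ->.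
{ rewrite <- !pz_add by lra. f_equal. lia. }
assert (powerRZ q (2 * N + 1) * (sg m * powerRZ q (m * m) * sech q (N - m)) =
  sg m * sech q (N - m) * (powerRZ q (m * m + m) * powerRZ q (N + 1) * powerRZ q (N - m))) as ->.
{ rewrite <- !pz_add by lra. replace (m * m + m + (N + 1) + (N - m))%Z with (2 * N + 1 + m * m)%Z by lia.
  rewrite (pz_add q (2 * N + 1) (m * m)) by lra. ring. }
unfold sech. assert (A := pz_pos q (N - m) ltac:(lra)). assert (B := pz_pos q (-(N - m)) ltac:(lra)).
field. lra.
Qed.

Lemma conv_closed q N : 0 < q < 1/4 ->
  hsum (fun m => sg m * powerRZ q (m * m) * sech q (N - m)) (conv0 q * powerRZ q (N * N)).
Proof.
intros Hq. revert N. apply Z_ind_shift.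
- change (powerRZ q (0 * 0)) with 1. rewrite Rmult_1_r. apply (conv_ex q 0 Hq).
- intros N. assert (HN := conv_ex q N Hq). assert (HN1 := conv_ex q (N + 1) Hq).
  assert (E := conv_step q N _ _ Hq HN HN1).
  replace ((N + 1) * (N + 1))%Z with (2 * N + 1 + N * N)%Z by lia. rewrite (pz_add q (2 * N + 1) (N * N)) by lra.
  assert (P := pz_pos q (2 * N + 1) ltac:(lra)).
  split; intros H.
  + rewrite (hsum_unique HN H) in E. rewrite E in HN1.
    replace (conv0 q * (powerRZ q (2 * N + 1) * powerRZ q (N * N))) with
      (powerRZ q (2 * N + 1) * (conv0 q * powerRZ q (N * N))) by ring. auto.
  + rewrite (hsum_unique HN1 H) in E.
    replace (conv0 q * powerRZ q (N * N)) with (tsum (fun m => sg m * powerRZ q (m * m) * sech q (N - m))); auto.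
    apply (Rmult_eq_reg_l (powerRZ q (2 * N + 1))); lra.
Qed.

(** Grouping pairs by N = m + n replaces the inner sum by the closed form of the convolution. The
    weights used are 1, (-1)^N and N^2, for which the left side splits into products of single
    series. *)
Lemma hsum_conv (W : Z -> R) q s r : 0 < q < 1/4 ->
  hsum (fun x => W (fst x + snd x)%Z * (sg (fst x) * powerRZ q (fst x * fst x) * sech q (snd x))) s ->
  hsum (fun N => W N * powerRZ q (N * N)) r ->
  s = conv0 q * r.
Proof.
intros Hq H Hr.
apply (hsum_bij _ _ (fun x : Z * Z => (snd x, (fst x - snd x)%Z)) (fun x : Z * Z => ((fst x + snd x)%Z, fst x))) in H;
 [|intros [u v]; simpl; f_equal; lia|intros [u v]; simpl; f_equal; lia].
simpl in H.
assert (H2 := hsum_fubini _ _ _ (fun N => conv0 q * (W N * powerRZ q (N * N))) _ H).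
simpl in H2.
eapply @hsum_unique; [apply H2|apply hsum_scal, Hr].
intros N. replace (conv0 q * (W N * powerRZ q (N * N))) with (W N * (conv0 q * powerRZ q (N * N))) by ring.
eapply hsum_ext; [|apply hsum_scal, (conv_closed q N Hq)].
intros m; simpl. f_equal. f_equal. lia.
Qed.

Lemma hs_th4 q : 0 < q < 1/4 -> hs q * th4 q = conv0 q * th3 q.
Proof.
intros Hq. apply (hsum_conv (fun _ => 1) q); auto.
- rewrite Rmult_comm. eapply hsum_ext; [|apply (hsum_mul (th4_spec q Hq) (hs_spec q Hq))].
  intros [m n]; simpl; ring.
- eapply hsum_ext; [|apply (th3_spec q Hq)]. intros; simpl; ring.
Qed.

Lemma hs_alt_th3 q : 0 < q < 1/4 -> hs_alt q * th3 q = conv0 q * th4 q.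
Proof.
intros Hq. apply (hsum_conv sg q); auto; [|apply th4_spec; auto].
rewrite Rmult_comm. eapply hsum_ext; [|apply (hsum_mul (th3_spec q Hq) (hs_alt_spec q Hq))].
intros [m n]; simpl. rewrite sg_add. assert (A := sg_sqr m).
transitivity ((sg m * sg m) * powerRZ q (m * m) * (sg n * sech q n)); [rewrite A|]; ring.
Qed.

Lemma hs_sq_th4 q : 0 < q < 1/4 -> hs_sq q * th4 q + hs q * dth4 q = conv0 q * dth3 q.
Proof.
intros Hq. destruct (n_sech_spec q Hq) as [s Hs].
apply (hsum_conv (fun N => IZR N * IZR N) q); auto; [|apply dth3_spec; auto].
(* The cross term 2 m n of (m + n)^2 contains the sum of the odd function (-1)^m m q^(m^2), which is
   the factor 0. *)
replace (hs_sq q * th4 q + hs q * dth4 q) with (th4 q * hs_sq q + dth4 q * hs q + 2 * (0 * s)) by ring.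
eapply hsum_ext; [|apply hsum_plus; [apply hsum_plus;
  [apply (hsum_mul (th4_spec q Hq) (hs_sq_spec q Hq))
  |apply (hsum_mul (dth4_spec q Hq) (hs_spec q Hq))]
  |apply hsum_scal, (hsum_mul (m_th4_spec q Hq) Hs)]].
intros [m n]; simpl. rewrite plus_IZR. ring.
Qed.

(** * Behaviour as q -> 0 and the two invariant ratios *)

Lemma hsum_remove T (dec : forall x y : T, {x = y} + {x <> y}) (f g : T -> R) l s t : NoDup l ->
  hsum f s -> hsum g t -> (forall x, 0 <= g x) -> (forall x, ~ In x l -> Rabs (f x) <= g x) ->
  Rabs (s - lsum f l) <= t.
Proof.
intros Hl Hs Ht Hg Hfg.
set (f1 := fun x => if in_dec dec x l then f x else 0).
assert (hsum f1 (lsum f l)) as H1.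
{ replace (lsum f l) with (lsum f1 l).
  - apply hsum_fin; auto. intros x Hx; unfold f1. destruct (in_dec dec x l); tauto.
  - apply lsum_eq. intros x Hx; unfold f1. destruct (in_dec dec x l); tauto. }
destruct (hsum_dom _ (fun x => f x - f1 x) g t) as [a [Ha Hb]]; auto.
- intros x; unfold f1. destruct (in_dec dec x l); auto.
  + rewrite Rminus_diag, Rabs_R0; auto.
  + rewrite Rminus_0_r; auto.
- rewrite (hsum_unique (hsum_minus _ _ _ _ _ Hs H1) Ha). auto.
Qed.

Lemma remove_near0 q K (f : Z -> R) l s : 0 < q -> 0 <= K -> NoDup l -> hsum f s ->
  (forall m, ~ In m l -> Rabs (f m) <= K * q * (1/2) ^ Z.abs_nat m) ->
  Rabs (s - lsum f l) <= 3 * K * q.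
Proof.
intros Hq HK Hl Hs H.
replace (3 * K * q) with (K * q * (/ (1 - 1/2) + 1/2 * / (1 - 1/2))) by field.
apply (hsum_remove _ Z.eq_dec f (fun m => K * q * (1/2) ^ Z.abs_nat m)); auto.
- apply hsum_scal, geom_Z; lra.
- intros m. apply Rmult_le_pos; [nra|apply pow_le; lra].
Qed.

(** This range is stable under squaring, and on it 6 q < 1, so the estimates below keep [th3], [th4]
    and [th2] positive. *)
Definition small q := 0 < q < 1/16.

Lemma small_range q : small q -> 0 < q < 1/4.
Proof. unfold small; lra. Qed.

Lemma small_sqr q : small q -> small (q * q).
Proof. unfold small; nra. Qed.

Lemma pow_small q n : small q -> (1 <= n)%nat -> q ^ n <= 2 * q * (1/2) ^ n.
Proof.
intros [H1 H2] Hn. replace n with (S (n - 1)) by lia. simpl.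
assert (q ^ (n - 1) <= (1/2) ^ (n - 1)) by (apply pow_incr; lra).
assert (0 < q ^ (n - 1)) by (apply pow_lt; auto). nra.
Qed.

Lemma nodup1 (x : Z) : NoDup (x :: nil).
Proof. constructor; auto; constructor. Qed.

Lemma abs_ge1 m : ~ In m (0%Z :: nil) -> (1 <= Z.abs_nat m)%nat.
Proof. simpl. lia. Qed.

Lemma th3_near q : small q -> Rabs (th3 q - 1) <= 6 * q.
Proof.
intros Hq. assert (Hr := small_range q Hq).
assert (H := remove_near0 q 2 _ (0%Z :: nil) _ (proj1 Hr) ltac:(lra) (nodup1 _) (th3_spec q Hr)).
simpl in H. replace (th3 q - 1) with (th3 q - (1 + 0)) by ring. replace (6 * q) with (3 * 2 * q) by ring. apply H.
intros m Hm. rewrite Rabs_right; [|left; apply pz_pos; lra].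
eapply Rle_trans; [apply pz_sq_le; lra|]. apply pow_small; auto. apply abs_ge1; auto.
Qed.

Lemma th4_near q : small q -> Rabs (th4 q - 1) <= 6 * q.
Proof.
intros Hq. assert (Hr := small_range q Hq).
assert (H := remove_near0 q 2 _ (0%Z :: nil) _ (proj1 Hr) ltac:(lra) (nodup1 _) (th4_spec q Hr)).
simpl in H. unfold sg at 2 in H. simpl in H.
replace (th4 q - 1) with (th4 q - (1 * 1 + 0)) by ring. replace (6 * q) with (3 * 2 * q) by ring. apply H.
intros m Hm. rewrite Rabs_mult, sg_abs, Rmult_1_l, Rabs_right; [|left; apply pz_pos; lra].
eapply Rle_trans; [apply pz_sq_le; lra|]. apply pow_small; auto. apply abs_ge1; auto.
Qed.

Lemma hs_near q : small q -> Rabs (hs q - 1) <= 12 * q.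
Proof.
intros Hq. assert (Hr := small_range q Hq).
assert (H := remove_near0 q 4 _ (0%Z :: nil) _ (proj1 Hr) ltac:(lra) (nodup1 _) (hs_spec q Hr)).
simpl in H. unfold sech at 2 in H. simpl in H.
replace (hs q - 1) with (hs q - (2 / (1 + 1) + 0)) by field. replace (12 * q) with (3 * 4 * q) by ring. apply H.
intros m Hm. rewrite Rabs_right; [|left; apply sech_pos; lra].
eapply Rle_trans; [apply sech_le; lra|].
assert (A := pow_small q _ Hq (abs_ge1 m Hm)). lra.
Qed.

Lemma th2_near q : small q -> Rabs (th2 q - 2) <= 6 * q.
Proof.
intros Hq. assert (Hr := small_range q Hq).
assert (H := remove_near0 q 2 _ (0%Z :: (-1)%Z :: nil) _ (proj1 Hr) ltac:(lra)
  ltac:(constructor; [simpl; lia|apply nodup1]) (th2_spec q Hr)).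
simpl in H. replace (th2 q - 2) with (th2 q - (1 + (1 + 0))) by ring. replace (6 * q) with (3 * 2 * q) by ring. apply H.
intros m Hm. rewrite Rabs_right; [|left; apply pz_pos; lra].
apply Rle_trans with (q ^ Z.abs_nat m); [|apply pow_small; auto; lia].
replace (m * m + m)%Z with (Z.of_nat (Z.to_nat (m * m + m))) by nia.
rewrite <- pow_powerRZ. apply pow_anti; [lra|]. nia.
Qed.

Lemma dth_term q m : small q -> ~ In m (0%Z :: 1%Z :: (-1)%Z :: nil) ->
  IZR m * IZR m * powerRZ q (m * m) <= 2 * q * q * (1/2) ^ Z.abs_nat m.
Proof.
intros Hq Hm. rewrite pz_sq. assert (Hm' : (2 <= Z.abs_nat m)%nat) by (simpl in Hm; lia).
assert (q ^ (Z.abs_nat m * Z.abs_nat m) <= q ^ (2 + Z.abs_nat m)) as H.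
{ apply pow_anti; [unfold small in Hq; lra|]. nia. }
rewrite pow_add in H. assert (A := sq_weight q m (proj1 Hq)).
assert ((2 * q) ^ Z.abs_nat m <= (1/2) ^ Z.abs_nat m) by (apply pow_incr; unfold small in Hq; lra).
assert (C := Rle_0_sqr (IZR m)). unfold Rsqr in C.
apply Rle_trans with (IZR m * IZR m * (q ^ 2 * q ^ Z.abs_nat m)).
- apply Rmult_le_compat_l; auto.
- replace (IZR m * IZR m * (q ^ 2 * q ^ Z.abs_nat m)) with (q * q * (IZR m * IZR m * q ^ Z.abs_nat m)) by ring.
  replace (2 * q * q * (1/2) ^ Z.abs_nat m) with (q * q * (2 * (1/2) ^ Z.abs_nat m)) by ring.
  apply Rmult_le_compat_l; [unfold small in Hq; nra|lra].
Qed.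

Lemma nodup3 : NoDup (0%Z :: 1%Z :: (-1)%Z :: nil).
Proof. constructor; [simpl; lia|constructor; [simpl; lia|apply nodup1]]. Qed.

Lemma dth3_near q : small q -> Rabs (dth3 q / q - 2) <= 6 * q.
Proof.
intros Hq. assert (Hr := small_range q Hq).
assert (H := remove_near0 q (2 * q) _ (0%Z :: 1%Z :: (-1)%Z :: nil) _ (proj1 Hr) ltac:(lra)
  nodup3 (dth3_spec q Hr)).
replace (dth3 q / q - 2) with ((dth3 q - 2 * q) / q) by (field; lra).
unfold Rdiv. rewrite Rabs_mult, (Rabs_right (/ q)); [|inv_ge0; lra].
apply (Rmult_le_reg_r q); [lra|]. rewrite Rmult_assoc, Rinv_l, Rmult_1_r by lra.
simpl in H. 
replace (dth3 q - 2 * q) with (dth3 q - (0 * 0 * 1 + (1 * 1 * (q * 1) + (-1 * -1 * (q * 1) + 0)))) by ring.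
replace (6 * q * q) with (3 * (2 * q) * q) by ring. apply H.
intros m Hm. rewrite Rabs_right.
- apply dth_term; auto.
- apply Rle_ge, Rmult_le_pos; [apply Rle_0_sqr|left; apply pz_pos; lra].
Qed.

Lemma dth4_near q : small q -> Rabs (dth4 q / q - (-2)) <= 6 * q.
Proof.
intros Hq. assert (Hr := small_range q Hq).
assert (H := remove_near0 q (2 * q) _ (0%Z :: 1%Z :: (-1)%Z :: nil) _ (proj1 Hr) ltac:(lra)
  nodup3 (dth4_spec q Hr)).
replace (dth4 q / q - (-2)) with ((dth4 q - (-2) * q) / q) by (field; lra).
unfold Rdiv. rewrite Rabs_mult, (Rabs_right (/ q)); [|inv_ge0; lra].
apply (Rmult_le_reg_r q); [lra|]. rewrite Rmult_assoc, Rinv_l, Rmult_1_r by lra.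
simpl in H. unfold sg in H at 2 3 4. simpl in H.
replace (dth4 q - (-2) * q) with (dth4 q - (1 * (0 * 0) * 1 + (-1 * (1 * 1) * (q * 1) + (-1 * (-1 * -1) * (q * 1) + 0)))) by ring.
replace (6 * q * q) with (3 * (2 * q) * q) by ring. apply H.
intros m Hm. rewrite Rmult_assoc, Rabs_mult, sg_abs, Rmult_1_l, Rabs_right.
- apply dth_term; auto.
- apply Rle_ge, Rmult_le_pos; [apply Rle_0_sqr|left; apply pz_pos; lra].
Qed.

Lemma th_pos q : small q -> 0 < th3 q /\ 0 < th4 q /\ 0 < th2 q.
Proof.
intros Hq. assert (A := th3_near q Hq). assert (B := th4_near q Hq). assert (C := th2_near q Hq).
assert (Hb : forall x c, 1 <= c -> Rabs (x - c) <= 6 * q -> 0 < x).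
{ intros x c Hc Hx. assert (K := Rle_abs (c - x)). rewrite Rabs_minus_sym in K. unfold small in Hq. lra. }
repeat split; [apply (Hb _ 1)|apply (Hb _ 1)|apply (Hb _ 2)]; auto; lra.
Qed.

Lemma near_limit (f : R -> R) c K : 0 < K -> (forall q, small q -> Rabs (f q - c) <= K * q) ->
  limit1_in f small c 0.
Proof.
intros HK H eps He. exists (eps / K). split; [apply Rdiv_lt_0_compat; lra|].
intros q [Hq Hd]. simpl in *. unfold Rdist in *. rewrite Rminus_0_r in Hd.
eapply Rle_lt_trans; [apply H; auto|]. rewrite Rabs_right in Hd by (unfold small in Hq; lra).
apply (Rmult_lt_compat_l K) in Hd; auto. replace (K * (eps / K)) with eps in Hd by (field; lra). auto.
Qed.

(** Repeated squaring preserves the value while the argument falls below every power of 1/2, so the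
    value at q is the limit at 0. *)
Lemma invariant_limit (f : R -> R) c : (forall q, small q -> f q = f (q * q)) ->
  limit1_in f small c 0 -> forall q, small q -> f q = c.
Proof.
intros Hf Hl q Hq.
assert (forall k, exists x, small x /\ x <= (1/2) ^ k /\ f q = f x) as H.
{ induction k as [|k [x [H1 [H2 H3]]]].
  - exists q. split; auto. split; auto. unfold small in Hq. simpl. lra.
  - exists (x * x). split; [apply small_sqr; auto|]. split.
    + simpl. unfold small in H1. assert (0 < (1/2)^k) by (apply pow_lt; lra). nra.
    + rewrite H3. auto. }
apply NNPP; intros Hne.
destruct (Hl (Rabs (f q - c))) as [d [Hd K]]; [apply Rabs_pos_lt; lra|].
destruct (pow_lt_1_zero (1/2) ltac:(rewrite Rabs_right; lra) d Hd) as [N HN].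
destruct (H N) as [x [H1 [H2 H3]]]. specialize (K x). simpl in K. unfold Rdist in K.
specialize (HN N (Nat.le_refl _)).
rewrite H3 in K. apply (Rlt_irrefl (Rabs (f x - c))). apply K. split; auto.
rewrite Rminus_0_r. rewrite Rabs_right by (unfold small in H1; lra).
rewrite Rabs_right in HN; [lra|]. apply Rle_ge, pow_le; lra.
Qed.

(* Both [rho] below are invariant under [q -> q^2] and tend to 1 at 0; this replaces the
   product formulas for the theta functions. *)
Lemma conv0_eq q : small q -> conv0 q = th3 q * th4 q.
Proof.
intros Hq.
set (rho := fun q => hs q * (/ th3 q * / th3 q)).
assert (rho q = 1) as E.
{ revert q Hq. apply invariant_limit.
  - intros q Hq. assert (Hr := small_range q Hq). assert (Hqq := small_sqr q Hq).
    destruct (th_pos q Hq) as [P3 [P4 _]]. destruct (th_pos _ Hqq) as [P3' _].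
    assert (E1 := hs_th4 q Hr). assert (E2 := hs_alt_th3 q Hr).
    assert (E3 := hs_double q Hr). assert (E4 := th3_th4_double q Hr).
    unfold rho. set (a := th3 q) in *. set (b := th4 q) in *. set (a' := th3 (q * q)) in *.
    assert (H1 : conv0 q = hs q * b / a) by (apply (Rmult_eq_reg_r a); [rewrite <- E1; field; lra|lra]).
    assert (H2 : hs_alt q = hs q * (b / a) * (b / a)).
    { apply (Rmult_eq_reg_r a); [|lra]. rewrite E2, H1. field. lra. }
    (* The two convolution identities give [hs_alt] = [hs] (b/a)^2. Hence [hs] + [hs_alt] carries
       the factor (a^2 + b^2) / a^2, and [th3_th4_double] turns its numerator into 2 a'^2. *)
    assert (H3 : 2 * hs (q * q) = hs q * (2 * (a' * a')) / (a * a)).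
    { rewrite <- E3, H2, <- E4. field. lra. }
    replace (hs (q * q)) with (hs q * (a' * a') / (a * a)) by lra. field. lra.
  - unfold rho. replace 1 with (1 * (/ 1 * / 1)) by field.
    assert (L3 : limit1_in th3 small 1 0) by (apply (near_limit _ _ 6); [lra|apply th3_near]).
    apply limit_mul; [apply (near_limit _ _ 12); [lra|apply hs_near]|].
    apply limit_mul; apply limit_inv; auto; lra. }
assert (Hr := small_range q Hq). destruct (th_pos q Hq) as [P3 [P4 _]].
assert (E1 := hs_th4 q Hr). unfold rho in E.
assert (H : hs q = th3 q * th3 q).
{ transitivity (hs q * (/ th3 q * / th3 q) * (th3 q * th3 q)); [field; lra|rewrite E; ring]. }
apply (Rmult_eq_reg_r (th3 q)); [|lra]. rewrite <- E1, H. ring.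
Qed.

(** The classical formula 4 q d/dq log(theta_3 / theta_4) = theta_2^4; the separate factor q
    restores the q^(1/4) missing from each [th2]. *)
Lemma wronskian q : small q ->
  4 * (th4 q * dth3 q - th3 q * dth4 q) = th3 q * th4 q * q * (th2 q * th2 q) * (th2 q * th2 q).
Proof.
intros Hq.
set (rho := fun q => 4 * (th4 q * (dth3 q / q) - th3 q * (dth4 q / q)) *
   (/ (th3 q * th4 q) * / ((th2 q * th2 q) * (th2 q * th2 q)))).
assert (rho q = 1) as E.
{ revert q Hq. apply invariant_limit.
  - intros q Hq. assert (Hr := small_range q Hq). assert (Hqq := small_sqr q Hq).
    destruct (th_pos q Hq) as [P3 [P4 P2]]. destruct (th_pos _ Hqq) as [P3' [P4' P2']].
    assert (E1 := th3_th4_double q Hr). assert (E2 := th3_th4_double_minus q Hr).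
    assert (E3 := th3_th4_mul q Hr). assert (E4 := th2_double q Hr).
    assert (E5 := dth3_dth4_double q Hr). assert (E6 := dth3_th4_mul q Hr).
    unfold rho. assert (Hq0 : 0 < q) by (unfold small in Hq; lra). clear rho Hr Hq Hqq.
    set (Q := q * q) in *.
    set (a := th3 q) in *. set (b := th4 q) in *. set (A := dth3 q) in *. set (B := dth4 q) in *.
    set (a' := th3 Q) in *. set (b' := th4 Q) in *. set (A' := dth3 Q) in *. set (B' := dth4 Q) in *.
    set (t := th2 q) in *. set (t' := th2 Q) in *.
    rewrite E4, E3.
    assert (HA : A' = (A * a + B * b) / (4 * a')) by (apply (Rmult_eq_reg_r (4 * a')); [field_simplify; lra|lra]).
    assert (HB : B' = (A * b + B * a) / (4 * b')) by (apply (Rmult_eq_reg_r (4 * b')); [field_simplify; lra|lra]).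
    (* The transformation of the Wronskian under q -> q^2: with the derivatives at q^2 eliminated,
       the factor (a^2 - b^2) / 2 = q t'^2 appears. *)
    assert (K : 4 * (a' * b') * (b' * A' - a' * B') = (q * (t' * t')) * (b * A - a * B)).
    { rewrite HA, HB.
      replace (4 * (a' * b') * (b' * ((A * a + B * b) / (4 * a')) - a' * ((A * b + B * a) / (4 * b'))))
       with ((b' * b') * (A * a + B * b) - (a' * a') * (A * b + B * a)) by (field; lra).
      rewrite <- E3. replace (a' * a') with ((a * a + b * b) / 2) by lra.
      replace (q * (t' * t')) with ((a * a - b * b) / 2) by lra. field. }
    unfold Q. 
    replace (4 * (b * (A / q) - a * (B / q))) with (4 * ((q * (t' * t')) * (b * A - a * B)) / (q * q * (t' * t'))) by (field; lra).
    rewrite <- K. field. lra.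
  - unfold rho. replace 1 with (4 * (1 * 2 - 1 * (-2)) * (/ (1 * 1) * / ((2 * 2) * (2 * 2)))) by field.
    assert (L3 : limit1_in th3 small 1 0) by (apply (near_limit _ _ 6); [lra|apply th3_near]).
    assert (L4 : limit1_in th4 small 1 0) by (apply (near_limit _ _ 6); [lra|apply th4_near]).
    assert (L2 : limit1_in th2 small 2 0) by (apply (near_limit _ _ 6); [lra|apply th2_near]).
    assert (M3 : limit1_in (fun q => dth3 q / q) small 2 0) by (apply (near_limit _ _ 6); [lra|apply dth3_near]).
    assert (M4 : limit1_in (fun q => dth4 q / q) small (-2) 0) by (apply (near_limit _ _ 6); [lra|apply dth4_near]).
    apply limit_mul.
    + apply limit_mul; [apply (limit_free (fun _ => 4) small 0 0)|].
      apply limit_minus; apply limit_mul; auto.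
    + apply limit_mul; apply limit_inv; try lra; repeat apply limit_mul; auto. }
destruct (th_pos q Hq) as [P3 [P4 P2]]. unfold rho in E. unfold small in Hq.
set (a := th3 q) in *. set (b := th4 q) in *. set (A := dth3 q) in *. set (B := dth4 q) in *. set (t := th2 q) in *.
transitivity (4 * (b * (A / q) - a * (B / q)) * (/ (a * b) * / (t * t * (t * t))) * (a * b * q * (t * t) * (t * t)));
 [field; lra|rewrite E; ring].
Qed.

Lemma hs_sq_eq q : small q -> 4 * hs_sq q = th3 q * th3 q * q * (th2 q * th2 q) * (th2 q * th2 q).
Proof.
intros Hq. assert (Hr := small_range q Hq). destruct (th_pos q Hq) as [P3 [P4 P2]].
assert (E1 := hs_th4 q Hr). assert (E2 := hs_sq_th4 q Hr). assert (E3 := wronskian q Hq).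
rewrite (conv0_eq q Hq) in E1, E2.
assert (E4 : hs q = th3 q * th3 q) by (apply (Rmult_eq_reg_r (th4 q)); lra).
rewrite E4 in E2. apply (Rmult_eq_reg_r (th4 q)); [|lra].
replace (4 * hs_sq q * th4 q) with (th3 q * (4 * (th4 q * dth3 q - th3 q * dth4 q))) by lra.
rewrite E3. ring.
Qed.

(** By strong induction the lower coefficients vanish, and comparison with a fixed point [q0] bounds
    the remaining tail by a multiple of q^(n+1). Dividing by q^n leaves |c n| <= q C for all small
    q. *)
Lemma power_series_unique (c : nat -> R) :
  (forall q, small q -> hsum (fun n => c n * q ^ n) 0) -> forall n, c n = 0.
Proof.
intros H n. induction n as [n IH] using (well_founded_induction lt_wf).
set (q0 := 1/32). assert (small q0) as Hq0 by (unfold small, q0; lra).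
destruct (hsum_abs_ex _ _ _ (H q0 Hq0)) as [B [HB _]].
assert (HB0 : 0 <= B).
{ change 0 with (lsum (fun x => Rabs (c x * q0 ^ x)) nil).
  apply hsum_pos_le; auto; [|constructor]. intros; apply Rabs_pos. }
assert (P0 : 0 < q0 ^ (S n)) by (apply pow_lt; unfold q0; lra).
assert (K : forall q, 0 < q <= q0 -> Rabs (c n) <= q * (B / q0 ^ (S n))).
{ intros q Hq. assert (small q) as Hq' by (unfold small, q0 in *; lra).
  assert (Pq : 0 < q ^ n) by (apply pow_lt; lra).
  assert (Hr : 0 <= q / q0 <= 1).
  { split; [apply Rmult_le_pos; [lra|inv_ge0; unfold q0; lra]|].
    apply (Rmult_le_reg_r q0); [unfold q0; lra|]. field_simplify; unfold q0 in *; lra. }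
  assert (A := hsum_remove _ Nat.eq_dec _ (fun k => (q / q0) ^ (S n) * Rabs (c k * q0 ^ k)) (n :: nil) _ _
     ltac:(constructor; auto; constructor) (H q Hq') (hsum_scal _ ((q / q0) ^ (S n)) _ _ HB)).
  assert (Rabs (c n * q ^ n) <= (q / q0) ^ (S n) * B) as A'.
  { replace (Rabs (c n * q ^ n)) with (Rabs (0 - lsum (fun k => c k * q ^ k) (n :: nil))).
    2:{ simpl. rewrite <- Rabs_Ropp. f_equal. ring. }
    apply A.
    - intros k. apply Rmult_le_pos; [apply pow_le; lra|apply Rabs_pos].
    - intros k Hk. destruct (Nat.lt_ge_cases k n) as [Hkn|Hkn].
      + rewrite IH by auto. rewrite !Rmult_0_l, Rabs_R0. lra.
      + assert (n < k)%nat as Hkn' by (simpl in Hk; lia).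
        replace (q ^ k) with ((q / q0) ^ k * q0 ^ k).
        2:{ rewrite <- Rpow_mult_distr. f_equal. field. unfold q0; lra. }
        rewrite <- Rmult_assoc, (Rmult_comm (c k)), Rmult_assoc, Rabs_mult.
        apply Rmult_le_compat_r; [apply Rabs_pos|].
        rewrite Rabs_right by (apply Rle_ge, pow_le; lra). apply pow_anti; auto. }
  rewrite Rabs_mult, (Rabs_right (q ^ n)) in A' by lra.
  apply (Rmult_le_reg_r (q ^ n)); auto. eapply Rle_trans; [exact A'|].
  right. unfold Rdiv. rewrite Rpow_mult_distr, pow_inv. simpl. field.
  split; [apply pow_nonzero|]; unfold q0; lra. }
assert (HC : 0 <= B / q0 ^ (S n)) by (apply Rmult_le_pos; auto; inv_ge0; auto).
set (C := B / q0 ^ S n) in *.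
apply NNPP; intros Hne. assert (0 < Rabs (c n)) as Hp by (apply Rabs_pos_lt; auto).
set (q := Rmin q0 (Rabs (c n) / (2 * (C + 1)))).
assert (0 < Rabs (c n) / (2 * (C + 1))) by (apply Rdiv_lt_0_compat; lra).
assert (0 < q) by (apply Rmin_glb_lt; auto; unfold q0; lra).
specialize (K q ltac:(split; auto; apply Rmin_l)).
assert (q <= Rabs (c n) / (2 * (C + 1))) as Hq by apply Rmin_r.
assert (q * (2 * (C + 1)) <= Rabs (c n)).
{ apply (Rmult_le_compat_r (2 * (C + 1))) in Hq; [|lra].
  replace (Rabs (c n) / (2 * (C + 1)) * (2 * (C + 1))) with (Rabs (c n)) in Hq by (field; lra). auto. }
nra.
Qed.

(** * The coefficients of f and the value L(f,4) *)

Definition lam (x : nat * nat) : nat := S (fst x) * (2 * snd x + 1).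

(** The index (i, j) encodes the factorisation n = d (2j+1) with d = i + 1; the term is d^2 times
    the character of the odd factor. *)
Definition ecoef (x : nat * nat) : R := INR (S (fst x)) * INR (S (fst x)) * (-1) ^ (snd x).

Lemma alt_geom_nat x : 0 <= x < 1 -> hsum (fun n => (-1) ^ n * x ^ n) (/ (1 + x)).
Proof.
intros Hx.
destruct (hsum_dom _ (fun n => (-1) ^ n * x ^ n) (fun n => x ^ n) (/ (1 - x))) as [s [Hs _]].
{ intros n; rewrite Rabs_mult, pow_1_abs, Rmult_1_l, Rabs_right; [lra|apply Rle_ge, pow_le; lra]. }
{ apply geom_nat; auto. }
replace (/ (1 + x)) with s; auto.
assert (hsum (fun n => (-1) ^ n * x ^ n) (1 + (- x) * s)).
{ apply hsum_ext with (fun n => (if Nat.eq_dec n 0 then 1 else 0) + (match n with O => 0 | S k => (-x) * ((-1) ^ k * x ^ k) end)).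
  { intros [|n]; simpl; ring. }
  apply hsum_plus.
  - assert (K := hsum_fin _ (fun n => if Nat.eq_dec n 0 then 1 else 0) (0%nat :: nil)).
    simpl in K. rewrite Rplus_0_r in K. apply K; [constructor; auto; constructor|].
    intros n Hn. destruct (Nat.eq_dec n 0); auto. exfalso; apply Hn; auto.
  - apply (hsum_inj _ _ S); [lia| |apply hsum_scal; auto].
    intros [|n] Hn; auto. exfalso; apply (Hn n); auto. }
assert (E := hsum_unique Hs H). apply (Rmult_eq_reg_r (1 + x)); [|lra].
rewrite Rinv_l by lra. lra.
Qed.

(** Each 1/cosh is expanded as 2 times the sum of (-1)^j q^(d (2j+1)). Counting d and -d doubles it
    again, which with the factor 4 makes 16. *)
Lemma hs_sq_lambert q : small q -> hsum (fun x => 16 * (ecoef x * q ^ lam x)) (4 * hs_sq q).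
Proof.
intros Hq. assert (Hr := small_range q Hq).
assert (0 < q < 1) as Hq1 by lra.
destruct (hsum_dom _ (fun x => 16 * (ecoef x * q ^ lam x)) 
  (fun x : nat * nat => 32 * (2 * q) ^ (S (fst x)) * q ^ (snd x)) (32 * (2 * q) * / (1 - 2 * q) * / (1 - q))) as [s [Hs _]].
- intros [i j]; unfold ecoef, lam; cbn [fst snd].
  rewrite !Rabs_mult, pow_1_abs, (Rabs_right 16), (Rabs_right (q ^ _)), !Rabs_right; try lra;
    [|apply Rle_ge, pos_INR|apply Rle_ge, pow_le; lra].
  replace (S i * (2 * j + 1))%nat with (S i + 2 * j * S i)%nat by lia. rewrite pow_add.
  assert (q ^ (2 * j * S i) <= q ^ j) by (apply pow_anti; [lra|nia]).
  assert (A := sq_le_pow2 (S i)). rewrite Rpow_mult_distr.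
  assert (P1 : 0 < q ^ S i) by (apply pow_lt; lra).
  assert (P2 : 0 < q ^ (2 * j * S i)) by (apply pow_lt; lra).
  assert (P3 : 0 <= INR (S i) * INR (S i)) by (apply Rle_0_sqr).
  assert (INR (S i) * INR (S i) * (q ^ S i * q ^ (2 * j * S i)) <= 2 * 2 ^ S i * (q ^ S i * q ^ j)).
  { apply Rmult_le_compat; auto; nra. }
  nra.
- eapply hsum_ext; [|apply (hsum_mul (hsum_scal _ (32 * (2 * q)) _ _ (geom_nat (2 * q) ltac:(lra))) (geom_nat q ltac:(lra)))].
  intros [i j]; simpl; ring.
- replace (4 * hs_sq q) with s; auto.
  assert (Hrow : hsum (fun i => 16 * (INR (S i) * INR (S i)) * (q ^ S i * / (1 + q ^ S i * q ^ S i))) s).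
  { apply (hsum_fubini _ _ _ _ _ Hs). intros i. unfold ecoef, lam; cbn [fst snd].
    assert (0 < q ^ S i <= q) as Hp.
    { split; [apply pow_lt; lra|]. rewrite <- (pow_1 q) at 2. apply pow_anti; lra || lia. }
    assert (Hp2 : 0 <= q ^ S i * q ^ S i < 1) by nra.
    replace (16 * (INR (S i) * INR (S i)) * (q ^ S i * / (1 + q ^ S i * q ^ S i))) with
      (16 * (INR (S i) * INR (S i)) * q ^ S i * / (1 + q ^ S i * q ^ S i)) by ring.
    eapply hsum_ext; [|apply hsum_scal, alt_geom_nat, Hp2].
    intros j; cbv beta. replace (S i * (2 * j + 1))%nat with (S i + (S i * j + S i * j))%nat by lia.
    rewrite !pow_add, !pow_mult, Rpow_mult_distr. ring. }
  assert (Hh : forall i, sech q (Z.of_nat (S i)) = 2 * (q ^ S i * / (1 + q ^ S i * q ^ S i))).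
  { intros i. unfold sech. rewrite powerRZ_neg', <- pow_powerRZ.
    assert (0 < q ^ S i) by (apply pow_lt; lra). field. split; nra. }
  (* The nonnegative and the negative integers each contribute s/8, here written as [/32 * s * 4];
     together they give [hs_sq] = s/4. *)
  assert (Hn : hsum (fun n => IZR (Z.of_nat n) * IZR (Z.of_nat n) * sech q (Z.of_nat n)) (/32 * s * 4)).
  { replace (/32 * s * 4) with (/8 * s) by field.
    apply (hsum_inj _ _ S); [lia| |].
    - intros [|n] Hn; [simpl; ring|]. exfalso; apply (Hn n); auto.
    - eapply hsum_ext; [|apply hsum_scal, Hrow]. intros i; cbv beta.
      rewrite Hh, <- INR_IZR_INZ. field. assert (0 < q ^ S i) by (apply pow_lt; lra). nra. }
  assert (Hm : hsum (fun n => IZR (- Z.of_nat n - 1) * IZR (- Z.of_nat n - 1) * sech q (- Z.of_nat n - 1)) (/8 * s)).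
  { eapply hsum_ext; [|apply hsum_scal, Hrow]. intros i; cbv beta.
    replace (- Z.of_nat i - 1)%Z with (- Z.of_nat (S i))%Z by lia.
    replace (sech q (- Z.of_nat (S i))) with (sech q (Z.of_nat (S i))).
    2:{ unfold sech. rewrite Z.opp_involutive. f_equal. ring. }
    rewrite Hh, opp_IZR, <- INR_IZR_INZ. field. assert (0 < q ^ S i) by (apply pow_lt; lra). nra. }
  assert (E := hsum_unique (hs_sq_spec q Hr) (hsum_Z (fun n => IZR n * IZR n * sech q n) _ _ Hn Hm)).
  lra.
Qed.

Definition Z6 := (((Z * Z) * (Z * Z)) * (Z * Z))%type.

(** The exponent of q in theta_2^4 theta_3^2, with (m + 1/2)^2 = m^2 + m + 1/4; the four quarters
    make up the leading 1. *)
Definition qform (x : Z6) : Z :=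
  let '(((m1, m2), (m3, m4)), (k1, k2)) := x in
  (1 + (m1 * m1 + m1) + (m2 * m2 + m2) + (m3 * m3 + m3) + (m4 * m4 + m4) + k1 * k1 + k2 * k2)%Z.

Lemma qform_pos x : (1 <= qform x)%Z.
Proof. destruct x as [[[m1 m2] [m3 m4]] [k1 k2]]. unfold qform.
assert (forall m, 0 <= m * m + m)%Z as Hm by (intros; nia).
assert (A1 := Hm m1). assert (A2 := Hm m2). assert (A3 := Hm m3). assert (A4 := Hm m4).
assert (B1 := Z.square_nonneg k1). assert (B2 := Z.square_nonneg k2). lia.
Qed.

Lemma theta_product q : small q ->
  hsum (fun x : Z6 => q ^ Z.to_nat (qform x)) (th3 q * th3 q * q * (th2 q * th2 q) * (th2 q * th2 q)).
Proof.
intros Hq. assert (Hr := small_range q Hq).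
assert (H2 := th2_spec q Hr). assert (H3 := th3_spec q Hr).
replace (th3 q * th3 q * q * (th2 q * th2 q) * (th2 q * th2 q)) with
 (q * ((th2 q * th2 q) * (th2 q * th2 q) * (th3 q * th3 q))) by ring.
eapply hsum_ext; [|apply hsum_scal, @hsum_mul; [apply @hsum_mul; apply (hsum_mul H2 H2)|apply (hsum_mul H3 H3)]].
intros x. rewrite pow_powerRZ, Z2Nat.id by (assert (A := qform_pos x); lia).
destruct x as [[[m1 m2] [m3 m4]] [k1 k2]]. unfold qform; cbn [fst snd].
rewrite <- !pz_add by lra. replace q with (powerRZ q 1) at 1 by (simpl; ring).
rewrite <- pz_add by lra. f_equal. lia.
Qed.

Definition ind (n : nat) (m : nat) : R := if Nat.eq_dec m n then 1 else 0.

Definition box (N : nat) : list Z6 :=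
  let z := zrange N in list_prod (list_prod (list_prod z z) (list_prod z z)) (list_prod z z).

Lemma zrange_In N z : In z (zrange N) <-> (- Z.of_nat N <= z <= Z.of_nat N)%Z.
Proof.
unfold zrange. rewrite in_map_iff. split.
- intros [i [Hi Hin]]. apply in_seq in Hin. lia.
- intros Hz. exists (Z.to_nat (z + Z.of_nat N)). rewrite in_seq. lia.
Qed.

Lemma zrange_NoDup N : NoDup (zrange N).
Proof. unfold zrange. apply NoDup_map_inj; [lia|apply seq_NoDup]. Qed.

Lemma box_NoDup N : NoDup (box N).
Proof. unfold box. repeat apply NoDup_prod; apply zrange_NoDup. Qed.

Lemma qform_box N x : qform x = Z.of_nat N -> In x (box N).
Proof.
destruct x as [[[m1 m2] [m3 m4]] [k1 k2]]. unfold qform, box. intros H.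
assert (forall m, 0 <= m * m + m)%Z as Hm by (intros; nia).
assert (A1 := Hm m1). assert (A2 := Hm m2). assert (A3 := Hm m3). assert (A4 := Hm m4).
repeat apply in_prod; apply zrange_In; nia.
Qed.

Lemma count_spec N : hsum (fun x => ind N (Z.to_nat (qform x))) (lsum (fun x => ind N (Z.to_nat (qform x))) (box N)).
Proof.
apply hsum_fin; [apply box_NoDup|]. intros x Hx. unfold ind.
destruct (Nat.eq_dec _ N) as [E|]; auto. exfalso. apply Hx, qform_box.
assert (A := qform_pos x). lia.
Qed.

Lemma IZR_zsum N g : IZR (zsum N g) = lsum (fun z => IZR (g z)) (zrange N).
Proof.
unfold zsum. induction (zrange N) as [|z l IH]; simpl; auto. rewrite plus_IZR, IH. auto.
Qed.

(** On the solutions of [qform] = N the sign (-1)^(k1+k2) is constant: each m^2 + m is even and k^2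
    has the parity of k, so k1 + k2 has the parity of N - 1. Up to this sign, theta_4^2 may
    therefore be replaced by theta_3^2. *)
Lemma theta_coef_count N :
  IZR (theta_coef16 N) = sg (Z.of_nat N - 1) * lsum (fun x => ind N (Z.to_nat (qform x))) (box N).
Proof.
rewrite <- lsum_scal. unfold box, Z6; cbv zeta. rewrite !lsum_prod. unfold theta_coef16.
rewrite IZR_zsum. apply lsum_eq; intros m1 _. rewrite IZR_zsum. apply lsum_eq; intros m2 _.
rewrite lsum_prod.
rewrite IZR_zsum. apply lsum_eq; intros m3 _. rewrite IZR_zsum. apply lsum_eq; intros m4 _.
rewrite lsum_prod.
rewrite IZR_zsum. apply lsum_eq; intros k1 _. rewrite IZR_zsum. apply lsum_eq; intros k2 _.
assert (P := qform_pos (((m1, m2), (m3, m4)), (k1, k2))). unfold qform in *.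
set (Q := (1 + _ + _ + _ + _ + _ + _)%Z) in *. unfold ind.
destruct (Z.eqb_spec ((2 * m1 + 1) ^ 2 + (2 * m2 + 1) ^ 2 + (2 * m3 + 1) ^ 2 + (2 * m4 + 1) ^ 2 + 4 * k1 ^ 2 + 4 * k2 ^ 2) (4 * Z.of_nat N)) as [E|E];
destruct (Nat.eq_dec (Z.to_nat Q) N) as [E'|E'].
- assert (HQ : Q = Z.of_nat N) by lia. rewrite Rmult_1_r.
  assert (forall m, sg (m * m + m) = 1) as Hs.
  { intros m. replace (m * m + m)%Z with (m * (m + 1))%Z by ring. unfold sg.
    rewrite Z.even_mul, Z.even_add. destruct (Z.even m); auto. }
  assert (forall m, sg (m * m) = sg m) as Hsq.
  { intros m. unfold sg. rewrite Z.even_mul. destruct (Z.even m); auto. }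
  replace (Z.of_nat N - 1)%Z with ((m1 * m1 + m1) + (m2 * m2 + m2) + (m3 * m3 + m3) + (m4 * m4 + m4) + k1 * k1 + k2 * k2)%Z by (unfold Q in HQ; lia).
  rewrite (sg_add _ (k2 * k2)), (sg_add _ (k1 * k1)), (sg_add _ (m4 * m4 + m4)), (sg_add _ (m3 * m3 + m3)), (sg_add _ (m2 * m2 + m2)), !Hs, !Hsq.
  rewrite !Rmult_1_l, <- sg_add. unfold sg. destruct (Z.even (k1 + k2)); auto.
- exfalso. apply E'. assert (Q = Z.of_nat N); [unfold Q; lia|lia].
- exfalso. apply E. assert (HQ : Q = Z.of_nat N) by lia. unfold Q in HQ. lia.
- simpl. ring.
Qed.

Lemma lam_fiber N : exists s, hsum (fun x => ind N (lam x) * ecoef x) s.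
Proof.
eexists. apply (hsum_fin _ _ (list_prod (seq 0 (S N)) (seq 0 (S N)))).
- apply NoDup_prod; apply seq_NoDup.
- intros [i j] Hx. unfold ind, lam; cbn [fst snd].
  destruct (Nat.eq_dec (S i * (2 * j + 1)) N) as [E|]; [|ring].
  exfalso; apply Hx. apply in_prod; apply in_seq; nia.
Qed.

(** Two expansions of 4 [hs_sq] in powers of q are compared: the count of lattice points from the
    theta product, and the Lambert series. *)
Lemma theta_coef_lambert N :
  hsum (fun x => ind N (lam x) * (sg (Z.of_nat N - 1) * ecoef x)) (a_coef N).
Proof.
set (e := fun N => tsum (fun x => ind N (lam x) * ecoef x)).
assert (He : forall N, hsum (fun x => ind N (lam x) * ecoef x) (e N)).
{ intros n. apply tsum_spec, lam_fiber. }
set (c := fun N => lsum (fun x => ind N (Z.to_nat (qform x))) (box N)).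
assert (forall n, c n - 16 * e n = 0) as Hu.
{ apply power_series_unique. intros q Hq.
  replace 0 with (4 * hs_sq q - 4 * hs_sq q) by ring.
  apply hsum_ext with (fun n => c n * q ^ n - 16 * e n * q ^ n); [intros; ring|].
  apply hsum_minus.
  - rewrite hs_sq_eq by auto.
    apply (hsum_fibers _ _ Nat.eq_dec (fun x => Z.to_nat (qform x)) _ _ _ (theta_product q Hq)).
    intros n. rewrite Rmult_comm. eapply hsum_ext; [|apply hsum_scal, (count_spec n)].
    intros x; cbv beta. unfold ind. destruct (Nat.eq_dec _ n) as [->|]; ring.
  - apply (hsum_fibers _ _ Nat.eq_dec lam _ _ _ (hs_sq_lambert q Hq)).
    intros n. replace (16 * e n * q ^ n) with ((16 * q ^ n) * e n) by ring.
    eapply hsum_ext; [|apply hsum_scal, (He n)].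
    intros x; cbv beta. unfold ind. destruct (Nat.eq_dec _ n) as [->|]; ring. }
unfold a_coef. rewrite theta_coef_count. fold (c N).
replace (sg (Z.of_nat N - 1) * c N / 16) with (sg (Z.of_nat N - 1) * e N)
  by (replace (c N) with (16 * e N) by (specialize (Hu N); lra); field).
eapply hsum_ext; [|apply hsum_scal, (He N)]. intros x; simpl; ring.
Qed.

(* The term of index [(i, j)] of the double sum carries the sign of
   [(i + 1) * (2 * j + 1) - 1], which has the parity of [i]. *)
Lemma L_f_4_product b e :
  hsum (fun j => (-1) ^ j / (2 * INR j + 1) ^ 4) b ->
  hsum (fun i => (-1) ^ i / INR (S i) ^ 2) e -> L_f_4_is (e * b).
Proof.
intros Hb He. apply hsum_infinite_sum.
assert (Hm := hsum_mul He Hb).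
apply (hsum_fibers _ _ Nat.eq_dec (fun x => lam x - 1)%nat _ _ _ Hm).
intros k. unfold Rdiv at 3. rewrite Rmult_comm.
eapply hsum_ext; [|apply hsum_scal, (theta_coef_lambert (S k))].
intros [i j]; cbn [fst snd]. unfold ind, ecoef, lam; cbn [fst snd].
destruct (Nat.eq_dec (S i * (2 * j + 1)) (S k)) as [E|E];
destruct (Nat.eq_dec (S i * (2 * j + 1) - 1) k) as [E'|E']; try lia; [|ring].
replace (Z.of_nat (S k) - 1)%Z with (Z.of_nat i + (2 * (Z.of_nat j * Z.of_nat (S i))))%Z by lia.
rewrite sg_add, sg_double.
rewrite sg_pow.
rewrite <- E, mult_INR, plus_INR, mult_INR. simpl (INR 2). simpl (INR 1).
assert (A := pos_INR j). assert (0 < INR (S i)) by (apply lt_0_INR; lia).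
field. lra.
Qed.

(** * Wallis sequences *)

(** [PI/2 * b n] and [w m] are the Wallis integrals of sin^(2n) and sin^(2m+1) over [0, pi/2]. *)
Definition b (n : nat) : R := poch (1/2) n / INR (fact n).
Definition w (m : nat) : R := INR (fact m) / poch (3/2) m.

Lemma poch_pos a n : 0 < a -> 0 < poch a n.
Proof.
intros Ha; induction n; simpl; [lra|]. assert (P := pos_INR n). apply Rmult_lt_0_compat; lra.
Qed.

Lemma fact_pos n : 0 < INR (fact n).
Proof. apply lt_0_INR, lt_O_fact. Qed.

Lemma fact_S n : INR (fact (S n)) = (INR n + 1) * INR (fact n).
Proof. change (fact (S n)) with (S n * fact n)%nat. rewrite mult_INR, S_INR. auto. Qed.

Lemma b_pos n : 0 < b n.
Proof. apply Rdiv_lt_0_compat; [apply poch_pos; lra|apply fact_pos]. Qed.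

Lemma w_pos n : 0 < w n.
Proof. apply Rdiv_lt_0_compat; [apply fact_pos|apply poch_pos; lra]. Qed.

Lemma b_0 : b 0 = 1.
Proof. unfold b; simpl; field. Qed.

Lemma w_0 : w 0 = 1.
Proof. unfold w; simpl; field. Qed.

Lemma b_S n : (2 * INR n + 2) * b (S n) = (2 * INR n + 1) * b n.
Proof.
unfold b. rewrite fact_S. simpl poch. assert (P := fact_pos n). assert (Q := pos_INR n). field. lra.
Qed.

Lemma w_S n : (2 * INR n + 3) * w (S n) = (2 * INR n + 2) * w n.
Proof.
unfold w. rewrite fact_S. simpl poch. assert (P := poch_pos (3/2) n ltac:(lra)). assert (Q := pos_INR n). field. lra.
Qed.

Lemma w_b n : (2 * INR n + 1) * (w n * b n) = 1.
Proof.
induction n; [rewrite w_0, b_0; simpl; ring|].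
rewrite S_INR. assert (Q := pos_INR n). assert (A := b_S n). assert (B := w_S n).
apply (Rmult_eq_reg_r (2 * INR n + 2)); [|lra].
transitivity (((2 * INR n + 3) * w (S n)) * ((2 * INR n + 2) * b (S n))); [ring|].
rewrite A, B. transitivity ((2 * INR n + 2) * ((2 * INR n + 1) * (w n * b n))); [ring|].
rewrite IHn. ring.
Qed.

Lemma w_b_S n : (2 * INR n + 2) * (w n * b (S n)) = 1.
Proof.
rewrite <- (w_b n). transitivity (w n * ((2 * INR n + 2) * b (S n))); [ring|]. rewrite b_S. ring.
Qed.

Lemma b_sqr_le n : b n * b n <= / (2 * INR n + 1).
Proof.
induction n; [rewrite b_0; simpl; lra|]. assert (Q := pos_INR n). rewrite S_INR.
replace (b (S n)) with ((2 * INR n + 1) * b n / (2 * INR n + 2)).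
2:{ rewrite <- b_S. field. lra. }
apply Rle_trans with ((2 * INR n + 1) * (2 * INR n + 1) / ((2 * INR n + 2) * (2 * INR n + 2)) * / (2 * INR n + 1)).
- replace ((2 * INR n + 1) * b n / (2 * INR n + 2) * ((2 * INR n + 1) * b n / (2 * INR n + 2))) with
   ((2 * INR n + 1) * (2 * INR n + 1) / ((2 * INR n + 2) * (2 * INR n + 2)) * (b n * b n)) by (field; lra).
  apply Rmult_le_compat_l; auto. left; apply Rdiv_lt_0_compat; nra.
- apply Rminus_le.
  match goal with |- ?x <= 0 => replace x with (- / ((2 * INR n + 2) * (2 * INR n + 2) * (2 * INR n + 3))) by (field; lra) end.
  apply Rge_le, Ropp_0_le_ge_contravar. inv_ge0; nra.
Qed.

Lemma w_sqr_le n : w n * w n <= / (INR n + 1).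
Proof.
induction n; [rewrite w_0; simpl; lra|]. assert (Q := pos_INR n). rewrite S_INR.
replace (w (S n)) with ((2 * INR n + 2) * w n / (2 * INR n + 3)).
2:{ rewrite <- w_S. field. lra. }
apply Rle_trans with ((2 * INR n + 2) * (2 * INR n + 2) / ((2 * INR n + 3) * (2 * INR n + 3)) * / (INR n + 1)).
- replace ((2 * INR n + 2) * w n / (2 * INR n + 3) * ((2 * INR n + 2) * w n / (2 * INR n + 3))) with
   ((2 * INR n + 2) * (2 * INR n + 2) / ((2 * INR n + 3) * (2 * INR n + 3)) * (w n * w n)) by (field; lra).
  apply Rmult_le_compat_l; auto. left; apply Rdiv_lt_0_compat; nra.
- apply Rminus_le.
  match goal with |- ?x <= 0 => replace x with (- / ((2 * INR n + 3) * (2 * INR n + 3) * (INR n + 2))) by (field; lra) end.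
  apply Rge_le, Ropp_0_le_ge_contravar. inv_ge0; nra.
Qed.

(* Antiderivatives of [sin^(2l+1)] and [sin^(2n)] vanishing at 0. *)
Fixpoint sin_odd (l : nat) (v : R) : R :=
  match l with
  | O => 1 - cos v
  | S k => ((2 * INR k + 2) * sin_odd k v - cos v * sin v ^ (2 * k + 2)) / (2 * INR k + 3)
  end.

Fixpoint sin_even (n : nat) (v : R) : R :=
  match n with
  | O => v
  | S k => ((2 * INR k + 1) * sin_even k v - cos v * sin v ^ (2 * k + 1)) / (2 * INR k + 2)
  end.

Lemma deriv_ext f g x l : (forall y, f y = g y) -> derivable_pt_lim f x l -> derivable_pt_lim g x l.
Proof.
intros E H eps He. destruct (H eps He) as [d Hd]. exists d. intros h H1 H2.
rewrite <- !E. auto.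
Qed.

Lemma deriv_sin_pow n v : derivable_pt_lim (fun v => sin v ^ (S n)) v (INR (S n) * sin v ^ n * cos v).
Proof.
apply (derivable_pt_lim_comp sin (fun y => y ^ (S n))); [apply derivable_pt_lim_sin|].
apply (derivable_pt_lim_pow (sin v) (S n)).
Qed.

Lemma deriv_cos_sin_pow n v :
  derivable_pt_lim (fun v => cos v * sin v ^ (S n)) v
   (INR (S n) * sin v ^ n - (INR (S n) + 1) * sin v ^ (S (S n))).
Proof.
assert (E : INR (S n) * sin v ^ n - (INR (S n) + 1) * sin v ^ (S (S n)) =
  - sin v * sin v ^ (S n) + cos v * (INR (S n) * sin v ^ n * cos v)).
{ assert (H := sin2_cos2 v). unfold Rsqr in H.
  replace (cos v * (INR (S n) * sin v ^ n * cos v)) with (INR (S n) * sin v ^ n * (cos v * cos v)) by ring.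
  replace (cos v * cos v) with (1 - sin v * sin v) by lra. simpl pow. ring. }
rewrite E. apply derivable_pt_lim_mult; [apply derivable_pt_lim_cos|apply deriv_sin_pow].
Qed.

Lemma sin_odd_deriv l v : derivable_pt_lim (sin_odd l) v (sin v ^ (2 * l + 1)).
Proof.
revert v. induction l as [|k IH]; intros v.
- apply deriv_ext with (fun y => 1 - cos y); [auto|].
  replace (sin v ^ (2 * 0 + 1)) with (0 - - sin v) by (simpl; ring).
  apply (derivable_pt_lim_minus (fct_cte 1) cos); [apply derivable_pt_lim_const|apply derivable_pt_lim_cos].
- assert (Q := pos_INR k).
  apply deriv_ext with (fun y => / (2 * INR k + 3) * ((2 * INR k + 2) * sin_odd k y - cos y * sin y ^ (S (2 * k + 1)))).
  { intros y. cbn [sin_odd]. replace (2 * k + 2)%nat with (S (2 * k + 1)) by lia. unfold Rdiv; ring. }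
  replace (sin v ^ (2 * S k + 1)) with
    (/ (2 * INR k + 3) * ((2 * INR k + 2) * sin v ^ (2 * k + 1) -
      (INR (S (2 * k + 1)) * sin v ^ (2 * k + 1) - (INR (S (2 * k + 1)) + 1) * sin v ^ (S (S (2 * k + 1)))))).
  2:{ replace (2 * S k + 1)%nat with (S (S (2 * k + 1))) by lia.
      rewrite S_INR, plus_INR, mult_INR. simpl (INR 2). simpl (INR 1). field. lra. }
  apply derivable_pt_lim_scal, derivable_pt_lim_minus; [|apply deriv_cos_sin_pow].
  apply derivable_pt_lim_scal, IH.
Qed.

Lemma sin_even_deriv n v : derivable_pt_lim (sin_even n) v (sin v ^ (2 * n)).
Proof.
revert v. induction n as [|k IH]; intros v.
- apply derivable_pt_lim_id.
- assert (Q := pos_INR k).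
  apply deriv_ext with (fun y => / (2 * INR k + 2) * ((2 * INR k + 1) * sin_even k y - cos y * sin y ^ (S (2 * k)))).
  { intros y. cbn [sin_even]. replace (2 * k + 1)%nat with (S (2 * k)) by lia. unfold Rdiv; ring. }
  replace (sin v ^ (2 * S k)) with
    (/ (2 * INR k + 2) * ((2 * INR k + 1) * sin v ^ (2 * k) -
      (INR (S (2 * k)) * sin v ^ (2 * k) - (INR (S (2 * k)) + 1) * sin v ^ (S (S (2 * k)))))).
  2:{ replace (2 * S k)%nat with (S (S (2 * k))) by lia.
      rewrite S_INR, mult_INR. simpl (INR 2). field. lra. }
  apply derivable_pt_lim_scal, derivable_pt_lim_minus; [|apply deriv_cos_sin_pow].
  apply derivable_pt_lim_scal, IH.
Qed.

Lemma sin_odd_0 l : sin_odd l 0 = 0.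
Proof.
induction l as [|k IH]; simpl; [rewrite cos_0; ring|]. rewrite IH, sin_0, pow_i by lia.
unfold Rdiv; ring.
Qed.

Lemma sin_even_0 l : sin_even l 0 = 0.
Proof.
induction l as [|k IH]; simpl; auto. rewrite IH, sin_0, pow_i by lia.
unfold Rdiv; ring.
Qed.

Lemma sin_odd_PI2 l : sin_odd l (PI/2) = w l.
Proof.
induction l as [|k IH]; simpl; rewrite cos_PI2; [rewrite w_0; ring|].
rewrite IH, Rmult_0_l, Rminus_0_r, <- w_S. assert (Q := pos_INR k). field. lra.
Qed.

Lemma sin_even_PI2 l : sin_even l (PI/2) = PI/2 * b l.
Proof.
induction l as [|k IH]; simpl; [rewrite b_0; ring|]. rewrite cos_PI2.
rewrite IH, Rmult_0_l, Rminus_0_r. assert (Q := pos_INR k).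
replace ((2 * INR k + 1) * (PI / 2 * b k)) with (PI / 2 * ((2 * INR k + 1) * b k)) by ring.
rewrite <- b_S. field. lra.
Qed.

Lemma deriv_nonneg_le (f f' : R -> R) a c : a <= c ->
  (forall x, a <= x <= c -> continuity_pt f x) ->
  (forall x, a < x < c -> derivable_pt_lim f x (f' x)) ->
  (forall x, a < x < c -> 0 <= f' x) -> f a <= f c.
Proof.
intros [Hac| ->] Hc Hd Hp; [|lra].
assert (pr1 : forall x, a < x < c -> derivable_pt f x) by (intros x Hx; exists (f' x); apply Hd; auto).
assert (pr2 : forall x, a < x < c -> derivable_pt id x) by (intros; apply derivable_pt_id).
destruct (MVT f id a c pr1 pr2 Hac Hc (fun x _ => derivable_continuous_pt _ _ (derivable_pt_id x))) as [x [Hx H]].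
rewrite (derive_pt_eq_0 f x (f' x) (pr1 x Hx) (Hd x Hx)) in H.
rewrite (derive_pt_eq_0 id x 1 (pr2 x Hx) (derivable_pt_lim_id x)) in H.
unfold id in H. specialize (Hp x Hx). nra.
Qed.

(** Plays the part of monotonicity of the integral: [f] and [g] are antiderivatives of the functions
    compared. *)
Lemma deriv_le (f g f' g' : R -> R) a c : a <= c ->
  (forall x, a <= x <= c -> continuity_pt f x) ->
  (forall x, a <= x <= c -> continuity_pt g x) ->
  (forall x, a < x < c -> derivable_pt_lim f x (f' x)) ->
  (forall x, a < x < c -> derivable_pt_lim g x (g' x)) ->
  (forall x, a < x < c -> f' x <= g' x) -> f c - f a <= g c - g a.
Proof.
intros Hac Cf Cg Df Dg H.
assert (K := deriv_nonneg_le (fun x => g x - f x) (fun x => g' x - f' x) a c Hac).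
simpl in K. assert (g a - f a <= g c - f c); [|lra].
apply K.
- intros x Hx. apply continuity_pt_minus; auto.
- intros x Hx. apply (derivable_pt_lim_minus g f); auto.
- intros x Hx. specialize (H x Hx). lra.
Qed.

Lemma deriv_cont f x l : derivable_pt_lim f x l -> continuity_pt f x.
Proof. intros H. apply derivable_continuous_pt. exists l; auto. Qed.

Lemma sin_01 x : 0 < x < PI/2 -> 0 < sin x < 1.
Proof.
intros Hx. assert (P := PI_RGT_0). split; [apply sin_gt_0; lra|].
rewrite <- sin_PI2. apply sin_increasing_1; lra.
Qed.

Lemma wallis_lower n : w n <= PI/2 * b n.
Proof.
assert (P := PI_RGT_0).
assert (K : sin_odd n (PI/2) - sin_odd n 0 <= sin_even n (PI/2) - sin_even n 0).
{ apply deriv_le with (fun v => sin v ^ (2 * n + 1)) (fun v => sin v ^ (2 * n)); try lra.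
  - intros x _; eapply deriv_cont, sin_odd_deriv.
  - intros x _; eapply deriv_cont, sin_even_deriv.
  - intros x _; apply sin_odd_deriv.
  - intros x _; apply sin_even_deriv.
  - intros x Hx. assert (S := sin_01 x Hx). apply pow_anti; [lra|lia]. }
rewrite sin_odd_PI2, sin_even_PI2, sin_odd_0, sin_even_0 in K. lra.
Qed.

Lemma wallis_upper n : PI/2 * b (S n) <= w n.
Proof.
assert (P := PI_RGT_0).
assert (K : sin_even (S n) (PI/2) - sin_even (S n) 0 <= sin_odd n (PI/2) - sin_odd n 0).
{ apply deriv_le with (fun v => sin v ^ (2 * S n)) (fun v => sin v ^ (2 * n + 1)); try lra.
  - intros x _; eapply deriv_cont, sin_even_deriv.
  - intros x _; eapply deriv_cont, sin_odd_deriv.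
  - intros x _; apply sin_even_deriv.
  - intros x _; apply sin_odd_deriv.
  - intros x Hx. assert (S := sin_01 x Hx). apply pow_anti; [lra|lia]. }
rewrite sin_odd_PI2, sin_even_PI2, sin_odd_0, sin_even_0 in K. lra.
Qed.

Lemma inv_lin_cv d : 0 < d -> Un_cv (fun n => / (2 * INR n + d)) 0.
Proof.
intros Hd eps He. destruct (archimed_cor1 eps He) as [N [HN1 HN2]].
exists N. intros n Hn. unfold Rdist. rewrite Rminus_0_r.
assert (0 < INR N) by (apply lt_0_INR; lia). assert (INR N <= INR n) by (apply le_INR; lia).
rewrite Rabs_right; [|inv_ge0; lra].
eapply Rle_lt_trans; [|exact HN1]. apply Rinv_le_contravar; lra.
Qed.

Lemma cst_cv c : Un_cv (fun _ => c) c.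
Proof. intros eps He. exists 0%nat. intros n _. unfold Rdist. rewrite Rminus_diag, Rabs_R0. auto. Qed.

Lemma cv_ext u v l : (forall n, u n = v n) -> Un_cv u l -> Un_cv v l.
Proof. intros E H eps He. destruct (H eps He) as [N HN]. exists N. intros n Hn. rewrite <- E. auto. Qed.

Lemma ratio_cv c d : 0 < d -> Un_cv (fun n => (2 * INR n + c) / (2 * INR n + d)) 1.
Proof.
intros Hd. apply cv_ext with (fun n => 1 + (c - d) * / (2 * INR n + d)).
- intros n. assert (Q := pos_INR n). field. lra.
- replace 1 with (1 + (c - d) * 0) at 1 by ring.
  apply CV_plus; [apply cst_cv|]. apply CV_mult; [apply cst_cv|apply inv_lin_cv; auto].
Qed.

Lemma cv_S u l : Un_cv (fun n => u (S n)) l -> Un_cv u l.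
Proof.
intros H eps He. destruct (H eps He) as [N HN]. exists (S N). intros n Hn.
destruct n; [lia|]. apply HN. lia.
Qed.

Lemma cv_of_S u l : Un_cv u l -> Un_cv (fun n => u (S n)) l.
Proof. intros H eps He. destruct (H eps He) as [N HN]. exists N. intros n Hn. apply HN. lia. Qed.

Lemma squeeze u v x l : (forall n, u n <= x n <= v n) -> Un_cv u l -> Un_cv v l -> Un_cv x l.
Proof.
intros H Hu Hv eps He. destruct (Hu eps He) as [N1 H1]. destruct (Hv eps He) as [N2 H2].
exists (max N1 N2). intros n Hn. specialize (H1 n ltac:(lia)). specialize (H2 n ltac:(lia)). specialize (H n).
unfold Rdist in *. apply Rabs_def2 in H1. apply Rabs_def2 in H2. apply Rabs_def1; lra.
Qed.

(** Wallis' product. Multiplied by (2n+2) w_n, the two comparisons of consecutive Wallis integrals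
    become the bounds pi/2 and pi/2 (2n+2)/(2n+1). *)
Lemma w_sqr_cv : Un_cv (fun n => (2 * INR n + 2) * (w n * w n)) (PI/2).
Proof.
assert (P := PI_RGT_0).
apply squeeze with (fun _ => PI/2) (fun n => PI/2 * ((2 * INR n + 2) / (2 * INR n + 1))).
- intros n. assert (Q := pos_INR n). assert (W := w_pos n). split.
  + assert (A := wallis_upper n). assert (B := w_b_S n).
    replace (PI/2) with ((2 * INR n + 2) * (w n * (PI/2 * b (S n)))).
    2:{ transitivity (PI/2 * ((2 * INR n + 2) * (w n * b (S n)))); [ring|rewrite B; ring]. }
    apply Rmult_le_compat_l; [lra|]. apply Rmult_le_compat_l; lra.
  + assert (A := wallis_lower n). assert (B := w_b n).
    replace (PI/2 * ((2 * INR n + 2) / (2 * INR n + 1))) with ((2 * INR n + 2) * (w n * (PI/2 * b n))).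
    2:{ replace (w n * (PI/2 * b n)) with (PI/2 * ((2 * INR n + 1) * (w n * b n)) / (2 * INR n + 1)) by (field; lra).
        rewrite B. field. lra. }
    apply Rmult_le_compat_l; [lra|]. apply Rmult_le_compat_l; lra.
- apply cst_cv.
- replace (PI/2) with (PI/2 * 1) at 1 by ring. apply CV_mult; [apply cst_cv|apply ratio_cv; lra].
Qed.

Lemma b_sqr_cv : Un_cv (fun n => 2 * INR n * (b n * b n)) (2/PI).
Proof.
assert (P := PI_RGT_0). apply cv_S.
apply squeeze with (fun n => 2/PI * ((2 * INR n + 2) / (2 * INR n + 3))) (fun _ => 2/PI).
- intros n. assert (Q := pos_INR n). assert (B := b_pos (S n)). rewrite S_INR. split.
  + assert (A := wallis_lower (S n)). assert (C := w_b (S n)). rewrite S_INR in C.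
    replace (2/PI * ((2 * INR n + 2) / (2 * INR n + 3))) with (2 * (INR n + 1) * (2/PI * w (S n) * b (S n))).
    2:{ replace (2/PI * w (S n) * b (S n)) with (2/PI * ((2 * (INR n + 1) + 1) * (w (S n) * b (S n))) / (2 * INR n + 3)) by (field; lra).
        rewrite C. field. lra. }
    apply Rmult_le_compat_l; [lra|]. apply Rmult_le_compat_r; [lra|].
    apply (Rmult_le_reg_l (PI/2)); [lra|]. replace (PI/2 * (2/PI * w (S n))) with (w (S n)) by (field; lra). auto.
  + assert (A := wallis_upper n). assert (C := w_b_S n).
    replace (2/PI) with (2 * (INR n + 1) * (2/PI * w n * b (S n))).
    2:{ transitivity (2/PI * ((2 * INR n + 2) * (w n * b (S n)))); [ring|rewrite C; ring]. }
    apply Rmult_le_compat_l; [lra|]. apply Rmult_le_compat_r; [lra|].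
    apply (Rmult_le_reg_l (PI/2)); [lra|]. replace (PI/2 * (2/PI * w n)) with (w n) by (field; lra). auto.
- replace (2/PI) with (2/PI * 1) at 1 by ring. apply CV_mult; [apply cst_cv|apply ratio_cv; lra].
- apply cst_cv.
Qed.

(** * Telescoping and summable majorants *)

Lemma tele_sum (f u : nat -> R) N : (forall n, f n = u (S n) - u n) -> sum_f_R0 f N = u (S N) - u 0%nat.
Proof. intros H. induction N; simpl; [apply H|]. rewrite IHN, H. ring. Qed.

Lemma tele_infinite (f u : nat -> R) l : (forall n, f n = u (S n) - u n) -> Un_cv u l ->
  infinite_sum f (l - u 0%nat).
Proof.
intros H Hu. assert (K := CV_minus _ _ _ _ (cv_of_S _ _ Hu) (cst_cv (u 0%nat))).
intros eps He. destruct (K eps He) as [N HN]. exists N. intros n Hn.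
rewrite (tele_sum f u) by auto. apply HN; auto.
Qed.

Lemma hsum_tele (f u : nat -> R) s l : hsum f s -> (forall n, f n = u (S n) - u n) -> Un_cv u l ->
  s = l - u 0%nat.
Proof.
intros Hs H Hu. apply (uniqueness_sum f); [apply hsum_infinite_sum; auto|apply tele_infinite; auto].
Qed.

Lemma hsum_dom_ex T (f g : T -> R) s : (forall x, Rabs (f x) <= g x) -> hsum g s -> exists a, hsum f a.
Proof. intros H Hg. destruct (hsum_dom _ f g s H Hg) as [a [Ha _]]. exists a; auto. Qed.

Lemma hsum_inv_sqr : exists s, hsum (fun n => / ((INR n + 1) * (INR n + 1))) s.
Proof.
(* The majorant 1 / ((n + 1/2)(n + 3/2)) is the difference of consecutive values of -1 / (n +
   1/2). *)
assert (H : infinite_sum (fun n => (- / (INR (S n) + /2)) - (- / (INR n + /2))) (0 - (- / (INR 0 + /2)))).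
{ apply (tele_infinite _ (fun n => - / (INR n + /2))); auto.
  apply cv_ext with (fun n => (-2) * / (2 * INR n + 1)); [intros n; assert (Q := pos_INR n); field; lra|].
  replace 0 with ((-2) * 0) by ring. apply CV_mult; [apply cst_cv|apply inv_lin_cv; lra]. }
assert (E : forall n, - / (INR (S n) + / 2) - - / (INR n + / 2) = / ((INR n + /2) * (INR n + 3/2))).
{ intros n. rewrite S_INR. assert (Q := pos_INR n). field. lra. }
apply infinite_sum_hsum in H.
2:{ intros n. rewrite E. assert (Q := pos_INR n). left. apply Rinv_0_lt_compat. nra. }
eapply hsum_dom_ex; [|exact H]. intros n. cbv beta. rewrite E. assert (Q := pos_INR n).
rewrite Rabs_right; [|inv_ge0; nra].
apply Rinv_le_contravar; nra.
Qed.

(** The antiderivative -2/sqrt(x) of x^(-3/2) is doubled to -4/sqrt(x), so that its forward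
    differences dominate the terms; the margin suffices because consecutive roots have ratio at most
    3/2. *)
Lemma hsum_inv_32 : exists s, hsum (fun n => / ((INR n + 1) * sqrt (INR n + 1))) s.
Proof.
set (u := fun n => - 4 / sqrt (INR n + 1)).
assert (Hs : forall n, 0 < sqrt (INR n + 1)) by (intros n; apply sqrt_lt_R0; assert (Q := pos_INR n); lra).
assert (Hq : forall n, sqrt (INR n + 1) * sqrt (INR n + 1) = INR n + 1) by (intros n; apply sqrt_sqrt; assert (Q := pos_INR n); lra).
assert (H : infinite_sum (fun n => u (S n) - u n) (0 - u 0%nat)).
{ apply tele_infinite; auto.
  intros eps He. destruct (archimed_cor1 (eps * eps / 16) ltac:(nra)) as [N [HN1 HN2]].
  exists N. intros n Hn. unfold Rdist, u. rewrite Rminus_0_r.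
  unfold Rdiv. rewrite Rabs_mult, (Rabs_left (-4)), Rabs_right; [|inv_ge0; auto|lra].
  assert (0 < INR N) by (apply lt_0_INR; lia). assert (INR N <= INR n) by (apply le_INR; lia).
  apply Rnot_le_lt; intros Hle.
  assert (eps * sqrt (INR n + 1) <= 4).
  { apply (Rmult_le_compat_r (sqrt (INR n + 1))) in Hle; [|left; auto].
    rewrite Rmult_assoc, Rinv_l in Hle; [lra|]. specialize (Hs n). lra. }
  assert (eps * eps * (INR n + 1) <= 16).
  { rewrite <- (Hq n). specialize (Hs n).
    replace (eps * eps * (sqrt (INR n + 1) * sqrt (INR n + 1))) with ((eps * sqrt (INR n + 1)) * (eps * sqrt (INR n + 1))) by ring.
    assert (0 < eps * sqrt (INR n + 1)) by nra. nra. }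
  apply (Rmult_lt_compat_r (INR N)) in HN1; auto. rewrite Rinv_l in HN1 by lra. nra. }
assert (E : forall n, / ((INR n + 1) * sqrt (INR n + 1)) <= u (S n) - u n).
{ intros n. unfold u. rewrite S_INR. assert (Q := pos_INR n).
  assert (A := Hs n). assert (B := Hq n). assert (C := Hs (S n)). assert (D := Hq (S n)). rewrite S_INR in C, D.
  set (x := sqrt (INR n + 1)) in *. set (y := sqrt (INR n + 1 + 1)) in *.
  assert (Hxy : x <= y) by (apply sqrt_le_1; lra).
  assert (y <= 3/2 * x) by nra.
  assert (K : (y - x) * (y + x) = 1) by nra.
  assert (4 * (y - x) * (x * x) >= y).
  { assert ((y - x) * (5/2 * x) >= 1) by nra. nra. }
  replace (-4 / y - -4 / x) with (4 * (y - x) / (x * y)) by (field; lra).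
  rewrite <- B. apply (Rmult_le_reg_r (x * x * x * y)); [repeat apply Rmult_lt_0_compat; auto|].
  replace (/ (x * x * x) * (x * x * x * y)) with y by (field; lra).
  replace (4 * (y - x) / (x * y) * (x * x * x * y)) with (4 * (y - x) * (x * x)) by (field; lra). lra. }
apply infinite_sum_hsum in H.
2:{ intros n. eapply Rle_trans; [|apply E]. left. apply Rinv_0_lt_compat, Rmult_lt_0_compat; auto.
    assert (Q := pos_INR n). lra. }
eapply hsum_dom_ex; [|exact H]. intros n. cbv beta. 
rewrite Rabs_right; [apply E|]. apply Rle_ge. left. apply Rinv_0_lt_compat, Rmult_lt_0_compat; auto.
assert (Q := pos_INR n). lra.
Qed.

(** Since (m+1)(n+1) <= (m+n+1)^2, the third factor is at least the product of the square roots of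
    the other two, and the majorant splits into two series with exponent 3/2. *)
Lemma hsum_inv_triple : exists s,
  hsum (fun x : nat * nat => / ((INR (fst x) + 1) * (INR (snd x) + 1) * (INR (fst x) + INR (snd x) + 1))) s.
Proof.
destruct hsum_inv_32 as [s Hs].
eapply hsum_dom_ex; [|apply (hsum_mul Hs Hs)].
intros [m n]; cbn [fst snd]. assert (Q := pos_INR n). assert (Q' := pos_INR m).
rewrite Rabs_right.
2:{ inv_ge0; repeat apply Rmult_lt_0_compat; lra. }
rewrite <- Rinv_mult. 
assert (A := sqrt_sqrt (INR n + 1) ltac:(lra)). assert (B := sqrt_sqrt (INR m + 1) ltac:(lra)).
assert (C := sqrt_lt_R0 (INR n + 1) ltac:(lra)). assert (D := sqrt_lt_R0 (INR m + 1) ltac:(lra)).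
set (x := sqrt (INR n + 1)) in *. set (y := sqrt (INR m + 1)) in *.
apply Rinv_le_contravar; [repeat apply Rmult_lt_0_compat; lra|].
replace ((INR m + 1) * y * ((INR n + 1) * x)) with ((INR m + 1) * (INR n + 1) * (x * y)) by ring.
apply Rmult_le_compat_l; [nra|].
assert (x * y * (x * y) <= (INR m + INR n + 1) * (INR m + INR n + 1)).
{ replace (x * y * (x * y)) with ((x * x) * (y * y)) by ring. rewrite A, B. nra. }
assert (0 < x * y) by (apply Rmult_lt_0_compat; auto).
apply Rnot_lt_le; intros Hl. nra.
Qed.

Definition odd (k : nat) : R := 2 * INR k + 1.
(** The nonprincipal character modulo 4, evaluated at the odd number [odd k]. *)
Definition chi (k : nat) : R := (-1) ^ k.

Lemma odd_pos k : 0 < odd k.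
Proof. unfold odd; assert (Q := pos_INR k); lra. Qed.

Lemma odd_ge k : INR k + 1 <= odd k.
Proof. unfold odd; assert (Q := pos_INR k); lra. Qed.

Lemma chi_abs k : Rabs (chi k) = 1.
Proof. apply pow_1_abs. Qed.

Lemma chi_sqr k : chi k * chi k = 1.
Proof.
unfold chi. rewrite <- Rpow_mult_distr. replace (-1 * -1) with 1 by ring. apply pow1.
Qed.

Lemma hsum_inv_odd_sqr (c : nat -> R) : (forall k, Rabs (c k) <= / (odd k * odd k)) -> hsum c (tsum c).
Proof.
intros H. apply tsum_spec. destruct hsum_inv_sqr as [s Hs].
eapply hsum_dom_ex; [|exact Hs]. intros k. cbv beta. eapply Rle_trans; [apply H|].
assert (A := odd_ge k). assert (Q := pos_INR k). apply Rinv_le_contravar; nra.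
Qed.

Definition beta2 := tsum (fun k => chi k / (odd k * odd k)).
Definition beta4 := tsum (fun k => chi k / odd k ^ 4).
Definition lambda3 := tsum (fun k => / odd k ^ 3).

Lemma odd_ge1 k : 1 <= odd k.
Proof. unfold odd; assert (Q := pos_INR k); lra. Qed.

Lemma beta2_spec : hsum (fun k => chi k / (odd k * odd k)) beta2.
Proof.
apply hsum_inv_odd_sqr. intros k. unfold Rdiv. rewrite Rabs_mult, chi_abs, Rmult_1_l, Rabs_right; [lra|].
assert (A := odd_pos k). inv_ge0; nra.
Qed.

Lemma beta4_spec : hsum (fun k => chi k / odd k ^ 4) beta4.
Proof.
apply hsum_inv_odd_sqr. intros k. unfold Rdiv. rewrite Rabs_mult, chi_abs, Rmult_1_l.
assert (A := odd_ge1 k). assert (B : odd k * odd k <= odd k ^ 4).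
{ simpl. assert (1 <= odd k * odd k) by nra. replace (odd k * (odd k * (odd k * (odd k * 1)))) with ((odd k * odd k) * (odd k * odd k)) by ring. nra. }
rewrite Rabs_right; [apply Rinv_le_contravar; nra|].
inv_ge0; nra.
Qed.

Lemma lambda3_spec : hsum (fun k => / odd k ^ 3) lambda3.
Proof.
apply hsum_inv_odd_sqr. intros k.
assert (A := odd_ge1 k). assert (B : odd k * odd k <= odd k ^ 3).
{ simpl. assert (1 <= odd k * odd k) by nra. nra. }
rewrite Rabs_right; [apply Rinv_le_contravar; nra|].
inv_ge0; nra.
Qed.

(** * Moments of the complete elliptic integral *)

(* [moment m] is [2 / PI] times the integral over [0, 1] of [x^(2m) K(x)]. *)
Definition moment (m : nat) : R := tsum (fun n => b n * b n / (2 * INR m + 2 * INR n + 1)).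

Lemma moment_spec m : hsum (fun n => b n * b n / (2 * INR m + 2 * INR n + 1)) (moment m).
Proof.
apply hsum_inv_odd_sqr. intros n. assert (A := b_sqr_le n). assert (B := b_pos n).
assert (Q := pos_INR n). assert (Q' := pos_INR m).
unfold Rdiv. rewrite Rabs_mult, !Rabs_right; [|inv_ge0; lra|nra].
rewrite Rinv_mult. unfold odd. apply Rmult_le_compat; auto; [nra|inv_ge0; lra|].
apply Rinv_le_contravar; lra.
Qed.

(** The terms of the difference telescope in n with certificate 4 n^2 b_n^2 / (2n+2m+1), whose limit
    2/pi is the inhomogeneous term. *)
Lemma moment_S m :
  (2 * INR m + 2) * (2 * INR m + 2) * moment (S m) = (2 * INR m + 1) * (2 * INR m + 1) * moment m + 2 / PI.
Proof.
assert (K := hsum_minus _ _ _ _ _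
  (hsum_scal _ ((2 * INR m + 2) * (2 * INR m + 2)) _ _ (moment_spec (S m)))
  (hsum_scal _ ((2 * INR m + 1) * (2 * INR m + 1)) _ _ (moment_spec m))).
apply (hsum_tele _ (fun n => 2 * INR n * (b n * b n) * ((2 * INR n + 0) / (2 * INR n + (2 * INR m + 1)))) _ (2/PI * 1)) in K.
- simpl (INR 0) in K. assert (E := K). rewrite Rmult_0_r, !Rmult_0_l in E. lra.
- intros n. cbv beta. assert (Q := pos_INR n). assert (Q' := pos_INR m).
  replace (b (S n)) with ((2 * INR n + 1) * b n / (2 * INR n + 2)) by (rewrite <- b_S; field; lra).
  rewrite !S_INR. field. lra.
- apply CV_mult; [apply b_sqr_cv|]. apply ratio_cv. assert (Q' := pos_INR m). lra.
Qed.

(* [leg k n] is the integral over [0, 1] of [t^n P_k(2t - 1)], with [P_k] the Legendre polynomial. *)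
Fixpoint leg (k n : nat) : R :=
  match k with
  | O => / (INR n + 1)
  | S j => leg j n * (INR n - INR j) / (INR n + INR j + 2)
  end.

Lemma leg_zero k n : (n < k)%nat -> leg k n = 0.
Proof.
induction k; intros H; [lia|]. simpl. destruct (Nat.eq_dec n k) as [->|Hne].
- unfold Rdiv. rewrite Rminus_diag. ring.
- rewrite IHk by lia. unfold Rdiv. ring.
Qed.

Lemma leg_nonneg k n : 0 <= leg k n.
Proof.
induction k; simpl; assert (Q := pos_INR n); [inv_ge0; lra|].
assert (Q' := pos_INR k).
destruct (Nat.le_gt_cases k n) as [H|H].
- apply le_INR in H. unfold Rdiv. apply Rmult_le_pos; [apply Rmult_le_pos; lra|].
  inv_ge0; lra.
- rewrite leg_zero by auto. unfold Rdiv. lra.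
Qed.

Lemma leg_rec k n : (INR n + 1) * (INR n + 1) * leg k n = (INR n + 1 - INR k) * (INR n + 2 + INR k) * leg k (S n).
Proof.
induction k; cbn [leg]; rewrite S_INR; assert (Q := pos_INR n).
- simpl (INR 0). field. lra.
- assert (Q' := pos_INR k).
  replace ((INR n + 1) * (INR n + 1) * (leg k n * (INR n - INR k) / (INR n + INR k + 2))) with
   (((INR n + 1) * (INR n + 1) * leg k n) * (INR n - INR k) / (INR n + INR k + 2)) by (field; lra).
  rewrite IHk, (S_INR n). field. lra.
Qed.

Lemma leg_cv k : Un_cv (fun n => (2 * INR n + 2) * leg k n) 2.
Proof.
induction k.
- apply cv_ext with (fun _ => 2); [|apply cst_cv]. intros n; simpl. assert (Q := pos_INR n). field. lra.
- apply cv_ext with (fun n => (2 * INR n + 2) * leg k n * ((2 * INR n + (- 2 * INR k)) / (2 * INR n + (2 * INR k + 4)))).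
  + intros n. simpl. assert (Q := pos_INR n). assert (Q' := pos_INR k). field. lra.
  + replace 2 with (2 * 1) at 1 by ring. apply CV_mult; auto. apply ratio_cv. assert (Q' := pos_INR k). lra.
Qed.

(** Up to the factor 2/pi, the integral of K(sqrt t) P_k(2t-1) over [0, 1]. Both factors are
    eigenfunctions of y -> (t (1-t) y')', with eigenvalues 1/4 and -k (k+1), whose difference is
    (2k+1)^2 / 4; only the boundary term at t = 1 survives. The telescoping in n is the series form
    of this argument. *)
Lemma leg_moment k : hsum (fun n => b n * b n * leg k n) (4 / PI / (odd k * odd k)).
Proof.
assert (P := PI_RGT_0). assert (O := odd_pos k).
apply infinite_sum_hsum.
{ intros n. apply Rmult_le_pos; [left; apply Rmult_lt_0_compat; apply b_pos|apply leg_nonneg]. }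
(* The certificate involves [leg k (n - 1)]; at n = 0 its factor 2n vanishes, whence the separate
   value 0. *)
set (u := fun n => match n with O => 0 | S n' => (2 * INR n) * (b n * b n) * ((2 * INR n' + 2) * leg k n') / (odd k * odd k) end).
replace (4 / PI / (odd k * odd k)) with (2 / PI * 2 / (odd k * odd k) - u 0%nat) by (simpl; field; lra).
apply tele_infinite.
- intros n. unfold u. assert (Q := pos_INR n).
  assert (E : (2 * INR (S n)) * (b (S n) * b (S n)) * ((2 * INR n + 2) * leg k n) =
     (2 * INR n + 1) * (2 * INR n + 1) * (b n * b n) * leg k n).
  { rewrite S_INR. transitivity (((2 * INR n + 2) * b (S n)) * ((2 * INR n + 2) * b (S n)) * leg k n); [ring|].
    rewrite b_S. ring. }
  rewrite E. destruct n as [|n].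
  + simpl (INR 0). destruct k as [|k].
    * unfold odd; simpl. field.
    * rewrite (leg_zero (S k) 0) by lia. field. lra.
  + assert (R := leg_rec k n). rewrite S_INR in *. assert (Q' := pos_INR n).
    replace (2 * (INR n + 1) * (b (S n) * b (S n)) * ((2 * INR n + 2) * leg k n)) with
      (4 * (b (S n) * b (S n)) * ((INR n + 1) * (INR n + 1) * leg k n)) by ring.
    rewrite R. unfold odd. unfold odd in O. field. lra.
- apply cv_S. unfold u. unfold Rdiv at 2. unfold Rdiv at 2.
  apply CV_mult; [|apply cst_cv]. apply CV_mult; [|apply leg_cv].
  apply (cv_of_S (fun n => 2 * INR n * (b n * b n))), b_sqr_cv.
Qed.

(** The generating function of the Legendre polynomials at -1 gives 1 / (2 sqrt t) as the
    alternating sum of P_k(2t-1), and the right side is its integral against t^n. Here the sum is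
    finite and telescopes in k. *)
Lemma leg_alt n : hsum (fun k => chi k * leg k n) (/ (2 * INR n + 1)).
Proof.
assert (Q := pos_INR n).
assert (H := hsum_fin _ (fun k => chi k * leg k n) (seq 0 (S n)) (seq_NoDup _ _)).
assert (Hf : hsum (fun k => chi k * leg k n) (lsum (fun k => chi k * leg k n) (seq 0 (S n)))).
{ apply H. intros k Hk. rewrite in_seq in Hk. rewrite leg_zero by lia. ring. }
replace (/ (2 * INR n + 1)) with (lsum (fun k => chi k * leg k n) (seq 0 (S n))); auto.
set (u := fun k => - (chi k * (INR n + INR k + 1) * leg k n) / (2 * INR n + 1)).
rewrite (hsum_tele _ u _ 0 Hf).
- unfold u, chi; simpl. field. lra.
- intros k. unfold u, chi. rewrite S_INR. simpl. assert (Q' := pos_INR k). field. lra.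
- intros eps He. exists (S n). intros k Hk. unfold u. rewrite leg_zero by lia.
  rewrite Rmult_0_r, Ropp_0. unfold Rdiv. rewrite Rmult_0_l. unfold Rdist. rewrite Rminus_0_r, Rabs_R0. auto.
Qed.

(** The alternating expansion of 1 / (2 sqrt t) is paired with the Legendre integrals of K.
    Positivity of [leg] together with [leg_moment] gives the absolute convergence that permits the
    exchange. *)
Lemma moment_0 : moment 0 = 4 / PI * beta2.
Proof.
assert (P := PI_RGT_0).
assert (Hrow : hsum (fun k => 4 / PI / (odd k * odd k)) (4 / PI * tsum (fun k => / (odd k * odd k)))).
{ eapply hsum_ext; [|apply hsum_scal, (hsum_inv_odd_sqr (fun k => / (odd k * odd k)))]; [intros k; simpl; reflexivity|].
  intros k. rewrite Rabs_right; [lra|]. assert (A := odd_pos k). inv_ge0; nra. }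
assert (Hp : forall x : nat * nat, 0 <= b (snd x) * b (snd x) * leg (fst x) (snd x)).
{ intros x. apply Rmult_le_pos; [left; apply Rmult_lt_0_compat; apply b_pos|apply leg_nonneg]. }
assert (Hpos := hsum_tonelli _ _ (fun x : nat * nat => b (snd x) * b (snd x) * leg (fst x) (snd x)) _ _ Hp leg_moment Hrow).
assert (exists s, hsum (fun x : nat * nat => chi (fst x) * (b (snd x) * b (snd x) * leg (fst x) (snd x))) s) as [s Hs].
{ eapply hsum_dom_ex; [|exact Hpos].
  intros x. rewrite Rabs_mult, chi_abs, Rmult_1_l. apply Req_le, Rabs_right, Rle_ge, Hp. }
assert (H1 : hsum (fun k => 4 / PI * (chi k / (odd k * odd k))) s).
{ apply (hsum_fubini _ _ _ _ _ Hs). intros k; cbn [fst snd].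
  replace (4 / PI * (chi k / (odd k * odd k))) with (chi k * (4 / PI / (odd k * odd k))).
  - apply hsum_scal, leg_moment.
  - assert (A := odd_pos k). field. lra. }
rewrite (hsum_unique (hsum_scal _ (4/PI) _ _ beta2_spec) H1).
apply (@hsum_unique _ (fun n => b n * b n / (2 * INR 0 + 2 * INR n + 1))); [apply moment_spec|].
apply (hsum_fubini _ _ _ _ _ (hsum_swap _ _ _ _ Hs)). intros n; cbn [fst snd].
replace (b n * b n / (2 * INR 0 + 2 * INR n + 1)) with (b n * b n * / (2 * INR n + 1)) by
 (simpl (INR 0); assert (Q := pos_INR n); field; lra).
eapply hsum_ext; [|apply hsum_scal, leg_alt]. intros k; simpl; ring.
Qed.

(* [half_leg k m] is half the integral over [0, 1] of [t^(m - 1/2) P_k(2t - 1)]. *)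
Fixpoint half_leg (k m : nat) : R :=
  match k with
  | O => / (2 * INR m + 1)
  | S j => half_leg j m * (2 * INR m - 2 * INR j - 1) / (2 * INR m + 2 * INR j + 3)
  end.

Lemma half_leg_rec k m :
  (2 * INR m + 1) * (2 * INR m + 1) * half_leg k m =
  ((2 * INR m + 2) * (2 * INR m + 2) - odd k * odd k) * half_leg k (S m).
Proof.
unfold odd. assert (Q := pos_INR m). induction k; cbn [half_leg].
- rewrite S_INR. simpl (INR 0). field. lra.
- assert (Q' := pos_INR k). rewrite (S_INR k).
  replace ((2 * INR m + 1) * (2 * INR m + 1) * (half_leg k m * (2 * INR m - 2 * INR k - 1) / (2 * INR m + 2 * INR k + 3)))
   with (((2 * INR m + 1) * (2 * INR m + 1) * half_leg k m) * (2 * INR m - 2 * INR k - 1) / (2 * INR m + 2 * INR k + 3)) by (field; lra).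
  rewrite IHk, (S_INR m). field. lra.
Qed.

Lemma half_leg_bound k m : Rabs (half_leg k m) <= / (2 * INR m + 2 * INR k + 1).
Proof.
assert (Q := pos_INR m). induction k; cbn [half_leg].
- simpl (INR 0). rewrite Rabs_right; [apply Req_le; f_equal; ring|inv_ge0; lra].
- assert (Q' := pos_INR k). rewrite (S_INR k). unfold Rdiv. rewrite !Rabs_mult.
  rewrite (Rabs_right (/ _)); [|inv_ge0; lra].
  assert (Rabs (2 * INR m - 2 * INR k - 1) <= 2 * INR m + 2 * INR k + 1) by (apply Rabs_le; lra).
  replace (/ (2 * INR m + 2 * (INR k + 1) + 1)) with
   (/ (2 * INR m + 2 * INR k + 1) * (2 * INR m + 2 * INR k + 1) * / (2 * INR m + 2 * INR k + 3)) by (field; lra).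
  apply Rmult_le_compat_r; [inv_ge0; lra|].
  apply Rmult_le_compat; auto; apply Rabs_pos.
Qed.

(** Quadratic decay in k, one order better than [half_leg_bound]: it makes the boundary term of the
    telescoping in [leg_series_S] vanish. *)
Lemma half_leg_S_bound k m :
  Rabs (half_leg k (S m)) <= (2 * INR m + 1) / ((2 * INR m + 2 * INR k + 1) * (2 * INR m + 2 * INR k + 3)).
Proof.
assert (Q := pos_INR m). induction k; cbn [half_leg]; rewrite (S_INR m).
- simpl (INR 0). rewrite Rabs_right; [apply Req_le; field; lra|inv_ge0; lra].
- assert (Q' := pos_INR k). rewrite (S_INR k). unfold Rdiv at 1. rewrite !Rabs_mult.
  rewrite (Rabs_right (/ _)); [|inv_ge0; lra].
  assert (Rabs (2 * (INR m + 1) - 2 * INR k - 1) <= 2 * INR m + 2 * INR k + 1) by (apply Rabs_le; lra).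
  replace ((2 * INR m + 1) / ((2 * INR m + 2 * (INR k + 1) + 1) * (2 * INR m + 2 * (INR k + 1) + 3))) with
   ((2 * INR m + 1) / ((2 * INR m + 2 * INR k + 1) * (2 * INR m + 2 * INR k + 3)) * (2 * INR m + 2 * INR k + 1)
     * / (2 * (INR m + 1) + 2 * INR k + 3)) by (field; lra).
  apply Rmult_le_compat_r; [inv_ge0; lra|].
  apply Rmult_le_compat; auto; apply Rabs_pos.
Qed.

Lemma half_leg_0 k : half_leg k 0 = chi k / odd k.
Proof.
unfold odd, chi. induction k; cbn [half_leg]; simpl (INR 0); [simpl; field|].
rewrite IHk, S_INR. simpl pow. assert (Q := pos_INR k). field. lra.
Qed.

Lemma half_leg_cv k : Un_cv (fun m => (2 * INR m + 1) * half_leg k m) 1.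
Proof.
induction k.
- apply cv_ext with (fun _ => 1); [|apply cst_cv]. intros n; cbn [half_leg]. assert (Q := pos_INR n). field. lra.
- apply cv_ext with (fun n => (2 * INR n + 1) * half_leg k n * ((2 * INR n + (- 2 * INR k - 1)) / (2 * INR n + (2 * INR k + 3)))).
  + intros n. cbn [half_leg]. assert (Q := pos_INR n). assert (Q' := pos_INR k). field. lra.
  + replace 1 with (1 * 1) at 1 by ring. apply CV_mult; auto. apply ratio_cv. assert (Q' := pos_INR k). lra.
Qed.

(** 4/pi times this is Parseval's formula for M_m: the polynomials P_k(2t-1) have squared norm
    1/(2k+1) on [0, 1], which turns the 1/(2k+1)^2 of [leg_moment] into 1/(2k+1). *)
Definition leg_series m := tsum (fun k => half_leg k m / odd k).

Lemma leg_series_spec m : hsum (fun k => half_leg k m / odd k) (leg_series m).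
Proof.
apply hsum_inv_odd_sqr. intros k. assert (A := odd_pos k). assert (Q := pos_INR m).
unfold Rdiv. rewrite Rabs_mult, (Rabs_right (/ _)), Rinv_mult; [|inv_ge0; auto].
apply Rmult_le_compat_r; [inv_ge0; auto|].
eapply Rle_trans; [apply half_leg_bound|]. apply Rinv_le_contravar; unfold odd in *; lra.
Qed.

(** By [half_leg_rec] the terms of the difference reduce to (2k+1) [half_leg k (S m)]. Their sum is
    the Legendre expansion of t^(m+1/2) / 2 at t = 1, hence 1/2; it is computed by telescoping in
    k. *)
Lemma leg_series_S m :
  (2 * INR m + 2) * (2 * INR m + 2) * leg_series (S m) = (2 * INR m + 1) * (2 * INR m + 1) * leg_series m + 1/2.
Proof.
assert (K := hsum_minus _ _ _ _ _
  (hsum_scal _ ((2 * INR m + 2) * (2 * INR m + 2)) _ _ (leg_series_spec (S m)))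
  (hsum_scal _ ((2 * INR m + 1) * (2 * INR m + 1)) _ _ (leg_series_spec m))).
assert (Q := pos_INR m).
set (u := fun k => - (2 * INR m + 2 * INR k + 3) * half_leg k (S m) / 2).
apply (hsum_tele _ u _ 0) in K.
- unfold u in K. cbn [half_leg] in K. rewrite (S_INR m) in K. simpl (INR 0) in K.
  replace (0 - - (2 * INR m + 2 * 0 + 3) * / (2 * (INR m + 1) + 1) / 2) with (1/2) in K by (field; lra). lra.
- intros k. cbv beta. assert (A := odd_pos k). assert (Q' := pos_INR k).
  replace ((2 * INR m + 1) * (2 * INR m + 1) * (half_leg k m / odd k)) with
    ((2 * INR m + 1) * (2 * INR m + 1) * half_leg k m / odd k) by (field; lra).
  rewrite half_leg_rec. unfold u. cbn [half_leg]. rewrite (S_INR m), (S_INR k). unfold odd in *. field. lra.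
- apply squeeze with (fun k => (-1) * ((2 * INR m + 1)/2 * / (2 * INR k + (2 * INR m + 1)))) (fun k => (2 * INR m + 1)/2 * / (2 * INR k + (2 * INR m + 1))).
  + intros k. assert (B := half_leg_S_bound k m). assert (Q' := pos_INR k).
    unfold u. set (x := half_leg k (S m)) in *.
    assert (E : Rabs (- (2 * INR m + 2 * INR k + 3) * x / 2) <= (2 * INR m + 1)/2 * / (2 * INR k + (2 * INR m + 1))).
    { unfold Rdiv at 1. rewrite !Rabs_mult, Rabs_Ropp, !(Rabs_right (_ + _)), (Rabs_right (/2)) by lra.
      replace ((2 * INR m + 1)/2 * / (2 * INR k + (2 * INR m + 1))) with
       ((2 * INR m + 2 * INR k + 3) * ((2 * INR m + 1) / ((2 * INR m + 2 * INR k + 1) * (2 * INR m + 2 * INR k + 3))) * /2) by (field; lra).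
      apply Rmult_le_compat_r; [lra|]. apply Rmult_le_compat_l; lra. }
    assert (F1 := Rle_abs (- (2 * INR m + 2 * INR k + 3) * x / 2)).
    assert (F2 := Rle_abs (- (- (2 * INR m + 2 * INR k + 3) * x / 2))). rewrite Rabs_Ropp in F2. lra.
  + replace 0 with ((-1) * ((2 * INR m + 1)/2 * 0)) by ring.
    repeat (apply CV_mult; [apply cst_cv|]). apply inv_lin_cv. lra.
  + replace 0 with ((2 * INR m + 1)/2 * 0) by ring.
    apply CV_mult; [apply cst_cv|]. apply inv_lin_cv. lra.
Qed.

Lemma leg_series_0 : leg_series 0 = beta2.
Proof.
apply (@hsum_unique _ (fun k => half_leg k 0 / odd k)); [apply leg_series_spec|].
eapply hsum_ext; [|apply beta2_spec]. intros k; cbv beta. rewrite half_leg_0. assert (A := odd_pos k). field. lra.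
Qed.

(** Both sides satisfy the recurrence of [moment_S] and agree at m = 0. *)
Lemma moment_leg m : moment m = 4 / PI * leg_series m.
Proof.
assert (P := PI_RGT_0). induction m; [rewrite leg_series_0; apply moment_0|].
assert (Q := pos_INR m). apply (Rmult_eq_reg_l ((2 * INR m + 2) * (2 * INR m + 2))); [|nra].
rewrite moment_S, IHm.
replace ((2 * INR m + 2) * (2 * INR m + 2) * (4 / PI * leg_series (S m))) with
 (4 / PI * ((2 * INR m + 2) * (2 * INR m + 2) * leg_series (S m))) by ring.
rewrite leg_series_S. field. lra.
Qed.

Fixpoint wsum (m : nat) : R :=
  match m with
  | O => 2 * beta2
  | S k => wsum k + w k * w k
  end.

(** Variation of constants: b_m^2 solves the homogeneous recurrence of [moment_S], and [w_b_S]
    identifies the increments of the remaining factor as w_m^2. *)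
Lemma moment_wsum m : moment m = 2 / PI * (b m * b m) * wsum m.
Proof.
assert (P := PI_RGT_0). induction m; [rewrite moment_0, b_0; simpl; field; lra|].
assert (Q := pos_INR m). apply (Rmult_eq_reg_l ((2 * INR m + 2) * (2 * INR m + 2))); [|nra].
rewrite moment_S, IHm. simpl wsum.
replace ((2 * INR m + 2) * (2 * INR m + 2) * (2 / PI * (b (S m) * b (S m)) * (wsum m + w m * w m))) with
 (2 / PI * (((2 * INR m + 2) * b (S m)) * ((2 * INR m + 2) * b (S m))) * wsum m + 2 / PI * (((2 * INR m + 2) * (w m * b (S m))) * ((2 * INR m + 2) * (w m * b (S m))))) by ring.
rewrite w_b_S, b_S. ring.
Qed.

Lemma w_half_leg_abs : exists s,
  hsum (fun x : nat * nat => w (snd x) * w (snd x) * half_leg (fst x) (S (snd x)) / odd (fst x)) s.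
Proof.
destruct hsum_inv_triple as [s Hs]. eapply hsum_dom_ex; [|exact Hs].
intros [k m]; cbn [fst snd]. assert (A := w_sqr_le m). assert (B := half_leg_bound k (S m)).
assert (C := odd_ge k). assert (Q := pos_INR m). assert (Q' := pos_INR k). assert (W := w_pos m).
rewrite S_INR in B. unfold Rdiv. rewrite !Rabs_mult, !(Rabs_right (w m)), (Rabs_right (/ _)) by
 (try apply Rle_ge; try (inv_ge0); lra).
replace (/ ((INR k + 1) * (INR m + 1) * (INR k + INR m + 1))) with
 (/ (INR m + 1) * / (INR k + INR m + 1) * / (INR k + 1)) by (field; lra).
apply Rmult_le_compat; [|inv_ge0; lra| |apply Rinv_le_contravar; lra].
- apply Rmult_le_pos; [nra|apply Rabs_pos].
- apply Rmult_le_compat; [nra|apply Rabs_pos|auto|].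
  eapply Rle_trans; [exact B|]. apply Rinv_le_contravar; lra.
Qed.

(** By [half_leg_rec] and [w_S], the sequence w_m^2 (2m+1)^2 [half_leg k m] has increments (2k+1)^2
    times the terms. Its limit is pi/2 by Wallis, and its initial value is chi(k) / (2k+1). *)
Lemma w_half_leg_sum k s : hsum (fun m => w m * w m * half_leg k (S m)) s ->
  s = (PI/2 - chi k / odd k) / (odd k * odd k).
Proof.
intros H. assert (A := odd_pos k).
set (u := fun m => (w m * w m) * ((2 * INR m + 1) * (2 * INR m + 1)) * half_leg k m / (odd k * odd k)).
rewrite (hsum_tele _ u _ (PI/2 / (odd k * odd k)) H).
- unfold u. rewrite w_0, half_leg_0. simpl (INR 0). field. lra.
- intros m. unfold u. assert (Q := pos_INR m).
  replace (w m * w m * ((2 * INR m + 1) * (2 * INR m + 1)) * half_leg k m) with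
   (w m * w m * ((2 * INR m + 1) * (2 * INR m + 1) * half_leg k m)) by ring.
  rewrite half_leg_rec.
  replace (w (S m) * w (S m) * ((2 * INR (S m) + 1) * (2 * INR (S m) + 1))) with
   (((2 * INR m + 3) * w (S m)) * ((2 * INR m + 3) * w (S m))) by (rewrite S_INR; ring).
  rewrite w_S. field. lra.
- apply cv_ext with (fun m => (2 * INR m + 2) * (w m * w m) * ((2 * INR m + 1) * half_leg k m) * ((2 * INR m + 1) / (2 * INR m + 2)) * / (odd k * odd k)).
  + intros m. unfold u. assert (Q := pos_INR m). field. lra.
  + replace (PI/2 / (odd k * odd k)) with (PI/2 * 1 * 1 * / (odd k * odd k)) by (field; lra).
    apply CV_mult; [|apply cst_cv]. apply CV_mult; [|apply ratio_cv; lra].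
    apply CV_mult; [apply w_sqr_cv|apply half_leg_cv].
Qed.

Lemma moment_S_sum : hsum (fun m => w m * w m * moment (S m)) (4 / PI * (PI/2 * lambda3 - beta4)).
Proof.
assert (P := PI_RGT_0). destruct w_half_leg_abs as [s Hs].
assert (H1 : hsum (fun k => (PI/2 - chi k / odd k) / (odd k * odd k) / odd k) s).
{ apply (hsum_fubini _ _ _ _ _ Hs). intros k; cbn [fst snd]. assert (A := odd_pos k).
  destruct (hsum_row _ _ _ _ k Hs) as [r Hr]. cbn [fst snd] in Hr.
  assert (K := hsum_scal _ (odd k) _ _ Hr). apply hsum_ext with (g := fun m => w m * w m * half_leg k (S m)) in K;
   [|intros m; cbv beta; field; lra].
  apply w_half_leg_sum in K.
  replace ((PI/2 - chi k / odd k) / (odd k * odd k) / odd k) with r; auto.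
  rewrite <- K. field. lra. }
assert (E : s = PI/2 * lambda3 - beta4).
{ apply (hsum_unique H1). eapply hsum_ext; [|apply hsum_minus; [apply hsum_scal, lambda3_spec|apply beta4_spec]].
  intros k; cbv beta. assert (A := odd_pos k). field. lra. }
rewrite <- E. apply hsum_scal with (c := 4/PI) in Hs. apply hsum_swap in Hs.
apply (hsum_fubini _ _ _ _ _ Hs). intros m; cbn [fst snd].
rewrite moment_leg.
replace (w m * w m * (4 / PI * leg_series (S m))) with (4 / PI * (w m * w m) * leg_series (S m)) by ring.
eapply hsum_ext; [|apply hsum_scal, leg_series_spec]. intros k; cbv beta. assert (A := odd_pos k). field. lra.
Qed.

(** * A double series of Tornheim type *)

Lemma leibniz : Un_cv (fun N => sum_f_R0 (fun j => chi j / odd j) N) (PI/4).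
Proof.
assert (H := Alt_PI_eq). unfold Alt_PI in H. destruct exist_PI as [l Hl].
replace (PI/4) with l by lra.
eapply cv_ext; [|exact Hl]. intros N. apply sum_eq. intros i _.
unfold tg_alt, PI_tg, chi, odd. rewrite plus_INR, mult_INR. simpl (INR 2). simpl (INR 1). reflexivity.
Qed.

(** The partial sum equals the sum of h over a window of fixed length around N minus the sum over
    -i, ..., i. The latter is zero by oddness and the former tends to zero. Convergence may be
    conditional, hence the ordered sums. *)
Lemma odd_tele (h : Z -> R) : (forall d, h (- d)%Z = - h d) ->
  (forall c : Z, Un_cv (fun n => h (Z.of_nat n + c)%Z) 0) ->
  forall i : nat, Un_cv (fun N => sum_f_R0 (fun j => h (Z.of_nat j + (Z.of_nat i + 1))%Z - h (Z.of_nat j + - Z.of_nat i)%Z) N) 0.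
Proof.
intros Ho Hc.
assert (forall c N, sum_f_R0 (fun j => h (Z.of_nat j + (c + 1))%Z - h (Z.of_nat j + c)%Z) N = h (Z.of_nat N + (c + 1))%Z - h c) as Ht.
{ intros c N. rewrite (tele_sum _ (fun j => h (Z.of_nat j + c)%Z)).
  - f_equal. f_equal. lia.
  - intros n. f_equal. f_equal. lia. }
induction i.
- apply cv_ext with (fun N => h (Z.of_nat N + 1)%Z); auto.
  intros N. specialize (Ht 0%Z N). simpl in *. rewrite Ht.
  assert (h 0%Z = 0) by (specialize (Ho 0%Z); simpl in Ho; lra). lra.
- apply cv_ext with (fun N => sum_f_R0 (fun j => h (Z.of_nat j + (Z.of_nat i + 1))%Z - h (Z.of_nat j + - Z.of_nat i)%Z) N
    + h (Z.of_nat N + (Z.of_nat i + 1 + 1))%Z + h (Z.of_nat N + (- Z.of_nat (S i) + 1))%Z).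
  + intros N. assert (T1 := Ht (Z.of_nat i + 1)%Z N). assert (T2 := Ht (- Z.of_nat (S i))%Z N).
    rewrite Ho in T2. replace (Z.of_nat (S i)) with (Z.of_nat i + 1)%Z in * by lia.
    replace (sum_f_R0 (fun j => h (Z.of_nat j + (Z.of_nat i + 1 + 1))%Z - h (Z.of_nat j + - (Z.of_nat i + 1))%Z) N) with
     (sum_f_R0 (fun j => h (Z.of_nat j + (Z.of_nat i + 1))%Z - h (Z.of_nat j + - Z.of_nat i)%Z) N
      + sum_f_R0 (fun j => h (Z.of_nat j + (Z.of_nat i + 1 + 1))%Z - h (Z.of_nat j + (Z.of_nat i + 1))%Z) N
      + sum_f_R0 (fun j => h (Z.of_nat j + (- (Z.of_nat i + 1) + 1))%Z - h (Z.of_nat j + - (Z.of_nat i + 1))%Z) N).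
    * rewrite T1, T2. ring.
    * rewrite <- !plus_sum. apply sum_eq. intros j _.
      replace (- (Z.of_nat i + 1) + 1)%Z with (- Z.of_nat i)%Z by lia. ring.
  + replace 0 with (0 + 0 + 0) by ring. repeat apply CV_plus; auto.
Qed.

Lemma inv_Z_cv c : Un_cv (fun n => / (2 * IZR (Z.of_nat n + c))) 0.
Proof.
intros eps He. destruct (inv_lin_cv 1 ltac:(lra) eps He) as [N HN].
exists (N + Z.abs_nat c + 1)%nat. intros n Hn.
specialize (HN (Z.to_nat (Z.of_nat n + c) - 1)%nat ltac:(lia)). unfold Rdist in *.
rewrite Rminus_0_r in *.
assert (E : 2 * INR (Z.to_nat (Z.of_nat n + c) - 1) + 1 = 2 * IZR (Z.of_nat n + c) - 1).
{ rewrite minus_INR by lia. rewrite INR_IZR_INZ. rewrite Z2Nat.id by lia. simpl. ring. }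
rewrite E in HN. assert (1 <= IZR (Z.of_nat n + c)) by (apply (IZR_le 1); lia).
eapply Rle_lt_trans; [|exact HN]. rewrite !Rabs_right; try (inv_ge0; lra).
apply Rinv_le_contravar; lra.
Qed.

(* Since [/ 0 = 0], this is an odd function, also at [d = 0]. *)
Definition hodd (s : bool) (d : Z) : R := (if s then sg d else 1) * / (2 * IZR d).

Lemma hodd_opp s d : hodd s (- d) = - hodd s d.
Proof.
unfold hodd. rewrite sg_opp, opp_IZR.
replace (2 * - IZR d) with (- (2 * IZR d)) by ring. rewrite Rinv_opp. ring.
Qed.

Lemma hodd_cv s c : Un_cv (fun n => hodd s (Z.of_nat n + c)) 0.
Proof.
intros eps He. destruct (inv_Z_cv c eps He) as [N HN]. exists N. intros n Hn.
specialize (HN n Hn). unfold Rdist, hodd in *. rewrite Rminus_0_r in *. rewrite Rabs_mult.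
replace (Rabs (if s then sg (Z.of_nat n + c) else 1)) with 1; [lra|].
destruct s; [rewrite sg_abs; auto|rewrite Rabs_R1; auto].
Qed.

Definition inv_diff (i j : nat) : R := if Nat.eq_dec i j then 0 else / (odd i * odd i - odd j * odd j).

Definition quad (d : Z) : R := / ((INR (Z.abs_nat d) + 1) * (INR (Z.abs_nat d) + 1)).

Lemma quad_spec : exists s, hsum quad s.
Proof.
destruct hsum_inv_sqr as [s Hs].
assert (exists s', hsum (fun n => quad (- Z.of_nat n - 1)) s') as [s' Hs'].
{ eapply hsum_dom_ex; [|exact Hs]. intros n. unfold quad.
  replace (Z.abs_nat (- Z.of_nat n - 1)) with (S n) by lia. rewrite S_INR. assert (Q := pos_INR n). cbv beta.
  rewrite Rabs_right; [apply Rinv_le_contravar; nra|inv_ge0; nra]. }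
exists (s + s'). apply hsum_Z; auto. eapply hsum_ext; [|exact Hs].
intros n; unfold quad; cbv beta. rewrite Zabs2Nat.id. auto.
Qed.

Lemma quad_pos d : 0 < quad d.
Proof. unfold quad. assert (Q := pos_INR (Z.abs_nat d)). apply Rinv_0_lt_compat. nra. Qed.

Lemma hsum_inj_ex T U (e : U -> T) (g : T -> R) s : (forall u v, e u = e v -> u = v) ->
  hsum g s -> exists s', hsum (fun u => g (e u)) s'.
Proof.
intros He H. destruct (hsum_bounded_by _ _ _ H) as [B HB]. apply (hsum_bounded _ _ B).
intros l Hl. rewrite <- (lsum_map _ _ e (fun x => Rabs (g x))). apply HB, NoDup_map_inj; auto.
Qed.

Lemma odd_diff i j : i <> j -> odd i - odd j <> 0.
Proof. unfold odd. intros H E. apply H, INR_eq. lra. Qed.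

Lemma odd_sqr_diff i j : i <> j -> odd i * odd i - odd j * odd j <> 0.
Proof.
intros H E. assert (A := odd_pos i). assert (B := odd_pos j). apply (odd_diff i j H).
apply (Rmult_eq_reg_r (odd i + odd j)); lra.
Qed.

(** With d = i - j one has |odd i - odd j| = 2|d| <= odd i + odd j, so the denominator is at least 4
    d^2. The bound depends on d alone, so it can be summed over either index. *)
Lemma inv_diff_bound i j : Rabs (inv_diff i j) <= quad (Z.of_nat i - Z.of_nat j).
Proof.
unfold inv_diff. destruct (Nat.eq_dec i j) as [->|Hne].
- rewrite Rabs_R0. left; apply quad_pos.
- assert (A := odd_pos i). assert (B := odd_pos j). 
  rewrite Rabs_inv. unfold quad. assert (Q := pos_INR (Z.abs_nat (Z.of_nat i - Z.of_nat j))).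
  apply Rinv_le_contravar; [nra|].
  replace (odd i * odd i - odd j * odd j) with ((odd i - odd j) * (odd i + odd j)) by ring.
  rewrite Rabs_mult, (Rabs_right (odd i + odd j)) by lra.
  assert (E : Rabs (odd i - odd j) = 2 * INR (Z.abs_nat (Z.of_nat i - Z.of_nat j))).
  { rewrite <- IZR_abs_nat, minus_IZR, <- !INR_IZR_INZ. unfold odd.
    replace (2 * INR i + 1 - (2 * INR j + 1)) with (2 * (INR i - INR j)) by ring.
    rewrite Rabs_mult, (Rabs_right 2); lra. }
  assert (Rabs (odd i - odd j) <= odd i + odd j) by (apply Rabs_le; lra).
  assert (1 <= INR (Z.abs_nat (Z.of_nat i - Z.of_nat j))) by (apply (le_INR 1); lia).
  rewrite E in *. nra.
Qed.

(** Partial fractions in a = odd i, c = odd j: 1/(a^2 - c^2) = (1/(a-c) - 1/(a+c)) / (2c), and the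
    right side sums to 0 by [odd_tele]. On the diagonal, where 1/(a-c) is read as 0, it equals
    -1/(4c^2), which [inv_diff] omits. *)
Lemma inv_diff_sqr_sum j : hsum (fun i => inv_diff i j) (/ (4 * (odd j * odd j))).
Proof.
assert (B := odd_pos j).
destruct quad_spec as [s Hs].
assert (Hi : forall u v : nat, (Z.of_nat u - Z.of_nat j)%Z = (Z.of_nat v - Z.of_nat j)%Z -> u = v) by lia.
destruct (hsum_inj_ex _ _ _ _ _ Hi Hs) as [s1 H1].
destruct (hsum_dom_ex _ (fun i => inv_diff i j) _ _ (fun i => inv_diff_bound i j) H1) as [r Hr].
replace (/ (4 * (odd j * odd j))) with r; auto.
assert (K := hsum_fin _ (fun i => if Nat.eq_dec i j then / (4 * (odd j * odd j)) else 0) (j :: nil)).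
simpl in K. destruct (Nat.eq_dec j j) as [_|]; [|tauto]. rewrite Rplus_0_r in K.
assert (K0 : hsum (fun i => if Nat.eq_dec i j then / (4 * (odd j * odd j)) else 0) (/ (4 * (odd j * odd j)))).
{ apply K; [constructor; auto; constructor|]. intros x Hx; destruct (Nat.eq_dec x j); auto; exfalso; apply Hx; auto. }
assert (K1 := hsum_minus _ _ _ _ _ Hr K0).
apply hsum_infinite_sum in K1.
assert (L := CV_mult _ _ _ _ (cst_cv (- / (2 * odd j))) (odd_tele (hodd false) (hodd_opp false) (hodd_cv false) j)).
rewrite Rmult_0_r in L.
assert (r - / (4 * (odd j * odd j)) = 0); [|lra].
eapply UL_sequence; [exact K1|]. eapply cv_ext; [|exact L].
intros N. cbv beta. rewrite scal_sum. apply sum_eq. intros i _.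
unfold inv_diff, hodd. rewrite !plus_IZR, opp_IZR, <- !INR_IZR_INZ.
assert (Q := pos_INR i). assert (Q' := pos_INR j).
destruct (Nat.eq_dec i j) as [->|Hne].
- replace (2 * (INR j + - INR j)) with 0 by ring. rewrite Rinv_0. unfold odd in *. field. lra.
- assert (D := odd_diff i j Hne). unfold odd in *. field. repeat split; try lra.
  intros E. apply D. nra.
Qed.

Definition chi_inv_diff i := tsum (fun j => chi j * inv_diff i j).
Definition chi_inv_sum i := tsum (fun j => chi j / (odd j * (odd i + odd j))).

Lemma chi_inv_diff_spec i : hsum (fun j => chi j * inv_diff i j) (chi_inv_diff i).
Proof.
apply tsum_spec. destruct quad_spec as [s Hs].
assert (Hi : forall u v : nat, (Z.of_nat i - Z.of_nat u)%Z = (Z.of_nat i - Z.of_nat v)%Z -> u = v) by lia.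
destruct (hsum_inj_ex _ _ _ _ _ Hi Hs) as [s1 H1].
eapply hsum_dom_ex; [|exact H1]. intros j. cbv beta. rewrite Rabs_mult, chi_abs, Rmult_1_l. apply inv_diff_bound.
Qed.

Lemma chi_inv_sum_spec i : hsum (fun j => chi j / (odd j * (odd i + odd j))) (chi_inv_sum i).
Proof.
apply hsum_inv_odd_sqr. intros j. assert (A := odd_pos i). assert (B := odd_pos j).
unfold Rdiv. rewrite Rabs_mult, chi_abs, Rmult_1_l.
rewrite Rabs_right; [apply Rinv_le_contravar; nra|inv_ge0; nra].
Qed.

(** With a = odd i, c = odd j, the terms 1/(c(a+c)) and 1/(a^2 - c^2) add up to 1/(ac) + (1/(a-c) -
    1/(a+c)) / (2a). Weighted by the character, the first part is Leibniz's series over a and the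
    second vanishes by [odd_tele]; the diagonal yields the correction chi(i) / (4a^2). *)
Lemma chi_inv_sum_eq i :
  chi_inv_sum i = PI / 4 / odd i - chi i / (4 * (odd i * odd i)) - chi_inv_diff i.
Proof.
assert (A := odd_pos i).
assert (K := hsum_fin _ (fun j => if Nat.eq_dec i j then chi i / (4 * (odd i * odd i)) else 0) (i :: nil)).
simpl in K. destruct (Nat.eq_dec i i) as [_|]; [|tauto]. rewrite Rplus_0_r in K.
assert (K0 : hsum (fun j => if Nat.eq_dec i j then chi i / (4 * (odd i * odd i)) else 0) (chi i / (4 * (odd i * odd i)))).
{ apply K; [constructor; auto; constructor|]. intros x Hx; destruct (Nat.eq_dec i x); auto; exfalso; apply Hx; auto. }
assert (K1 := hsum_plus _ _ _ _ _ (hsum_plus _ _ _ _ _ (chi_inv_sum_spec i) (chi_inv_diff_spec i)) K0).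
apply hsum_infinite_sum in K1.
assert (L := CV_plus _ _ _ _ (CV_mult _ _ _ _ (cst_cv (/ odd i)) leibniz)
   (CV_mult _ _ _ _ (cst_cv (chi i / (2 * odd i))) (odd_tele (hodd true) (hodd_opp true) (hodd_cv true) i))).
rewrite Rmult_0_r, Rplus_0_r in L.
assert (chi_inv_sum i + chi_inv_diff i + chi i / (4 * (odd i * odd i)) = / odd i * (PI / 4)) as E; [|unfold Rdiv in *; lra].
eapply UL_sequence; [exact K1|]. eapply cv_ext; [|exact L].
intros N. cbv beta. rewrite !scal_sum, <- plus_sum. apply sum_eq. intros j _.
unfold inv_diff, hodd. rewrite !sg_add, sg_opp, !plus_IZR, opp_IZR, <- !INR_IZR_INZ, !sg_pow. fold (chi i) (chi j).
replace (sg 1) with (-1) by reflexivity.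
assert (Q := pos_INR i). assert (Q' := pos_INR j). assert (S := chi_sqr i).
replace (chi j * (chi i * -1) * / (2 * (INR j + (INR i + 1))) - chi j * chi i * / (2 * (INR j + - INR i)))
 with (chi i * (- chi j * / (2 * (INR j + (INR i + 1))) - chi j * / (2 * (INR j + - INR i)))) by ring.
replace (chi i * (- chi j * / (2 * (INR j + (INR i + 1))) - chi j * / (2 * (INR j + - INR i))) * (chi i / (2 * odd i)))
 with ((chi i * chi i) * (- chi j * / (2 * (INR j + (INR i + 1))) - chi j * / (2 * (INR j + - INR i))) * / (2 * odd i)) by (unfold Rdiv; ring).
rewrite S. destruct (Nat.eq_dec i j) as [->|Hne].
- replace (2 * (INR j + - INR j)) with 0 by ring. rewrite Rinv_0. unfold odd in *. field. lra.
- assert (D := odd_diff i j Hne). assert (D' := odd_sqr_diff i j Hne). unfold odd in *. field. repeat split; try lra; nra.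
Qed.

Definition tornheim (x : nat * nat) : R :=
  chi (snd x) / (odd (fst x) * (odd (snd x) * odd (snd x)) * (odd (fst x) + odd (snd x))).

Lemma inv_sqr_prod : exists s, hsum (fun x : nat * nat => / ((odd (fst x) * odd (fst x)) * (odd (snd x) * odd (snd x)))) s.
Proof.
assert (H : hsum (fun k => / (odd k * odd k)) (tsum (fun k => / (odd k * odd k)))).
{ apply hsum_inv_odd_sqr. intros k. assert (A := odd_pos k).
  rewrite Rabs_right; [lra|inv_ge0; nra]. }
exists (tsum (fun k => / (odd k * odd k)) * tsum (fun k => / (odd k * odd k))).
eapply hsum_ext; [|apply (hsum_mul H H)].
intros [i j]; cbv beta; cbn [fst snd]. rewrite (Rinv_mult (odd i * odd i)). auto.
Qed.

(** Off the diagonal, with a = odd i and c = odd j, 1/c^2 + 1/(a^2 - c^2) = a^2 / (c^2 (a^2 - c^2)),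
    so division by a^2 leaves the summand [g]. Summed over i first, [g] gives beta(4)/4 by
    [inv_diff_sqr_sum]; the diagonal adds beta(4). *)
Lemma mixed_sum : hsum (fun i => (beta2 + chi_inv_diff i) / (odd i * odd i)) (5/4 * beta4).
Proof.
set (g := fun x : nat * nat => chi (snd x) * inv_diff (fst x) (snd x) / (odd (snd x) * odd (snd x))).
assert (exists s, hsum g s) as [s Hs].
{ destruct quad_spec as [s1 H1].
  assert (H : hsum (fun k => / (odd k * odd k)) (tsum (fun k => / (odd k * odd k)))).
  { apply hsum_inv_odd_sqr. intros k. assert (A := odd_pos k).
    rewrite Rabs_right; [lra|inv_ge0; nra]. }
  assert (Hi : forall u v : nat * nat, ((Z.of_nat (fst u) - Z.of_nat (snd u))%Z, snd u) = ((Z.of_nat (fst v) - Z.of_nat (snd v))%Z, snd v) -> u = v).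
  { intros [a b] [c d]; simpl; intros E; injection E; intros; f_equal; lia. }
  destruct (hsum_inj_ex _ _ _ _ _ Hi (hsum_mul H1 H)) as [s2 H2].
  eapply hsum_dom_ex; [|exact H2]. intros [i j]; unfold g; cbn [fst snd].
  assert (A := odd_pos j). unfold Rdiv. rewrite !Rabs_mult, chi_abs, Rmult_1_l.
  rewrite (Rabs_right (/ _)); [|inv_ge0; nra].
  apply Rmult_le_compat_r; [inv_ge0; nra|apply inv_diff_bound]. }
assert (Hd : hsum (fun x : nat * nat => if Nat.eq_dec (fst x) (snd x) then chi (snd x) / odd (snd x) ^ 4 else 0) beta4).
{ apply (hsum_inj _ _ (fun k : nat => (k, k))).
  - congruence.
  - intros [i j] Hk; cbn [fst snd]. destruct (Nat.eq_dec i j) as [->|]; auto. exfalso; apply (Hk j); auto.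
  - eapply hsum_ext; [|apply beta4_spec]. intros k; cbn [fst snd]. destruct (Nat.eq_dec k k); tauto. }
assert (E : s = 1/4 * beta4).
{ apply hsum_swap in Hs.
  apply (@hsum_unique _ (fun j => 1/4 * (chi j / odd j ^ 4))); [|apply hsum_scal, beta4_spec].
  apply (hsum_fubini _ _ _ _ _ Hs). intros j; unfold g; cbn [fst snd]. assert (A := odd_pos j).
  replace (1/4 * (chi j / odd j ^ 4)) with (chi j / (odd j * odd j) * / (4 * (odd j * odd j))) by (field; lra).
  eapply hsum_ext; [|apply hsum_scal, inv_diff_sqr_sum]. intros i; cbv beta. field. lra. }
replace (5/4 * beta4) with (s + beta4) by lra.
apply (hsum_fubini _ _ _ _ _ (hsum_plus _ _ _ _ _ Hs Hd)).
intros i; unfold g; cbn [fst snd]. assert (A := odd_pos i).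
replace ((beta2 + chi_inv_diff i) / (odd i * odd i)) with (/ (odd i * odd i) * (beta2 + chi_inv_diff i)) by (field; lra).
eapply hsum_ext; [|apply hsum_scal, hsum_plus; [apply beta2_spec|apply chi_inv_diff_spec]].
intros j; cbv beta. assert (B := odd_pos j). unfold inv_diff.
destruct (Nat.eq_dec i j) as [->|Hne]; [field; lra|].
assert (D := odd_sqr_diff i j Hne). field. lra.
Qed.

(** The decomposition 1/(a c^2 (a+c)) = (1/a^2)(1/c^2 - 1/(c(a+c))) separates the inner sum over c,
    which [chi_inv_sum_eq] evaluates. The coefficient 3/2 is 5/4 from [mixed_sum] plus 1/4 from the
    diagonal. *)
Lemma tornheim_spec : hsum tornheim (3/2 * beta4 - PI/4 * lambda3).
Proof.
destruct inv_sqr_prod as [s0 Hs0].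
assert (exists s, hsum tornheim s) as [s Hs].
{ eapply hsum_dom_ex; [|exact Hs0]. intros [i j]; unfold tornheim; cbn [fst snd].
  assert (A := odd_pos i). assert (B := odd_pos j). unfold Rdiv. rewrite Rabs_mult, chi_abs, Rmult_1_l.
  assert (0 < odd i * odd i * (odd j * odd j)) by (repeat apply Rmult_lt_0_compat; auto).
  assert (odd i * odd i * (odd j * odd j) <= odd i * (odd j * odd j) * (odd i + odd j)).
  { replace (odd i * odd i * (odd j * odd j)) with (odd i * (odd j * odd j) * odd i) by ring.
    apply Rmult_le_compat_l; [|lra]. left; repeat apply Rmult_lt_0_compat; auto. }
  rewrite Rabs_right; [apply Rinv_le_contravar; auto|inv_ge0; lra]. }
replace (3/2 * beta4 - PI/4 * lambda3) with s; auto.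
assert (H1 : hsum (fun i => / (odd i * odd i) * (beta2 - chi_inv_sum i)) s).
{ apply (hsum_fubini _ _ _ _ _ Hs). intros i; unfold tornheim; cbn [fst snd].
  eapply hsum_ext; [|apply hsum_scal, hsum_minus; [apply beta2_spec|apply chi_inv_sum_spec]].
  intros j; cbv beta. assert (A := odd_pos i). assert (B := odd_pos j). field. lra. }
apply (hsum_unique H1).
replace (3/2 * beta4 - PI/4 * lambda3) with (5/4 * beta4 + 1/4 * beta4 - PI/4 * lambda3) by lra.
eapply hsum_ext; [|apply hsum_minus; [apply hsum_plus; [apply mixed_sum|apply hsum_scal, beta4_spec]|apply hsum_scal, lambda3_spec]].
intros i; cbv beta. rewrite chi_inv_sum_eq. assert (A := odd_pos i). field. lra.
Qed.

(** * Power series in the sine *)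

Definition unit_bounded (a : nat -> R) := forall n, Rabs (a n) <= 1.

Lemma unit_radius a y : unit_bounded a -> Rabs y < 1 -> Rbar_lt (Rabs y) (CV_radius a).
Proof.
intros Ha Hy. apply Rbar_lt_le_trans with 1; [exact Hy|].
apply CV_radius_bounded. exists 1. intros n. rewrite pow1, Rmult_1_r. auto.
Qed.

Lemma PSeries_infinite_sum a y l : is_pseries a y l -> infinite_sum (fun n => a n * y ^ n) l.
Proof.
intros H. apply is_pseries_R in H. apply is_series_Reals in H. exact H.
Qed.

Lemma PSeries_hsum a y : unit_bounded a -> 0 <= y < 1 -> hsum (fun n => a n * y ^ n) (PSeries a y).
Proof.
intros Ha Hy.
assert (H : infinite_sum (fun n => a n * y ^ n) (PSeries a y)).
{ apply PSeries_infinite_sum, PSeries_correct, CV_radius_inside, unit_radius; auto.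
  rewrite Rabs_right; lra. }
destruct (hsum_dom_ex _ (fun n => a n * y ^ n) (fun n => y ^ n) (/ (1 - y))) as [s Hs].
- intros n. rewrite Rabs_mult, (Rabs_right (y ^ n)) by (apply Rle_ge, pow_le; lra).
  rewrite <- (Rmult_1_l (y ^ n)) at 2. apply Rmult_le_compat_r; [apply pow_le; lra|auto].
- apply geom_nat; auto.
- replace (PSeries a y) with s; auto. apply (uniqueness_sum (fun n => a n * y ^ n)); auto.
  apply hsum_infinite_sum; auto.
Qed.

Lemma PSeries_deriv a y : unit_bounded a -> Rabs y < 1 ->
  derivable_pt_lim (PSeries a) y (PSeries (PS_derive a) y).
Proof. intros Ha Hy. apply is_derive_Reals, is_derive_PSeries, unit_radius; auto. Qed.

(** The operator 1 + 2 y d/dy multiplies the coefficient of y^n by 2n+1; with y = s^2 it is the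
    derivative in s of s times the series. *)
Lemma PSeries_odd a y : unit_bounded a -> Rabs y < 1 ->
  is_pseries (fun n => odd n * a n) y (PSeries a y + 2 * y * PSeries (PS_derive a) y).
Proof.
intros Ha Hy. assert (Hr := unit_radius a y Ha Hy).
assert (H1 : is_pseries a y (PSeries a y)) by (apply PSeries_correct, CV_radius_inside; auto).
assert (H2 : is_pseries (PS_derive a) y (PSeries (PS_derive a) y)).
{ apply PSeries_correct, CV_radius_inside. rewrite CV_radius_derive. auto. }
assert (H3 := is_pseries_plus _ _ _ _ _ H1 (is_pseries_scal 2 _ _ _ ltac:(apply Rmult_comm) (is_pseries_incr_1 _ _ _ H2))).
replace (PSeries a y + 2 * y * PSeries (PS_derive a) y) with
 (plus (PSeries a y) (scal 2 (scal y (PSeries (PS_derive a) y)))) by (unfold plus, scal; simpl; unfold mult; simpl; ring).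
eapply is_pseries_ext; [|exact H3]. intros n. unfold PS_plus, PS_scal, PS_incr_1, PS_derive, odd.
destruct n as [|n]; cbn -[INR]; unfold mult, zero; cbn -[INR]; rewrite ?S_INR; simpl (INR 0); ring.
Qed.

Lemma deriv_val f x l l' : derivable_pt_lim f x l -> l = l' -> derivable_pt_lim f x l'.
Proof. intros H <-; auto. Qed.

Lemma deriv_sqr (f : R -> R) x l : derivable_pt_lim f x l -> derivable_pt_lim (fun y => f y * f y) x (2 * f x * l).
Proof. intros H. eapply deriv_val; [apply (derivable_pt_lim_mult f f); eauto|]. ring. Qed.

(** Termwise integration in s: the antiderivative of the series in s^2 with coefficients [a] is s
    times the series with coefficients [div_odd a]. *)
Definition div_odd (a : nat -> R) (n : nat) : R := a n / odd n.

Lemma div_odd_bounded a : unit_bounded a -> unit_bounded (div_odd a).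
Proof.
intros Ha n. unfold div_odd, Rdiv. assert (A := odd_ge1 n). specialize (Ha n).
rewrite Rabs_mult, (Rabs_right (/ odd n)).
- assert (/ odd n <= 1) by (rewrite <- Rinv_1; apply Rinv_le_contravar; lra).
  assert (0 < / odd n) by (apply Rinv_0_lt_compat; lra). assert (B := Rabs_pos (a n)). nra.
- inv_ge0; lra.
Qed.

Lemma deriv_PSeries_sqr a (f : R -> R) x l : unit_bounded a -> -1 < f x < 1 -> derivable_pt_lim f x l ->
  derivable_pt_lim (fun y => PSeries a (f y * f y)) x (PSeries (PS_derive a) (f x * f x) * (2 * f x * l)).
Proof.
intros Ha Hf Hl.
apply (derivable_pt_lim_comp (fun y => f y * f y) (PSeries a)); [apply deriv_sqr; auto|].
apply PSeries_deriv; auto. apply Rabs_def1; nra.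
Qed.

Lemma deriv_div_odd a (f : R -> R) x l : unit_bounded a -> -1 < f x < 1 -> derivable_pt_lim f x l ->
  derivable_pt_lim (fun y => f y * PSeries (div_odd a) (f y * f y)) x (PSeries a (f x * f x) * l).
Proof.
intros Ha Hf Hl.
eapply deriv_val.
- apply (derivable_pt_lim_mult f (fun y => PSeries (div_odd a) (f y * f y))); [exact Hl|].
  apply deriv_PSeries_sqr; eauto. apply div_odd_bounded; auto.
- assert (H := PSeries_odd (div_odd a) (f x * f x) (div_odd_bounded a Ha) ltac:(apply Rabs_def1; nra)).
  apply is_pseries_unique in H.
  replace (PSeries a (f x * f x)) with (PSeries (fun n => odd n * div_odd a n) (f x * f x)).
  + rewrite H. ring.
  + apply PSeries_ext. intros n. unfold div_odd. assert (A := odd_pos n). field. lra.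
Qed.

Lemma deriv_eq (f g f' g' : R -> R) c :
  (forall x, 0 <= x < c -> derivable_pt_lim f x (f' x)) ->
  (forall x, 0 <= x < c -> derivable_pt_lim g x (g' x)) ->
  (forall x, 0 < x < c -> f' x = g' x) -> f 0 = g 0 -> forall x, 0 <= x < c -> f x = g x.
Proof.
intros Df Dg H H0 x Hx.
assert (K1 : f x - f 0 <= g x - g 0).
{ apply deriv_le with f' g'; try lra; intros y Hy; try (eapply deriv_cont; first [apply Df|apply Dg]; lra);
  try (first [apply Df|apply Dg]; lra). right; apply H; lra. }
assert (K2 : g x - g 0 <= f x - f 0).
{ apply deriv_le with g' f'; try lra; intros y Hy; try (eapply deriv_cont; first [apply Df|apply Dg]; lra);
  try (first [apply Df|apply Dg]; lra). right; symmetry; apply H; lra. }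
lra.
Qed.

Lemma cos_pos x : 0 <= x < PI/2 -> 0 < cos x.
Proof. intros Hx. assert (P := PI_RGT_0). apply cos_gt_0; lra. Qed.

Lemma sin_range x : 0 <= x < PI/2 -> 0 <= sin x < 1.
Proof.
intros Hx. assert (P := PI_RGT_0). split; [apply sin_ge_0; lra|].
rewrite <- sin_PI2. apply sin_increasing_1; lra.
Qed.

Lemma sin_sqr x : sin x * sin x = 1 - cos x * cos x.
Proof. assert (H := sin2_cos2 x). unfold Rsqr in H. lra. Qed.

Definition tan_half (v : R) : R := sin v / (1 + cos v).

Lemma tan_half_deriv v : 0 <= v < PI/2 -> derivable_pt_lim tan_half v (/ (1 + cos v)).
Proof.
intros Hv. assert (C := cos_pos v Hv).
eapply deriv_val.
- apply (derivable_pt_lim_div sin (fun y => 1 + cos y)).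
  + apply derivable_pt_lim_sin.
  + apply (derivable_pt_lim_plus (fct_cte 1) cos); [apply derivable_pt_lim_const|apply derivable_pt_lim_cos].
  + lra.
- assert (S := sin_sqr v). unfold Rsqr.
  match goal with |- ?n / _ = _ => replace n with (1 + cos v) by lra end.
  field. lra.
Qed.

Lemma tan_half_sqr v : 0 <= v < PI/2 -> tan_half v * tan_half v = (1 - cos v) / (1 + cos v).
Proof.
intros Hv. assert (C := cos_pos v Hv). unfold tan_half.
replace (sin v / (1 + cos v) * (sin v / (1 + cos v))) with (sin v * sin v / ((1 + cos v) * (1 + cos v))) by (field; lra).
rewrite sin_sqr. field. lra.
Qed.

Lemma tan_half_range v : 0 <= v < PI/2 -> 0 <= tan_half v < 1.
Proof.
intros Hv. assert (C := cos_pos v Hv). assert (S := sin_range v Hv). unfold tan_half. split.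
- apply Rmult_le_pos; [lra|inv_ge0; lra].
- apply (Rmult_lt_reg_r (1 + cos v)); [lra|]. unfold Rdiv. rewrite Rmult_assoc, Rinv_l; lra.
Qed.

Lemma tan_half_sin v : 0 <= v < PI/2 -> sin v = tan_half v * (1 + cos v).
Proof. intros Hv. assert (C := cos_pos v Hv). unfold tan_half. field. lra. Qed.

Lemma tan_half_0 : tan_half 0 = 0.
Proof. unfold tan_half. rewrite sin_0. unfold Rdiv; ring. Qed.

Lemma b_bounded : unit_bounded b.
Proof.
intros n. assert (B := b_pos n). assert (A := b_sqr_le n). assert (Q := pos_INR n).
rewrite Rabs_right by lra. assert (/ (2 * INR n + 1) <= 1) by (rewrite <- Rinv_1; apply Rinv_le_contravar; lra). nra.
Qed.

Lemma w_bounded : unit_bounded w.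
Proof.
intros n. assert (B := w_pos n). assert (A := w_sqr_le n). assert (Q := pos_INR n).
rewrite Rabs_right by lra. assert (/ (INR n + 1) <= 1) by (rewrite <- Rinv_1; apply Rinv_le_contravar; lra). nra.
Qed.

Lemma chi_bounded : unit_bounded chi.
Proof. intros n. rewrite chi_abs. lra. Qed.

Lemma one_bounded : unit_bounded (fun _ => 1).
Proof. intros n. rewrite Rabs_R1. lra. Qed.

Lemma PSeries_one y : 0 <= y < 1 -> PSeries (fun _ => 1) y = / (1 - y).
Proof.
intros Hy. apply (hsum_unique (PSeries_hsum _ y one_bounded Hy)).
eapply hsum_ext; [|apply geom_nat; auto]. intros n; cbv beta; ring.
Qed.

Lemma PSeries_chi y : 0 <= y < 1 -> PSeries chi y = / (1 + y).
Proof.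
intros Hy. apply (hsum_unique (PSeries_hsum _ y chi_bounded Hy)). apply alt_geom_nat; auto.
Qed.

(* The differential equation of [sum w_m s^(2m+1) = arcsin s / sqrt (1 - s^2)], with [y = s^2]. *)
Lemma w_ode y : 0 <= y < 1 ->
  (1 - y) * (PSeries w y + 2 * y * PSeries (PS_derive w) y) = 1 + y * PSeries w y.
Proof.
intros Hy. assert (Ha : Rabs y < 1) by (rewrite Rabs_right; lra).
assert (H := PSeries_odd w y w_bounded Ha). assert (E := is_pseries_unique _ _ _ H).
assert (Hw : is_pseries w y (PSeries w y)) by (apply PSeries_correct, CV_radius_inside, unit_radius; auto; apply w_bounded).
set (U := PSeries w y + 2 * y * PSeries (PS_derive w) y) in *.
assert (U = 1 + y * (U + PSeries w y)); [|lra].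
rewrite <- E at 1. rewrite PSeries_decr_1 by (exists U; exact H).
rewrite w_0. unfold odd; simpl (INR 0). replace ((2 * 0 + 1) * 1) with 1 by ring. f_equal. f_equal.
apply is_pseries_unique. eapply is_pseries_ext; [|apply (is_pseries_plus _ _ _ _ _ H Hw)].
intros n. unfold PS_plus, PS_decr_1, plus; simpl plus. unfold odd. rewrite S_INR.
replace (2 * (INR n + 1) + 1) with (2 * INR n + 3) by ring. rewrite w_S. simpl. ring.
Qed.

Lemma b_ode y : 0 <= y < 1 -> 2 * (1 - y) * PSeries (PS_derive b) y = PSeries b y.
Proof.
intros Hy. assert (Ha : Rabs y < 1) by (rewrite Rabs_right; lra).
assert (H := PSeries_odd b y b_bounded Ha).
assert (H2 : is_pseries (PS_derive b) y (PSeries (PS_derive b) y)).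
{ apply PSeries_correct, CV_radius_inside. rewrite CV_radius_derive. apply unit_radius; auto; apply b_bounded. }
assert (H3 := is_pseries_scal 2 _ _ _ ltac:(apply Rmult_comm) H2).
apply is_pseries_unique in H. apply is_pseries_unique in H3.
assert (E : PSeries (PS_scal 2 (PS_derive b)) y = PSeries (fun n => odd n * b n) y).
{ apply PSeries_ext. intros n. unfold PS_scal, PS_derive, odd. rewrite <- b_S.
  cbn -[INR]; unfold mult; cbn -[INR]. rewrite S_INR. ring. }
rewrite H, H3 in E. unfold scal in E; simpl in E. unfold mult in E; simpl in E. lra.
Qed.

Lemma sin_range' v : 0 <= v < PI/2 -> -1 < sin v < 1.
Proof. intros Hv. assert (S := sin_range v Hv). lra. Qed.

Lemma sin_sqr_range v : 0 <= v < PI/2 -> 0 <= sin v * sin v < 1.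
Proof. intros Hv. assert (S := sin_range v Hv). nra. Qed.

Lemma tan_half_range' v : 0 <= v < PI/2 -> -1 < tan_half v < 1.
Proof. intros Hv. assert (S := tan_half_range v Hv). lra. Qed.

Lemma tan_half_sqr_range v : 0 <= v < PI/2 -> 0 <= tan_half v * tan_half v < 1.
Proof. intros Hv. assert (S := tan_half_range v Hv). nra. Qed.

Lemma w_series v : 0 <= v < PI/2 -> cos v * (sin v * PSeries w (sin v * sin v)) = v.
Proof.
revert v. apply deriv_eq with (fun _ => 1) (fun _ => 1); auto.
- intros v Hv. eapply deriv_val.
  + apply (derivable_pt_lim_mult cos (fun v => sin v * PSeries w (sin v * sin v))); [apply derivable_pt_lim_cos|].
    apply (derivable_pt_lim_mult sin (fun v => PSeries w (sin v * sin v))); [apply derivable_pt_lim_sin|].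
    apply deriv_PSeries_sqr; [apply w_bounded|apply sin_range'; auto|apply derivable_pt_lim_sin].
  + assert (E := w_ode _ (sin_sqr_range v Hv)). assert (S := sin_sqr v).
    set (W := PSeries w (sin v * sin v)) in *. set (W' := PSeries (PS_derive w) (sin v * sin v)) in *.
    transitivity ((cos v * cos v) * (W + 2 * (sin v * sin v) * W') - (sin v * sin v) * W); [ring|].
    replace (cos v * cos v) with (1 - sin v * sin v) by lra. rewrite E. ring.
- intros v Hv. apply derivable_pt_lim_id.
- rewrite sin_0. ring.
Qed.

Lemma b_series v : 0 <= v < PI/2 -> cos v * PSeries b (sin v * sin v) = 1.
Proof.
revert v. apply deriv_eq with (fun _ => 0) (fun _ => 0); auto.
- intros v Hv. eapply deriv_val.
  + apply (derivable_pt_lim_mult cos (fun v => PSeries b (sin v * sin v))); [apply derivable_pt_lim_cos|].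
    apply deriv_PSeries_sqr; [apply b_bounded|apply sin_range'; auto|apply derivable_pt_lim_sin].
  + assert (E := b_ode _ (sin_sqr_range v Hv)). assert (S := sin_sqr v).
    set (W := PSeries b (sin v * sin v)) in *. set (W' := PSeries (PS_derive b) (sin v * sin v)) in *.
    transitivity (sin v * (2 * (cos v * cos v) * W' - W)); [ring|].
    replace (cos v * cos v) with (1 - sin v * sin v) by lra. rewrite E. ring.
- intros v Hv. apply (derivable_pt_lim_const 1).
- rewrite sin_0, cos_0, Rmult_0_l, PSeries_0, b_0. ring.
Qed.

Lemma arcsin_series v : 0 <= v < PI/2 -> sin v * PSeries (div_odd b) (sin v * sin v) = v.
Proof.
revert v. apply deriv_eq with (fun v => PSeries b (sin v * sin v) * cos v) (fun _ => 1).
- intros v Hv. apply deriv_div_odd; [apply b_bounded|apply sin_range'; auto|apply derivable_pt_lim_sin].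
- intros v Hv. apply derivable_pt_lim_id.
- intros v Hv. rewrite Rmult_comm. apply b_series. lra.
- rewrite sin_0. ring.
Qed.

(** That is, artanh(sin v) = 2 artanh(tan(v/2)); both sides have derivative 1 / cos v. *)
Lemma artanh_series v : 0 <= v < PI/2 ->
  sin v * PSeries (div_odd (fun _ => 1)) (sin v * sin v)
  = 2 * (tan_half v * PSeries (div_odd (fun _ => 1)) (tan_half v * tan_half v)).
Proof.
revert v.
apply deriv_eq with (fun v => PSeries (fun _ => 1) (sin v * sin v) * cos v)
  (fun v => 2 * (PSeries (fun _ => 1) (tan_half v * tan_half v) * / (1 + cos v))).
- intros v Hv. apply deriv_div_odd; [apply one_bounded|apply sin_range'; auto|apply derivable_pt_lim_sin].
- intros v Hv. apply (derivable_pt_lim_scal (fun v => tan_half v * PSeries (div_odd (fun _ => 1)) (tan_half v * tan_half v))).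
  apply deriv_div_odd; [apply one_bounded|apply tan_half_range'; auto|apply tan_half_deriv; auto].
- intros v Hv'. assert (Hv : 0 <= v < PI/2) by lra. assert (C := cos_pos v Hv).
  rewrite !PSeries_one by (try apply sin_sqr_range; try apply tan_half_sqr_range; auto).
  rewrite tan_half_sqr, sin_sqr by auto. field. repeat split; lra || nra.
- rewrite sin_0, tan_half_0. ring.
Qed.

Lemma arctan_series v : 0 <= v < PI/2 ->
  tan_half v * PSeries (div_odd chi) (tan_half v * tan_half v) = / 2 * v.
Proof.
revert v. apply deriv_eq with (fun v => PSeries chi (tan_half v * tan_half v) * / (1 + cos v)) (fun _ => / 2 * 1).
- intros v Hv. apply deriv_div_odd; [apply chi_bounded|apply tan_half_range'; auto|apply tan_half_deriv; auto].
- intros v Hv. apply (derivable_pt_lim_scal id), derivable_pt_lim_id.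
- intros v Hv'. assert (Hv : 0 <= v < PI/2) by lra. assert (C := cos_pos v Hv).
  rewrite PSeries_chi by (apply tan_half_sqr_range; auto). rewrite tan_half_sqr by auto. field. lra.
- rewrite tan_half_0. ring.
Qed.

(** The right side is twice the inverse tangent integral at tan(v/2). Both sides have derivative v /
    sin v, by [w_series] on the left and [arctan_series] on the right. *)
Lemma w_div_odd_series v : 0 <= v < PI/2 ->
  sin v * PSeries (div_odd w) (sin v * sin v)
  = 2 * (tan_half v * PSeries (div_odd (div_odd chi)) (tan_half v * tan_half v)).
Proof.
revert v.
apply deriv_eq with (fun v => PSeries w (sin v * sin v) * cos v)
  (fun v => 2 * (PSeries (div_odd chi) (tan_half v * tan_half v) * / (1 + cos v))).
- intros v Hv. apply deriv_div_odd; [apply w_bounded|apply sin_range'; auto|apply derivable_pt_lim_sin].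
- intros v Hv. apply (derivable_pt_lim_scal (fun v => tan_half v * PSeries (div_odd (div_odd chi)) (tan_half v * tan_half v))).
  apply deriv_div_odd; [apply div_odd_bounded, chi_bounded|apply tan_half_range'; auto|apply tan_half_deriv; auto].
- intros v Hv'. assert (Hv : 0 <= v < PI/2) by lra. assert (C := cos_pos v Hv).
  assert (S : 0 < sin v < 1) by (apply sin_01; auto).
  assert (E1 := w_series v Hv). assert (E2 := arctan_series v Hv).
  apply (Rmult_eq_reg_l (sin v)); [|lra].
  replace (sin v * (PSeries w (sin v * sin v) * cos v)) with v by lra.
  rewrite (tan_half_sin v Hv) at 1.
  transitivity (2 * (tan_half v * PSeries (div_odd chi) (tan_half v * tan_half v))); [rewrite E2; field|field; lra].
- rewrite sin_0, tan_half_0. ring.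
Qed.

(** * Limits at [PI / 2] *)

Definition acute (v : R) : Prop := 0 < v < PI/2.

Lemma acute_near d : 0 < d -> exists v, acute v /\ PI/2 - d < v.
Proof.
intros Hd. assert (P := PI_RGT_0). exists (PI/2 - Rmin d (PI/2) / 2).
assert (0 < Rmin d (PI/2)) by (apply Rmin_glb_lt; lra).
assert (A := Rmin_l d (PI/2)). assert (B := Rmin_r d (PI/2)). unfold acute. lra.
Qed.

Lemma limit_acute_le f g a c : (forall v, acute v -> f v <= g v) ->
  limit1_in f acute a (PI/2) -> limit1_in g acute c (PI/2) -> a <= c.
Proof.
intros H Hf Hg. apply Rnot_lt_le; intros Hlt.
destruct (Hf ((a - c)/2) ltac:(lra)) as [d1 [Hd1 K1]].
destruct (Hg ((a - c)/2) ltac:(lra)) as [d2 [Hd2 K2]].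
destruct (acute_near (Rmin d1 d2)) as [v [Hv Hv']]; [apply Rmin_glb_lt; auto|].
assert (A := Rmin_l d1 d2). assert (B := Rmin_r d1 d2).
assert (E : Rabs (v - PI/2) = PI/2 - v) by (unfold acute in Hv; rewrite Rabs_left; lra).
specialize (K1 v). specialize (K2 v). simpl in K1, K2. unfold Rdist in K1, K2. rewrite E in K1, K2.
specialize (K1 ltac:(split; [auto|lra])). specialize (K2 ltac:(split; [auto|lra])).
specialize (H v Hv). apply Rabs_def2 in K1. apply Rabs_def2 in K2. lra.
Qed.

Lemma limit_acute_cont f : continuity_pt f (PI/2) -> limit1_in f acute (f (PI/2)) (PI/2).
Proof.
intros H eps He. destruct (H eps He) as [d [Hd K]]. exists d. split; auto.
intros v [Hv Hd']. apply K. split; auto. split; [exact I|]. unfold acute in Hv. lra.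
Qed.

Lemma limit_ext_acute f g l : (forall v, acute v -> f v = g v) ->
  limit1_in f acute l (PI/2) -> limit1_in g acute l (PI/2).
Proof.
intros E H eps He. destruct (H eps He) as [d [Hd K]]. exists d. split; auto.
intros v [Hv Hv']. rewrite <- E by auto. apply K; auto.
Qed.

Lemma limit_cst c : limit1_in (fun _ => c) acute c (PI/2).
Proof. apply (limit_free (fun _ => c) acute 0). Qed.

Lemma tan_half_limit : limit1_in tan_half acute 1 (PI/2).
Proof.
replace 1 with (tan_half (PI/2)) by (unfold tan_half; rewrite sin_PI2, cos_PI2; field).
apply limit_acute_cont. apply continuity_pt_div; [apply continuity_sin| |rewrite cos_PI2; lra].
apply continuity_pt_plus; [apply continuity_const; intros x y; auto|apply continuity_cos].
Qed.

Lemma sin_limit : limit1_in sin acute 1 (PI/2).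
Proof. rewrite <- sin_PI2. apply limit_acute_cont, continuity_sin. Qed.

Lemma limit_pow f l n : limit1_in f acute l (PI/2) -> limit1_in (fun v => f v ^ n) acute (l ^ n) (PI/2).
Proof.
intros H. induction n; simpl; [apply limit_cst|]. apply limit_mul; auto.
Qed.

Lemma limit_lsum T (f : T -> R -> R) (l : T -> R) s : (forall t, limit1_in (f t) acute (l t) (PI/2)) ->
  limit1_in (fun v => lsum (fun t => f t v) s) acute (lsum l s) (PI/2).
Proof.
intros H. induction s; simpl; [apply limit_cst|]. apply limit_plus; auto.
Qed.

(** Abel's theorem for absolutely summable coefficients: finitely many terms carry all but eps/4 of
    the total mass and are continuous at z = 1, while the others change by at most |d n| since 0 <=
    1 - y^n <= 1. *)
Lemma abel_limit d D : unit_bounded d -> hsum d D ->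
  limit1_in (fun v => PSeries d (tan_half v * tan_half v)) acute D (PI/2).
Proof.
intros Hb HD eps He.
destruct (hsum_abs_ex _ _ _ HD) as [B [HB _]].
destruct (HB (eps/4) ltac:(lra)) as [l0 K0].
destruct (list_undup _ l0) as [l [Hl Hl0]].
specialize (K0 l Hl ltac:(intros x Hx; apply Hl0; auto)).
set (r := fun v => lsum (fun n => d n * (1 - (tan_half v * tan_half v) ^ n)) l).
assert (Hr : limit1_in r acute 0 (PI/2)).
{ unfold r. replace 0 with (lsum (fun n => d n * (1 - (1 * 1) ^ n)) l).
  - apply (limit_lsum _ (fun n v => d n * (1 - (tan_half v * tan_half v) ^ n))). intros n.
    apply limit_mul; [apply limit_cst|]. apply limit_minus; [apply limit_cst|].
    apply limit_pow, limit_mul; apply tan_half_limit.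
  - apply lsum_0. intros n _. rewrite Rmult_1_l, pow1. ring. }
destruct (Hr (eps/2) ltac:(lra)) as [dl [Hdl Kdl]]. exists dl. split; auto.
intros v [Hv Hv']. specialize (Kdl v (conj Hv Hv')). simpl in *. unfold Rdist in *.
rewrite Rminus_0_r in Kdl.
assert (Hy := tan_half_sqr_range v ltac:(unfold acute in Hv; lra)).
set (y := tan_half v * tan_half v) in *.
assert (H1 := hsum_minus _ _ _ _ _ HD (PSeries_hsum d y Hb Hy)).
apply hsum_ext with (g := fun n => d n * (1 - y ^ n)) in H1; [|intros; ring].
assert (H2 : Rabs (D - PSeries d y - lsum (fun n => d n * (1 - y ^ n)) l) <= eps/4).
{ set (g := fun n => if in_dec Nat.eq_dec n l then 0 else Rabs (d n)).
  assert (Hg : hsum g (B - lsum (fun n => Rabs (d n)) l)).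
  { assert (K := hsum_fin _ (fun n => if in_dec Nat.eq_dec n l then Rabs (d n) else 0) l Hl).
    assert (K' : hsum (fun n => if in_dec Nat.eq_dec n l then Rabs (d n) else 0) (lsum (fun n => Rabs (d n)) l)).
    { rewrite (lsum_eq _ (fun n => Rabs (d n)) (fun n => if in_dec Nat.eq_dec n l then Rabs (d n) else 0)).
      - apply K. intros x Hx. destruct (in_dec Nat.eq_dec x l); tauto.
      - intros x Hx. destruct (in_dec Nat.eq_dec x l); tauto. }
    eapply hsum_ext; [|apply (hsum_minus _ _ _ _ _ HB K')].
    intros n; unfold g; cbv beta. destruct (in_dec Nat.eq_dec n l); ring. }
  eapply Rle_trans.
  - apply (hsum_remove _ Nat.eq_dec _ g _ _ _ Hl H1 Hg).
    + intros n; unfold g. destruct (in_dec Nat.eq_dec n l); [lra|apply Rabs_pos].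
    + intros n Hn; unfold g. destruct (in_dec Nat.eq_dec n l); [tauto|].
      assert (0 <= y ^ n) by (apply pow_le; lra).
      assert (y ^ n <= 1) by (rewrite <- (pow1 n); apply pow_incr; lra).
      rewrite Rabs_mult, (Rabs_right (1 - y ^ n)) by lra. assert (A := Rabs_pos (d n)). nra.
  - assert (A := Rle_abs (- (lsum (fun x => Rabs (d x)) l - B))). rewrite Rabs_Ropp in A. lra. }
unfold r in Kdl. fold y in Kdl.
replace (PSeries d y - D) with (- ((D - PSeries d y - lsum (fun n => d n * (1 - y ^ n)) l) + lsum (fun n => d n * (1 - y ^ n)) l)) by ring.
rewrite Rabs_Ropp. eapply Rle_lt_trans; [apply Rabs_triang|lra].
Qed.

Lemma sin_odd_bounds l v : acute v -> 0 <= sin_odd l v <= w l.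
Proof.
intros [H1 H2]. split.
- rewrite <- (sin_odd_0 l). apply deriv_nonneg_le with (fun v => sin v ^ (2 * l + 1)); try lra.
  + intros x _; eapply deriv_cont, sin_odd_deriv.
  + intros x _; apply sin_odd_deriv.
  + intros x Hx. apply pow_le. assert (S := sin_range x). lra.
- rewrite <- (sin_odd_PI2 l). apply deriv_nonneg_le with (fun v => sin v ^ (2 * l + 1)); try lra.
  + intros x _; eapply deriv_cont, sin_odd_deriv.
  + intros x _; apply sin_odd_deriv.
  + intros x Hx. apply pow_le. assert (S := sin_range x). lra.
Qed.

Lemma lsum_deriv T (f f' : T -> R -> R) l x : (forall t, derivable_pt_lim (f t) x (f' t x)) ->
  derivable_pt_lim (fun v => lsum (fun t => f t v) l) x (lsum (fun t => f' t x) l).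
Proof.
intros H. induction l; simpl; [apply (derivable_pt_lim_const 0)|].
apply (derivable_pt_lim_plus (f a) (fun v => lsum (fun t => f t v) l)); auto.
Qed.

(* Integrating a power series in [sin v] termwise over [0, PI / 2]; the interchange
   only needs comparison of derivatives because the coefficients are nonnegative. *)
Lemma sine_integral T (g : T -> R) (e : T -> nat) (G H : R -> R) L :
  (forall t, 0 <= g t) ->
  (forall v, acute v -> hsum (fun t => g t * sin v ^ (2 * e t + 1)) (G v)) ->
  H 0 = 0 -> (forall v, 0 <= v < PI/2 -> derivable_pt_lim H v (G v)) ->
  limit1_in H acute L (PI/2) -> hsum (fun t => g t * w (e t)) L.
Proof.
intros Hg HG H0 HH HL.
set (P := fun l v => lsum (fun t => g t * sin_odd (e t) v) l).
set (P' := fun l v => lsum (fun t => g t * sin v ^ (2 * e t + 1)) l).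
assert (DP : forall l v, derivable_pt_lim (P l) v (P' l v)).
{ intros l v. apply (lsum_deriv _ (fun t v => g t * sin_odd (e t) v) (fun t v => g t * sin v ^ (2 * e t + 1))).
  intros t. apply derivable_pt_lim_scal, sin_odd_deriv. }
assert (P0 : forall l, P l 0 = 0).
{ intros l. apply lsum_0. intros t _. rewrite sin_odd_0. ring. }
assert (Ppos : forall v t, acute v -> 0 <= g t * sin v ^ (2 * e t + 1)).
{ intros v t Hv. apply Rmult_le_pos; auto. apply pow_le. assert (S := sin_range v ltac:(unfold acute in Hv; lra)). lra. }
assert (W0 : forall t, 0 <= g t * w (e t)).
{ intros t. apply Rmult_le_pos; auto. left; apply w_pos. }
assert (HP : forall l, NoDup l -> lsum (fun t => g t * w (e t)) l <= L).
{ intros l Hl. apply (limit_acute_le (P l) H); auto.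
  - intros v Hv. assert (K : P l v - P l 0 <= H v - H 0).
    { apply deriv_le with (P' l) G; auto; unfold acute in Hv; try lra.
      - intros x _. eapply deriv_cont, DP.
      - intros x Hx. eapply deriv_cont, HH. lra.
      - intros x Hx. apply HH. lra.
      - intros x Hx. apply hsum_pos_le; auto; [intros t; apply Ppos; unfold acute; lra|apply HG; unfold acute; lra]. }
    rewrite P0, H0 in K. lra.
  - replace (lsum (fun t => g t * w (e t)) l) with (P l (PI/2)).
    + apply limit_acute_cont. eapply deriv_cont, DP.
    + apply lsum_eq. intros t _. rewrite sin_odd_PI2. auto. }
destruct (hsum_pos_ex _ _ L W0 HP) as [s [Hs HsL]].
replace L with s; auto. apply Rle_antisym; auto.
apply (limit_acute_le H (fun _ => s)); auto; [|apply limit_cst].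
intros x Hx. assert (Hx' := Hx). unfold acute in Hx'.
apply Rnot_lt_le; intros Hlt.
(* If H x exceeded s, a finite list good up to [eps] at x would be good on all of (0, x), since the
   omitted terms increase with the angle. Integrating gives H x <= P l x + eps x, and this [eps]
   makes eps x half of the excess. *)
set (eps := (H x - s) / (2 * x)).
assert (He : 0 < eps) by (apply Rdiv_lt_0_compat; lra).
destruct (HG x Hx eps He) as [l0 K0].
destruct (list_undup _ l0) as [l [Hl Hl0]].
specialize (K0 l Hl ltac:(intros t Ht; apply Hl0; auto)).
assert (K : H x - H 0 <= (P l x + eps * x) - (P l 0 + eps * 0)).
{ apply (deriv_le H (fun v => P l v + eps * v) G (fun v => P' l v + eps * 1)); auto; try lra.
  - intros y Hy. eapply deriv_cont, HH. lra.
  - intros y Hy. apply continuity_pt_plus; [eapply deriv_cont, DP|].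
    eapply deriv_cont. apply (derivable_pt_lim_scal id), derivable_pt_lim_id.
  - intros y Hy. apply HH. lra.
  - intros y Hy. apply (derivable_pt_lim_plus (P l) (fun v => eps * v)); [apply DP|].
    apply (derivable_pt_lim_scal id), derivable_pt_lim_id.
  - intros y Hy. assert (Hya : acute y) by (unfold acute; lra).
    assert (D := hsum_minus _ _ _ _ _ (HG x Hx) (HG y Hya)).
    assert (Hm : forall t, 0 <= g t * sin x ^ (2 * e t + 1) - g t * sin y ^ (2 * e t + 1)).
    { intros t. rewrite <- Rmult_minus_distr_l. apply Rmult_le_pos; auto.
      assert (sin y ^ (2 * e t + 1) <= sin x ^ (2 * e t + 1)); [|lra].
      assert (S := sin_range y ltac:(lra)). assert (PI > 0) by apply PI_RGT_0.
      apply pow_incr; split; [lra|]. apply Rlt_le, sin_increasing_1; lra. }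
    assert (E := hsum_pos_le _ _ _ l Hm D Hl).
    assert (lsum (fun t => g t * sin x ^ (2 * e t + 1) - g t * sin y ^ (2 * e t + 1)) l = P' l x - P' l y) as E'.
    { apply lsum_minus. }
    rewrite E' in E. apply Rabs_def2 in K0. unfold P' in *. lra. }
rewrite H0, P0 in K.
assert (P l x <= s).
{ apply Rle_trans with (lsum (fun t => g t * w (e t)) l); [|apply hsum_pos_le; auto].
  apply lsum_le. intros t _. apply Rmult_le_compat_l; auto. apply sin_odd_bounds; auto. }
assert (eps * x = (H x - s) / 2) by (unfold eps; field; lra). lra.
Qed.

(** * Evaluations by integrating series in the sine *)

Lemma inv_odd_w_b n : / odd n = w n * b n.
Proof.
assert (A := odd_pos n). apply (Rmult_eq_reg_l (odd n)); [|lra].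
rewrite Rinv_r by lra. symmetry. apply w_b.
Qed.

(** Euler's argument: the arcsine series at sin v equals v, and integrating it termwise over
    [0, pi/2] gives pi^2 / 8. *)
Lemma hsum_inv_odd_2 : hsum (fun n => / (odd n * odd n)) (PI ^ 2 / 8).
Proof.
apply hsum_ext with (fun n => div_odd b n * w n).
{ intros n. unfold div_odd. assert (A := odd_pos n).
  replace (b n / odd n * w n) with (/ odd n * (w n * b n)) by (field; lra).
  rewrite <- inv_odd_w_b. field. lra. }
assert (P := PI_RGT_0).
apply (sine_integral nat (div_odd b) (fun n => n) (fun v => v) (fun v => / 2 * (v * v))).
- intros n. unfold div_odd. assert (A := odd_pos n). assert (B := b_pos n). left. apply Rdiv_lt_0_compat; lra.
- intros v Hv. assert (Hv' : 0 <= v < PI/2) by (unfold acute in Hv; lra).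
  assert (K := hsum_scal _ (sin v) _ _ (PSeries_hsum _ _ (div_odd_bounded _ b_bounded) (sin_sqr_range v Hv'))).
  rewrite arcsin_series in K by auto. eapply hsum_ext; [|exact K].
  intros n; cbv beta. rewrite pow_add, pow_mult. simpl (sin v ^ 2). rewrite !Rmult_1_r. simpl. ring.
- ring.
- intros v Hv. eapply deriv_val; [apply (derivable_pt_lim_scal (fun v => v * v)), (deriv_sqr id v 1), derivable_pt_lim_id|].
  unfold id. field.
- replace (PI ^ 2 / 8) with (/ 2 * ((PI/2) * (PI/2))) by field.
  apply (limit_acute_cont (fun v => / 2 * (v * v))).
  eapply deriv_cont. apply (derivable_pt_lim_scal (fun v => v * v)), (deriv_sqr id _ 1), derivable_pt_lim_id.
Qed.

Lemma hsum_parity (f : nat -> R) x y : hsum (fun k => f (2 * k)%nat) x -> hsum (fun k => f (2 * k + 1)%nat) y -> hsum f (x + y).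
Proof.
intros Hx Hy.
apply hsum_ext with (fun n => (if Nat.even n then f n else 0) + (if Nat.even n then 0 else f n)).
{ intros n; destruct (Nat.even n); ring. }
assert (E1 : forall k, Nat.even (2 * k) = true) by (intros; apply Nat.even_spec; exists k; lia).
assert (E2 : forall k, Nat.even (2 * k + 1) = false).
{ intros k. rewrite <- Nat.negb_odd. replace (Nat.odd (2 * k + 1)) with true; auto.
  symmetry; apply Nat.odd_spec; exists k; lia. }
apply hsum_plus.
- apply (hsum_inj _ _ (fun k => (2 * k)%nat)); [lia| |].
  + intros n Hn. destruct (Nat.even n) eqn:E; auto. apply Nat.even_spec in E. destruct E as [k Hk].
    exfalso; apply (Hn k); lia.
  + eapply hsum_ext; [|exact Hx]. intros k; cbv beta. rewrite E1; auto.
- apply (hsum_inj _ _ (fun k => (2 * k + 1)%nat)); [lia| |].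
  + intros n Hn. destruct (Nat.even n) eqn:E; auto. rewrite <- Nat.negb_odd in E.
    apply Bool.negb_false_iff, Nat.odd_spec in E. destruct E as [k Hk]. exfalso; apply (Hn k); lia.
  + eapply hsum_ext; [|exact Hy]. intros k; cbv beta. rewrite E2; auto.
Qed.

Lemma eta2 : hsum (fun i => (-1) ^ i / INR (S i) ^ 2) (PI ^ 2 / 12).
Proof.
destruct hsum_inv_sqr as [z Hz].
assert (Ho : hsum (fun k => / ((INR (2 * k) + 1) * (INR (2 * k) + 1))) (PI ^ 2 / 8)).
{ eapply hsum_ext; [|apply hsum_inv_odd_2]. intros k; unfold odd; cbv beta. rewrite mult_INR. simpl (INR 2). auto. }
assert (He : hsum (fun k => / ((INR (2 * k + 1) + 1) * (INR (2 * k + 1) + 1))) (/4 * z)).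
{ eapply hsum_ext; [|apply hsum_scal, Hz]. intros k; cbv beta. rewrite plus_INR, mult_INR. simpl (INR 2). simpl (INR 1).
  assert (Q := pos_INR k). field. lra. }
(* With z = zeta(2) this reads z = pi^2/8 + z/4; the alternating sum is pi^2/8 - z/4. *)
assert (E := hsum_unique Hz (hsum_parity (fun n => / ((INR n + 1) * (INR n + 1))) _ _ Ho He)).
replace (PI ^ 2 / 12) with (PI ^ 2 / 8 + (-1) * (/4 * z)) by lra.
apply hsum_parity.
- eapply hsum_ext; [|exact Ho]. intros k; cbv beta. rewrite S_INR, pow_mult.
  replace ((-1) ^ 2) with 1 by ring. rewrite pow1. assert (Q := pos_INR (2 * k)). field. lra.
- eapply hsum_ext; [|apply hsum_scal, He]. intros k; cbv beta. rewrite S_INR, pow_add, pow_mult.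
  replace ((-1) ^ 2) with 1 by ring. rewrite pow1. assert (Q := pos_INR (2 * k + 1)). field. lra.
Qed.

(** The limit of [w_div_odd_series] at pi/2. Abel's theorem applies on the tangent side, where the
    sum is already known; on the sine side the coefficients are nonnegative, so the limit both
    bounds the finite sums and is bounded by their supremum. *)
Lemma div_odd_w_sum : hsum (div_odd w) (2 * beta2).
Proof.
assert (P := PI_RGT_0).
assert (Hd : hsum (div_odd (div_odd chi)) beta2).
{ eapply hsum_ext; [|apply beta2_spec]. intros k; unfold div_odd; cbv beta. assert (A := odd_pos k). field. lra. }
assert (Hb : unit_bounded (div_odd (div_odd chi))) by (apply div_odd_bounded, div_odd_bounded, chi_bounded).
assert (HL : limit1_in (fun v => sin v * PSeries (div_odd w) (sin v * sin v)) acute (2 * beta2) (PI/2)).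
{ apply limit_ext_acute with (fun v => 2 * (tan_half v * PSeries (div_odd (div_odd chi)) (tan_half v * tan_half v))).
  - intros v Hv. symmetry. apply w_div_odd_series. unfold acute in Hv; lra.
  - replace (2 * beta2) with (2 * (1 * beta2)) by ring.
    apply limit_mul; [apply limit_cst|]. apply limit_mul; [apply tan_half_limit|apply abel_limit; auto]. }
assert (Hp : forall n, 0 <= div_odd w n).
{ intros n. left. apply Rdiv_lt_0_compat; [apply w_pos|apply odd_pos]. }
assert (HB : forall l, NoDup l -> lsum (div_odd w) l <= 2 * beta2).
{ intros l Hl. apply (limit_acute_le (fun v => sin v * lsum (fun n => div_odd w n * (sin v * sin v) ^ n) l) (fun v => sin v * PSeries (div_odd w) (sin v * sin v))); auto.
  - intros v Hv. assert (Hv' : 0 <= v < PI/2) by (unfold acute in Hv; lra).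
    assert (S := sin_range v Hv'). apply Rmult_le_compat_l; [lra|].
    apply hsum_pos_le; auto; [|apply PSeries_hsum; [apply div_odd_bounded, w_bounded|apply sin_sqr_range; auto]].
    intros n. apply Rmult_le_pos; auto. apply pow_le; nra.
  - replace (lsum (div_odd w) l) with (1 * lsum (fun n => div_odd w n * (1 * 1) ^ n) l).
    + apply limit_mul; [apply sin_limit|].
      apply (limit_lsum _ (fun n v => div_odd w n * (sin v * sin v) ^ n)). intros n.
      apply limit_mul; [apply limit_cst|]. apply limit_pow, limit_mul; apply sin_limit.
    + rewrite Rmult_1_l. apply lsum_eq. intros n _. rewrite Rmult_1_l, pow1. ring. }
destruct (hsum_pos_ex _ _ _ Hp HB) as [s [Hs HsL]].
replace (2 * beta2) with s; auto. apply Rle_antisym; auto.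
apply (limit_acute_le (fun v => sin v * PSeries (div_odd w) (sin v * sin v)) (fun _ => s)); auto; [|apply limit_cst].
intros v Hv. assert (Hv' : 0 <= v < PI/2) by (unfold acute in Hv; lra).
assert (S := sin_range v Hv'). assert (Y := sin_sqr_range v Hv').
assert (K := PSeries_hsum _ _ (div_odd_bounded _ w_bounded) Y).
assert (PSeries (div_odd w) (sin v * sin v) <= s).
{ eapply hsum_le; [|exact K|exact Hs]. intros n; cbv beta.
  assert ((sin v * sin v) ^ n <= 1) by (rewrite <- (pow1 n); apply pow_incr; lra). specialize (Hp n). nra. }
assert (0 <= PSeries (div_odd w) (sin v * sin v)).
{ eapply hsum_le; [|apply (hsum_0 nat (fun _ => 0)); auto|exact K]. intros n; cbv beta.
  apply Rmult_le_pos; auto. apply pow_le; lra. }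
nra.
Qed.

Lemma w_cv : Un_cv w 0.
Proof.
intros eps He. destruct (archimed_cor1 (eps * eps) ltac:(nra)) as [N [HN1 HN2]].
exists N. intros n Hn. unfold Rdist. rewrite Rminus_0_r, Rabs_right by (assert (W := w_pos n); lra).
assert (A := w_sqr_le n). assert (W := w_pos n).
assert (0 < INR N) by (apply lt_0_INR; lia). assert (INR N <= INR n) by (apply le_INR; lia).
assert (/ (INR n + 1) <= / INR N) by (apply Rinv_le_contravar; lra). nra.
Qed.

(** The recurrence of w reads (2m+2) w_(m+1+k) = (2m+1) w_(m+k) + (2k+1)(w_(m+k) - w_(m+1+k)).
    Divided by 2k+1 and summed over k, the last part telescopes to w_m, which is the recurrence of
    b_m [wsum m]. *)
Lemma w_shift_sum m : hsum (fun k => w (m + k) / odd k) (b m * wsum m).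
Proof.
induction m.
- rewrite b_0. simpl wsum. rewrite Rmult_1_l. apply div_odd_w_sum.
- assert (Q := pos_INR m).
  assert (Ht : hsum (fun k => w (m + k) - w (S m + k)) (w m)).
  { apply infinite_sum_hsum.
    - intros k. assert (A := w_S (m + k)). assert (B := w_pos (m + k)). assert (Q' := pos_INR (m + k)).
      simpl Nat.add. nra.
    - replace (w m) with (0 - (- w (m + 0))) by (rewrite Nat.add_0_r; ring).
      apply (tele_infinite _ (fun k => - w (m + k))).
      + intros k. replace (m + S k)%nat with (S m + k)%nat by lia. ring.
      + rewrite <- Ropp_0. apply CV_opp. intros eps He. destruct (w_cv eps He) as [N HN].
        exists N. intros n Hn. apply HN. lia. }
  replace (b (S m) * wsum (S m)) with (/ (2 * INR m + 2) * ((2 * INR m + 1) * (b m * wsum m) + w m)).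
  + eapply hsum_ext; [|apply hsum_scal, hsum_plus; [apply hsum_scal, IHm|apply Ht]].
    intros k; cbv beta. assert (A := w_S (m + k)). rewrite plus_INR in A. assert (B := odd_pos k).
    change (S m + k)%nat with (S (m + k)). unfold odd in *.
    apply (Rmult_eq_reg_l ((2 * INR m + 2) * (2 * INR k + 1))); [|nra].
    field_simplify; try lra. 
  + simpl wsum. apply (Rmult_eq_reg_l (2 * INR m + 2)); [|lra].
    rewrite <- Rmult_assoc, Rinv_r, Rmult_1_l by lra.
    transitivity (((2 * INR m + 1) * b m) * wsum m + ((2 * INR m + 2) * (w m * b (S m))) * w m).
    * rewrite w_b_S. ring.
    * rewrite <- b_S. ring.
Qed.

(** The product of artanh z and the inverse tangent integral of z is z^2 times the series in z^2
    with these coefficients; [kappa_int] integrates that series in the variable z^2. *)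
Definition kappa : nat -> R := PS_mult (div_odd (fun _ => 1)) (div_odd (div_odd chi)).
Definition kappa_int (n : nat) : R := kappa n / (INR n + 1).

Lemma kappa_int_bounded : unit_bounded kappa_int.
Proof.
intros n. unfold kappa_int, Rdiv. assert (Q := pos_INR n).
rewrite Rabs_mult, (Rabs_right (/ _)) by (inv_ge0; lra).
apply (Rmult_le_reg_r (INR n + 1)); [lra|]. rewrite Rmult_assoc, Rinv_l, Rmult_1_l, Rmult_1_r by lra.
unfold kappa, PS_mult. eapply Rle_trans; [apply Rsum_abs|].
replace (INR n + 1) with (sum_f_R0 (fun _ => 1) n) by (rewrite sum_cte, S_INR; ring).
apply sum_Rle. intros k Hk. rewrite Rabs_mult.
assert (A := div_odd_bounded _ one_bounded k).
assert (B := div_odd_bounded _ (div_odd_bounded _ chi_bounded) (n - k)%nat).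
assert (A' := Rabs_pos (div_odd (fun _ => 1) k)). assert (B' := Rabs_pos (div_odd (div_odd chi) (n - k))). nra.
Qed.

(** On the antidiagonal i + j = n one has odd i + odd j = 2 (n+1), so the factor 1/(n+1) from
    integration is twice the factor 1/(a+c) of [tornheim]. *)
Lemma kappa_int_sum : hsum kappa_int (2 * (3/2 * beta4 - PI/4 * lambda3)).
Proof.
assert (K := hsum_scal _ 2 _ _ tornheim_spec).
apply (hsum_fibers _ _ Nat.eq_dec (fun x => fst x + snd x)%nat _ _ _ K).
intros n. set (l := map (fun k => (k, n - k)%nat) (seq 0 (S n))).
assert (Hl : NoDup l).
{ unfold l. apply NoDup_map_inj; [congruence|apply seq_NoDup]. }
assert (H := hsum_fin _ (fun x => if Nat.eq_dec (fst x + snd x) n then 2 * tornheim x else 0) l Hl).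
replace (kappa_int n) with (lsum (fun x => if Nat.eq_dec (fst x + snd x) n then 2 * tornheim x else 0) l).
- apply H. intros [i j] Hx; cbn [fst snd]. destruct (Nat.eq_dec (i + j) n) as [E|]; auto.
  exfalso; apply Hx. unfold l. apply in_map_iff. exists i. split; [f_equal; lia|apply in_seq; lia].
- unfold l. rewrite lsum_map, lsum_seq. unfold kappa_int, kappa, PS_mult, Rdiv.
  rewrite (Rmult_comm (sum_f_R0 _ _)), scal_sum. apply sum_eq. intros k Hk. cbn [fst snd].
  destruct (Nat.eq_dec (k + (n - k)) n) as [_|]; [|lia]. unfold tornheim, div_odd; cbn [fst snd].
  assert (A := odd_pos k). assert (B := odd_pos (n - k)). assert (Q := pos_INR n).
  replace (odd k + odd (n - k)) with (2 * (INR n + 1)) by (unfold odd; rewrite minus_INR by auto; ring).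
  field. lra.
Qed.

(** The integrand is the product of the series of [w_div_odd_series] and [artanh_series], divided by
    sin v. With z = tan(v/2), dv / sin v = dz / z, so the integral is that of 4 artanh z times the
    inverse tangent integral, against dz / z; its antiderivative is 2 times the series of
    [kappa_int] shifted by one power of z^2. *)
Lemma w_double_sum : hsum (fun x : nat * nat => div_odd w (fst x) * div_odd (fun _ => 1) (snd x) * w (fst x + snd x))
  (4 * (3/2 * beta4 - PI/4 * lambda3)).
Proof.
assert (P := PI_RGT_0). set (T := 3/2 * beta4 - PI/4 * lambda3).
apply (sine_integral _ (fun x : nat * nat => div_odd w (fst x) * div_odd (fun _ => 1) (snd x)) (fun x => fst x + snd x)%nat
  (fun v => sin v * (PSeries (div_odd w) (sin v * sin v) * PSeries (div_odd (fun _ => 1)) (sin v * sin v)))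
  (fun v => 2 * PSeries (PS_incr_1 kappa_int) (tan_half v * tan_half v))).
- intros [m k]; cbn [fst snd]. assert (A := odd_pos k). assert (B := odd_pos m). assert (W := w_pos m).
  apply Rmult_le_pos; left; apply Rdiv_lt_0_compat; lra.
- intros v Hv. assert (Hv' : 0 <= v < PI/2) by (unfold acute in Hv; lra). assert (Y := sin_sqr_range v Hv').
  eapply hsum_ext; [|apply hsum_scal, (hsum_mul (PSeries_hsum _ _ (div_odd_bounded _ w_bounded) Y)
    (PSeries_hsum _ _ (div_odd_bounded _ one_bounded) Y))].
  intros [m k]; cbn [fst snd]. rewrite pow_add, pow_mult, pow_add.
  replace (sin v ^ 2) with (sin v * sin v) by ring. rewrite pow_1. ring.
- rewrite tan_half_0, Rmult_0_l, PSeries_0. simpl. unfold zero; simpl. ring.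
- intros v Hv. assert (C := cos_pos v Hv).
  eapply deriv_val.
  + apply (derivable_pt_lim_scal (fun v => PSeries (PS_incr_1 kappa_int) (tan_half v * tan_half v))).
    apply deriv_PSeries_sqr; [|apply tan_half_range'; auto|apply tan_half_deriv; auto].
    intros [|n]; simpl; [unfold zero; simpl; rewrite Rabs_R0; lra|apply kappa_int_bounded].
  + assert (Y := tan_half_sqr_range v Hv).
    assert (E : PSeries (PS_derive (PS_incr_1 kappa_int)) (tan_half v * tan_half v) =
       PSeries (div_odd (fun _ => 1)) (tan_half v * tan_half v) * PSeries (div_odd (div_odd chi)) (tan_half v * tan_half v)).
    { rewrite <- PSeries_mult.
      - apply PSeries_ext. intros n. unfold PS_derive. cbn [PS_incr_1]. fold kappa. unfold kappa_int.
        rewrite S_INR. assert (Q := pos_INR n). field. lra.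
      - apply unit_radius; [apply div_odd_bounded, one_bounded|rewrite Rabs_right; lra].
      - apply unit_radius; [apply div_odd_bounded, div_odd_bounded, chi_bounded|rewrite Rabs_right; lra]. }
    (* The identities for the two series carry a factor sin v, which can be cancelled only away from
       v = 0. *)
    rewrite E. destruct (Req_dec v 0) as [->|Hne]; [rewrite tan_half_0, sin_0; ring|].
    assert (S : 0 < sin v < 1) by (apply sin_01; lra).
    apply (Rmult_eq_reg_l (sin v)); [|lra].
    assert (E1 := w_div_odd_series v Hv). assert (E2 := artanh_series v Hv).
    set (cw := PSeries (div_odd w) (sin v * sin v)) in *.
    set (cs := PSeries (div_odd (fun _ => 1)) (sin v * sin v)) in *.
    transitivity ((sin v * cw) * (sin v * cs)); [|ring].
    rewrite E1, E2. rewrite (tan_half_sin v Hv) at 1. field. lra.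
- apply limit_ext_acute with (fun v => 2 * (tan_half v * tan_half v * PSeries kappa_int (tan_half v * tan_half v))).
  { intros v _. rewrite PSeries_incr_1. auto. }
  replace (4 * T) with (2 * (1 * 1 * (2 * T))) by ring.
  apply limit_mul; [apply limit_cst|]. apply limit_mul; [apply limit_mul; apply tan_half_limit|].
  apply abel_limit; [apply kappa_int_bounded|apply kappa_int_sum].
Qed.

(** One factor w_m b_m = 1/(2m+1) of w_m^2 M_m is split off through [moment_wsum]; the rest, b_m
    [wsum m], is opened by [w_shift_sum] into a series in w_(m+k). *)
Lemma moment_sum : hsum (fun m => w m * w m * moment m) (2 / PI * (4 * (3/2 * beta4 - PI/4 * lambda3))).
Proof.
assert (P := PI_RGT_0).
apply hsum_ext with (fun m => 2 / PI * (div_odd w m * (b m * wsum m))).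
{ intros m. rewrite moment_wsum. unfold div_odd, Rdiv. rewrite inv_odd_w_b. ring. }
apply hsum_scal. apply (hsum_fubini _ _ _ _ _ w_double_sum). intros m; cbn [fst snd].
eapply hsum_ext; [|apply hsum_scal, w_shift_sum]. intros k; unfold div_odd; cbv beta. assert (A := odd_pos k). field.
assert (B := odd_pos m). lra.
Qed.

(** * The Kampe de Feriet series *)

Lemma poch_1 n : poch 1 n = INR (fact n).
Proof. induction n; [simpl; auto|]. rewrite fact_S. simpl poch. rewrite IHn. ring. Qed.

Lemma poch_3_2 n : poch (3/2) n = poch (1/2) n * (2 * INR n + 1).
Proof. induction n; [simpl; field|]. rewrite S_INR. simpl poch. rewrite IHn. field. Qed.

Lemma poch_5_2 n : 3 * poch (5/2) n = poch (3/2) n * (2 * INR n + 3).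
Proof.
induction n; [simpl; field|]. rewrite S_INR. simpl poch.
rewrite <- Rmult_assoc, IHn. field.
Qed.

(** The quotient (1/2)_(m+n) / (3/2)_(m+n) is 1/(2m+2n+1), and m! cancels one of the three factors
    (1)_m. *)
Lemma kdf_term_1 m n :
  kdf_term (1/2 :: nil) (3/2 :: nil) (1 :: 1 :: 1 :: nil) (3/2 :: 3/2 :: nil) (1/2 :: 1/2 :: nil) (1 :: nil) 1 1 m n
  = w m * w m * (b n * b n / (2 * INR m + 2 * INR n + 1)).
Proof.
unfold kdf_term, prodl; simpl map; simpl fold_right.
rewrite !poch_1, !pow1, (poch_3_2 (m + n)), plus_INR. unfold w, b.
assert (A := poch_pos (1/2) (m + n) ltac:(lra)). assert (B := poch_pos (3/2) m ltac:(lra)).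
assert (F := fact_pos m). assert (F' := fact_pos n). assert (Q := pos_INR m). assert (Q' := pos_INR n).
field. repeat split; lra.
Qed.

Lemma kdf_term_2 m n :
  kdf_term (3/2 :: nil) (5/2 :: nil) (1 :: 1 :: 1 :: nil) (3/2 :: 3/2 :: nil) (1/2 :: 1/2 :: nil) (1 :: nil) 1 1 m n
  = 3 * (w m * w m) * (b n * b n / (2 * INR (S m) + 2 * INR n + 1)).
Proof.
unfold kdf_term, prodl; simpl map; simpl fold_right.
assert (Q := pos_INR m). assert (Q' := pos_INR n).
replace (poch (5/2) (m + n)) with (poch (3/2) (m + n) * (2 * INR (m + n) + 3) / 3) by (rewrite <- poch_5_2; field).
rewrite !poch_1, !pow1, plus_INR, S_INR. unfold w, b.
assert (A := poch_pos (3/2) (m + n) ltac:(lra)). assert (B := poch_pos (3/2) m ltac:(lra)).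
assert (F := fact_pos m). assert (F' := fact_pos n).
field. repeat split; lra.
Qed.

(** Here [mu] is the identity for the first series and the successor for the second. All terms are
    nonnegative, so summation by rows determines the double sum. *)
Lemma kdf_sum (c : R) (f : nat -> nat -> R) (mu : nat -> nat) s : 0 <= c ->
  (forall m n, f m n = c * (w m * w m) * (b n * b n / (2 * INR (mu m) + 2 * INR n + 1))) ->
  hsum (fun m => w m * w m * moment (mu m)) s -> double_sum_is f (c * s).
Proof.
intros Hc E H.
apply (hsum_double_sum (fun x => f (fst x) (snd x))).
apply (hsum_tonelli _ _ _ (fun m => c * (w m * w m * moment (mu m)))); [| |apply hsum_scal, H].
- intros [m n]; cbn [fst snd]. rewrite E. assert (A := w_pos m). assert (B := b_pos n).
  assert (Q := pos_INR (mu m)). assert (Q' := pos_INR n).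
  apply Rmult_le_pos; [nra|]. left. apply Rdiv_lt_0_compat; nra.
- intros m; cbn [fst snd]. rewrite <- Rmult_assoc.
  eapply hsum_ext; [|apply hsum_scal, moment_spec]. intros n; cbv beta. rewrite E. auto.
Qed.

Theorem theorem2 :
  exists L F1 F2 : R,
    L_f_4_is L /\
    kdf_is (1/2 :: nil) (3/2 :: nil) (1 :: 1 :: 1 :: nil) (3/2 :: 3/2 :: nil)
           (1/2 :: 1/2 :: nil) (1 :: nil) 1 1 F1 /\
    kdf_is (3/2 :: nil) (5/2 :: nil) (1 :: 1 :: 1 :: nil) (3/2 :: 3/2 :: nil)
           (1/2 :: 1/2 :: nil) (1 :: nil) 1 1 F2 /\
    L = PI ^ 3 / 288 * (3 * F1 + F2).
Proof.
assert (P := PI_RGT_0).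
exists (PI ^ 2 / 12 * beta4), (1 * (2 / PI * (4 * (3/2 * beta4 - PI/4 * lambda3)))), (3 * (4 / PI * (PI/2 * lambda3 - beta4))).
split; [|split; [|split]].
- apply L_f_4_product; [exact beta4_spec|exact eta2].
- apply (kdf_sum 1 _ (fun m => m)); [lra| |exact moment_sum]. intros m n. rewrite kdf_term_1. ring.
- apply (kdf_sum 3 _ S); [lra| |exact moment_S_sum]. intros m n. apply kdf_term_2.
(* The values are F1 = (12/pi) beta(4) - 2 lambda(3) and F2 = 6 lambda(3) - (12/pi) beta(4), so 3 F1
   + F2 = (24/pi) beta(4), and pi^3/288 times this is pi^2/12 beta(4). *)
- field. lra.
Qed.
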